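(* Let $\Theta\subseteq S^1$ be an arc of positive length in the unit circle and let $\mathcal{S}_\Theta=\{u\in\mathbb{R}^2\setminus\{0\}: u/\|u\|\in\Theta\}$ be the corresponding sector of the plane. For every primitive integral vector $v=(a,b)\in\mathbb{Z}^2$ let $w_v$ and $\theta_v$ be as in the context. Then, for primitive integral vectors $v\in\mathcal{S}_\Theta$ with $\|v\|\to\infty$: 1. The ratios $\|w_v\|/\|v\|$ become effectively equidistributed in $[0,1/2]$. 2. The values $v/\|v\|$ become effectively equidistributed in $\Theta$. 3. The values $w_v/\|w_v\|$ become effectively equidistributed in $\Theta$ when $v$ is restricted to positive vectors, and in $-\Theta$ when $v$ is restricted to negative vectors. In particular, when $|\Theta|\le\pi$, the values $w_v/\|w_v\|$ become effectively equidistributed in $\Theta$, in $-\Theta$ and in $\Theta\cup-\Theta$ (that is, for each of these three sets $X$, the values $w_v/\|w_v\|$ that lie in $X$ become effectively equidistributed in $X$). 4. The ratios $\|w_v\|/\|v\|$ become effectively equidistributed in $[0,1/2]$, and the values $v/\|v\|$ become effectively equidistributed in $\Theta$, also when $v$ is restricted to positive vectors only, or to negative vectors only. In each of the effective equidistribution statements made in items 1, 2, 3 and 4 of this theorem, the rate of convergence is $O(\|v\|^{-1/4}\log\|v\|)$.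
   Context: $\|\cdot\|$ is the Euclidean norm on $\mathbb{R}^2$. An integral vector $v=(a,b)\in\mathbb{Z}^2$ is primitive if $\gcd(a,b)=1$. $w_v$ is the shortest integral vector completing $v$ to a (positively oriented) basis of $\mathbb{Z}^2$, namely the shortest solution $(x,y)\in\mathbb{Z}^2$ of the gcd equation $bx-ay=1$ (in case of a tie, which happens only for finitely many $v$, either choice is made). $\theta_v$ is the angle from $w_v$ to $v$, measured anticlockwise; $v$ is called positive if $\theta_v$ is acute and negative if $\theta_v$ is obtuse. $|\Theta|$ is the arc length of $\Theta$ and $-\Theta=\{-u:u\in\Theta\}$. Effective equidistribution: let $V$ be a set of primitive vectors, let $(x_v)_{v\in V}$ be points of $Y$ ($Y=\mathbb{R}$ or $Y=S^1$), and let $X\subset Y$ be $[0,1/2]$, an arc, or a union of two arcs, with normalized (probability) Lebesgue/arc-length measure $\lambda$. The values $x_v$ become effectively equidistributed in $X$ at rate $O(r(\|v\|))$ if for every compactly supported Lipschitz function $f:Y\to\mathbb{R}$ there are $C,R_0>0$ such that for all $R\ge R_0$, with $V_R=\{v\in V:\|v\|\le R\}$, $$\left|\frac{1}{\#V_R}\sum_{v\in V_R}f(x_v)-\int_X f\,d\lambda\right|\le C\,r(R).$$ *)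

(* Defs.v *)
From HB Require Import structures.
From mathcomp Require Import all_boot all_order all_algebra finmap.
From mathcomp Require Import all_classical all_reals all_analysis.
From mathcomp Require Import measurable_realfun.

Set Implicit Arguments.
Unset Strict Implicit.
Unset Printing Implicit Defensive.

Import Order.TTheory GRing.Theory Num.Theory.
Import numFieldNormedType.Exports.

Local Open Scope classical_set_scope.
Local Open Scope ring_scope.

(* The Euclidean norm; the library norm on [R * R] is the sup norm. *)
Definition enorm (R : realType) (u : R * R) : R :=
  Num.sqrt (u.1 ^+ 2 + u.2 ^+ 2).

Definition dir (R : realType) (u : R * R) : R * R := (enorm u)^-1 *: u.

Definition vec (R : realType) (v : int * int) : R * R := (v.1%:~R, v.2%:~R).

Definition primitive (v : int * int) : bool := coprimez v.1 v.2.

Definition gcd_solution (v w : int * int) : Prop :=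
  v.2 * w.1 - v.1 * w.2 = 1.

(* [w] is a shortest solution; it need not be the only one. *)
Definition shortest_solution (R : realType) (v w : int * int) : Prop :=
  gcd_solution v w /\
  forall w', gcd_solution v w' -> enorm (vec R w) <= enorm (vec R w').

Definition rotation (R : realType) (t : R) (u : R * R) : R * R :=
  (cos t * u.1 - sin t * u.2, sin t * u.1 + cos t * u.2).

(* The angle in [0, 2 pi) from [u] to [v], measured anticlockwise; it exists
   and is unique when [u] and [v] are nonzero. *)
Definition angle_from (R : realType) (u v : R * R) : R :=
  xget 0 [set t | 0 <= t < 2 * pi /\ dir v = rotation t (dir u)].

Definition positive_vector (R : realType) (v w : int * int) : Prop :=
  0 < angle_from (vec R w) (vec R v) < pi / 2.

Definition negative_vector (R : realType) (v w : int * int) : Prop :=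
  pi / 2 < angle_from (vec R w) (vec R v) < pi.

Definition circle (R : realType) : set (R * R) := [set u | enorm u = 1].

Definition cis (R : realType) (t : R) : R * R := (cos t, sin t).

(* The two booleans say which endpoints belong to the arc. The full circle and
   the circle minus a point are arcs, and so are single points. *)
Definition is_arc (R : realType) (Theta : set (R * R)) : Prop :=
  exists (a l : R) (b1 b2 : bool), 0 <= l <= 2 * pi /\
    Theta = (@cis R) @` [set` Interval (BSide b1 a) (BSide b2 (a + l))].

Definition opp_set (R : realType) (A : set (R * R)) : set (R * R) :=
  [set - u | u in A].

Definition sector (R : realType) (Theta : set (R * R)) : set (R * R) :=
  [set u | u != 0 /\ Theta (dir u)].

Lemma measurable_cis (R : realType) : measurable_fun [set: R] (@cis R).
Proof.
apply: measurable_fun_pair; apply: continuous_measurable_fun.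
- exact: continuous_cos.
- exact: continuous_sin.
Qed.

Lemma measurable_period (R : realType) :
  measurable (`[0, 2 * pi[%classic : set R).
Proof. exact: measurable_itv. Qed.

(* Arc length on the unit circle, as a Borel measure on the plane. *)
Definition arc_length (R : realType) : set (R * R) -> \bar R :=
  pushforward (mrestr (@lebesgue_measure R) (@measurable_period R)) (@cis R).

Section arc_length_measure.
Variable R : realType.

Let mcis := @measurable_cis R.

Let arc_length0 : @arc_length R set0 = 0%E.
Proof. by rewrite /arc_length measure0. Qed.

Let arc_length_ge0 (A : set (R * R)) : (0 <= arc_length A)%E.
Proof. exact: measure_ge0. Qed.

Let arc_length_sigma_additive : semi_sigma_additive (@arc_length R).
Proof.
by rewrite /arc_length; apply: measure_semi_sigma_additive; exact: mcis.
Qed.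

HB.instance Definition _ := isMeasure.Build _ _ _ (@arc_length R)
  arc_length0 arc_length_ge0 arc_length_sigma_additive.

End arc_length_measure.

(* The integral of [f] over [X] against the normalized restriction of [mu]. *)
Definition mean (d : measure_display) (T : measurableType d) (R : realType)
    (mu : {measure set T -> \bar R}) (X : set T) (f : T -> R) : R :=
  (\int[mu]_(x in X) f x) / fine (mu X).

Definition lipschitz_wrt (R : realType) (T : Type) (dist : T -> T -> R)
    (Y : set T) (f : T -> R) : Prop :=
  exists L : R, forall y z, Y y -> Y z -> `|f y - f z| <= L * dist y z.

Definition truncation (R : realType) (V : set (int * int)) (r : R) :
    set (int * int) :=
  [set v | V v /\ enorm (vec R v) <= r].

(* A test function on the closed set [Y] is represented by a function on the
   ambient space [T], of which only the values on [Y] matter. [lambda] is the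
   integral against the limiting probability measure. The truncations are
   finite, so [fset_set] lists their elements. *)
Definition effectively_equidistributed (R : realType) (T : topologicalType)
    (dist : T -> T -> R) (Y : set T) (lambda : (T -> R) -> R)
    (V : set (int * int)) (x : int * int -> T) (rate : R -> R) : Prop :=
  forall f : T -> R,
    lipschitz_wrt dist Y f ->
    compact (closure [set y | Y y /\ f y != 0]) ->
    exists C R0 : R, 0 < C /\ 0 < R0 /\
      forall r : R, R0 <= r ->
        `| (#|` fset_set (truncation V r)|%fset%:R)^-1 *
             \sum_(v <- fset_set (truncation V r)) f (x v) - lambda f |
        <= C * rate r.

Definition equidistributed_line (R : realType) (V : set (int * int))
    (x : int * int -> R) (X : set R) (rate : R -> R) : Prop :=
  effectively_equidistributed (fun y z : R => `|y - z|) [set: R]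
    (mean (@lebesgue_measure R) X) V x rate.

Definition equidistributed_circle (R : realType) (V : set (int * int))
    (x : int * int -> R * R) (X : set (R * R)) (rate : R -> R) : Prop :=
  effectively_equidistributed (fun y z : R * R => enorm (y - z)) (@circle R)
    (mean (@arc_length R) X) V x rate.

(* Main.v *)
(** For v = (a,b) with shortest companion w, put lam = <w,v>/|v|^2, so that
    w = lam v + u with u orthogonal to v and |u| = 1/|v|.  Then |lam| <= 1/2,
    the ratio |w|/|v| differs from |lam| by at most 1/|v|, the direction of w
    differs from that of sgn(lam) v by O(1/|v|), and v is positive or negative
    according to the sign of lam.  So everything follows from counting the
    primitive v of norm at most R in a thin sector with lam in a given interval.

    Since b x - a y = 1, the first coordinate x of w is an inverse of b modulo a,
    and a lam is within 1/2 of x.  One has to count the pairs of mutually inverse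
    residues modulo a in a product of two intervals.  Fourier inversion of
    smoothed intervals turns this into Kloosterman sums S(j,m), whose fourth
    moment over all frequencies is elementary: it counts x + y = z + t,
    1/x + 1/y = 1/z + 1/t.  As S(ju,m/u) = S(j,m), the low frequencies lie on
    essentially disjoint orbits of the unit group, so that their share of the
    moment is smaller by a factor phi(a).  The error is a^(3/4) (tau(a) + log a)
    for the modulus a, hence R^(7/4) log R for all a <= R.

    The number of primitive v in a sector is evaluated by Moebius inversion in
    triangles.  The main terms contain a truncated sum of mu(d)/d^2, which
    cancels in the averages.  Abel summation passes from counting functions
    to Lipschitz functions.  In the last part of item 3 the sign of lam decides
    whether the direction of w is in Theta or in its opposite, except for the v
    within O(1/|v|) of an end of Theta, and these are negligible. *)

Require Import Defs.
From mathcomp Require Import all_boot all_order all_algebra finmap.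
From mathcomp Require Import cyclic complex.
From mathcomp Require Import all_classical all_reals all_analysis.
From mathcomp Require Import measurable_realfun.
From mathcomp Require Import zify ring lra.

Set Implicit Arguments.
Unset Strict Implicit.
Unset Printing Implicit Defensive.

Import Order.TTheory GRing.Theory Num.Theory.
Import numFieldNormedType.Exports.

Local Open Scope classical_set_scope.
Local Open Scope ring_scope.

(** * Kloosterman sums and their moments *)

(** Weil's bound for a single Kloosterman sum is avoided. Inserted directly by Hoelder's inequality,
    the fourth moment over all frequencies gives only the trivial order [a]. Hence a cut at about
    [sqrt(a/2)]: for a fixed low [j] the products [j m] with low [m] are distinct modulo [a], which
    separates the orbits. Beyond the cut the bound [|S(j,m)| <= a] has to suffice, and for that the
    Fourier coefficients must decay quadratically; this is what the smoothing is for. Smoothing over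
    [H] residues costs [O(H)] and leaves a tail [a^(3/2) / H] up to logarithms, so [H] is about
    [a^(3/4)]. The zero frequency of one interval is kept exactly, so the number of coprime residues
    in a short interval is never evaluated: it is summed over the rows of a sector and compared with
    the number of primitive points there. Slopes are confined to [[-1, 0]] or [[0, 1]] so that a row
    is at most one period of its modulus; quarter turns of the lattice reach the rest of the
    plane. *)

Section ElementarySums.
Variable R : rcfType.

Definition rt4 (x : R) : R := Num.sqrt (Num.sqrt x).

Lemma rt4_ge0 x : 0 <= rt4 x. Proof. exact: sqrtr_ge0. Qed.

Lemma rt4_gt0 x : 0 < x -> 0 < rt4 x.
Proof. by move=> x0; rewrite !sqrtr_gt0. Qed.

Lemma rt4X4 x : 0 <= x -> rt4 x ^+ 4 = x.
Proof.
move=> x0; rewrite -[4%N]/(2 * 2)%N exprM /rt4 sqr_sqrtr ?sqrtr_ge0 //.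
by rewrite sqr_sqrtr.
Qed.

Lemma rt4_sqr x : rt4 x ^+ 2 = Num.sqrt x.
Proof. by rewrite sqr_sqrtr // sqrtr_ge0. Qed.

Lemma ler_rt4 x y : x <= y -> rt4 x <= rt4 y.
Proof. by move=> xy; rewrite !ler_wsqrtr. Qed.

Lemma rt4M x y : 0 <= x -> rt4 (x * y) = rt4 x * rt4 y.
Proof. by move=> x0; rewrite /rt4 sqrtrM // sqrtrM ?sqrtr_ge0. Qed.

Lemma rt4_1 : rt4 1 = 1. Proof. by rewrite /rt4 !sqrtr1. Qed.

(** A discrete form of the derivative of [x^(-1/4)], made for telescoping. The constant is 8 instead
    of 4 because [k + 1 <= 2 k] is used to pass from [k + 1] to [k]. *)
Lemma inv_rt4_step (k : nat) : (0 < k)%N ->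
  (k%:R * rt4 k%:R)^-1 <= 8 * ((rt4 k%:R)^-1 - (rt4 k.+1%:R)^-1).
Proof.
move=> k0; set q := rt4 k%:R; set p := rt4 k.+1%:R.
have k0R : (1 : R) <= k%:R by rewrite ler1n.
have q0 : 0 < q by apply: rt4_gt0; rewrite ltr0n.
have qp : q <= p by apply: ler_rt4; rewrite ler_nat.
have p0 : 0 < p by exact: lt_le_trans qp.
have q4 : q ^+ 4 = k%:R by rewrite rt4X4.
have p4 : p ^+ 4 = k%:R + 1 by rewrite rt4X4 // -natr1.
have e : q^-1 - p^-1 = (p - q) / (p * q).
  by field; rewrite !gt_eqF.
rewrite e -q4 mulrA ler_pdivlMr ?mulr_gt0 // [leLHS]mulrC.
rewrite ler_pdivrMr ?mulr_gt0 ?exprn_gt0 //.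
have h1 : (p - q) * (4 * p ^+ 3) >= 1.
  have e1 : (p - q) * (p ^+ 3 + p ^+ 2 * q + p * q ^+ 2 + q ^+ 3) = 1.
    by rewrite -[RHS](addrK (k%:R)) [1 + _]addrC -p4 -q4; ring.
  rewrite -[leLHS]e1; apply: ler_wpM2l; first by rewrite subr_ge0.
  have : q ^+ 2 <= p ^+ 2 by rewrite lerXn2r // nnegrE ltW.
  have : q ^+ 3 <= p ^+ 3 by rewrite lerXn2r // nnegrE ltW.
  have : p ^+ 2 * q <= p ^+ 3 by rewrite [leRHS]exprSr ler_wpM2l // exprn_ge0 // ltW.
  have : p * q ^+ 2 <= p ^+ 3.
    by rewrite [leRHS]exprS ler_wpM2l ?(ltW p0) // lerXn2r // nnegrE ltW.
  by move=> *; lra.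
have h2 : p ^+ 4 <= 2 * q ^+ 4 by rewrite p4 q4; lra.
have : p * q <= ((p - q) * (4 * p ^+ 3)) * (p * q) by rewrite ler_peMl // mulr_ge0 // ltW.
move=> /le_trans; apply.
have -> : (p - q) * (4 * p ^+ 3) * (p * q) = (p - q) * 4 * q * p ^+ 4 by ring.
have -> : 8 * (p - q) * (q ^+ 4 * q) = (p - q) * 4 * q * (2 * q ^+ 4) by ring.
by apply: ler_wpM2l => //; rewrite !mulr_ge0 // ?subr_ge0 // ltW.
Qed.

Lemma sum_inv_rt4_le (j N : nat) : (0 < j)%N ->
  \sum_(j <= k < N) (k%:R * rt4 k%:R)^-1 <= 8 / rt4 j%:R.
Proof.
move=> j0.
case: (leqP N j) => [Nj|jN].
  by rewrite big_geq // mulr_ge0 // invr_ge0 rt4_ge0.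
apply: (@le_trans _ _ (\sum_(j <= k < N) 8 * (- (rt4 k.+1%:R)^-1 - - (rt4 k%:R)^-1))).
  apply: ler_sum_nat => k /andP[jk _]; rewrite opprK addrC.
  by apply: inv_rt4_step; exact: leq_trans jk.
rewrite -mulr_sumr telescope_sumr ?(ltnW jN) // ler_wpM2l //.
by rewrite opprK gerDr oppr_le0 invr_ge0 rt4_ge0.
Qed.

Lemma sum_inv_sqrt_le (N : nat) :
  \sum_(1 <= k < N.+1) (Num.sqrt (k%:R : R))^-1 <= 2 * Num.sqrt N%:R.
Proof.
elim: N => [|N IH]; first by rewrite big_geq // mulr_ge0 // sqrtr_ge0.
rewrite big_nat_recr //=; apply: le_trans (lerD IH (lexx _)) _.
set q := Num.sqrt N%:R; set p := Num.sqrt N.+1%:R.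
have p0 : 0 < p by rewrite sqrtr_gt0 ltr0n.
have q0 : 0 <= q by rewrite sqrtr_ge0.
have q2 : q ^+ 2 = N%:R by rewrite sqr_sqrtr.
have p2 : p ^+ 2 = N%:R + 1 by rewrite sqr_sqrtr // -natr1.
rewrite -(ler_pM2r p0) mulrDl mulVf ?gt_eqF //.
have -> : 2 * p * p = 2 * p ^+ 2 by ring.
by have := sqr_ge0 (p - q); rewrite sqrrB q2 p2 mulr2n => ?; lra.
Qed.

Lemma sum_inv_sqr_le (j N : nat) : (0 < j)%N ->
  \sum_(j <= k < N) (k%:R ^+ 2 : R)^-1 <= 2 / j%:R.
Proof.
move=> j0; case: (leqP N j) => [Nj|jN].
  by rewrite big_geq // mulr_ge0 // invr_ge0.
apply: (@le_trans _ _ (\sum_(j <= k < N) 2 * (- (k.+1%:R)^-1 - - (k%:R)^-1))).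
  apply: ler_sum_nat => k /andP[jk _].
  have k0 : (1 : R) <= k%:R by rewrite ler1n (leq_trans j0).
  have -> : 2 * (- (k.+1%:R)^-1 - - (k%:R)^-1) = 2 * (k%:R * (k%:R + 1))^-1 :> R.
    by rewrite -natr1; field; apply/andP; split; rewrite gt_eqF //; lra.
  rewrite -[leLHS]mul1r ler_pdivrMr ?exprn_gt0 ?(lt_le_trans ltr01) //.
  rewrite -mulrA mulrCA ler_pdivlMl; last by rewrite mulr_gt0 //; lra.
  by rewrite mulr1; nra.
rewrite -mulr_sumr telescope_sumr ?(ltnW jN) // ler_wpM2l //.
by rewrite opprK gerDr oppr_le0 invr_ge0.
Qed.

End ElementarySums.

Lemma card_multiples_le (d m : nat) : (0 < d)%N -> (d %| m)%N ->
  (#|[pred p : 'I_m | d %| p]%N| <= m %/ d)%N.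
Proof.
move=> d0 dm.
have lt_div (p : 'I_m) : (p %/ d < m %/ d)%N.
  by rewrite ltn_divLR // divnK // ltn_ord.
rewrite -[leqRHS]card_ord -(card_in_imset (f := fun p => Ordinal (lt_div p))).
  exact: max_card.
move=> p q; rewrite !inE => dp dq [] e; apply: val_inj => /=.
by rewrite -(divnK dp) e divnK.
Qed.

Lemma gcdnM_dvd (x y m : nat) : (gcdn (x * y) m %| gcdn x m * gcdn y m)%N.
Proof.
rewrite muln_gcdl !muln_gcdr !dvdn_gcd dvdn_gcdl /=.
by rewrite dvdn_mull ?dvdn_gcdr // !dvdn_mulr ?dvdn_gcdr.
Qed.

Definition tau (m : nat) := size (divisors m).

(** The gcd is itself a common divisor, hence at most the sum of the common divisors; each divisor
    [d] of [m] then contributes at most [d * (m / d) = m]. *)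
Lemma sum_gcdn_le (m : nat) : (0 < m)%N ->
  (\sum_(p < m) gcdn p m <= m * tau m)%N.
Proof.
move=> m0.
have le_gcd (p : 'I_m) : (gcdn p m <= \sum_(d <- divisors m) (d %| p) * d)%N.
  rewrite (bigD1_seq (gcdn p m)) ?divisors_uniq -?dvdn_divisors ?dvdn_gcdr //=.
  by rewrite dvdn_gcdl mul1n leq_addr.
apply: leq_trans (leq_sum _ (fun p _ => le_gcd p)) _.
rewrite exchange_big /= big_seq.
apply: (@leq_trans (\sum_(d <- divisors m | d \in divisors m) m)%N); last first.
  by rewrite -big_seq big_const_seq count_predT iter_addn_0 /tau mulnC.
apply: leq_sum => d; rewrite -dvdn_divisors // => dm.
rewrite -big_distrl /= -[leqRHS](divnK dm) leq_mul2r; apply/orP; right.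
have d0 := dvdn_gt0 m0 dm.
apply: leq_trans (card_multiples_le d0 dm); rewrite -sum1_card [leqRHS]big_mkcond.
by apply: leq_sum => p _; rewrite inE; case: (d %| p)%N.
Qed.

Lemma totient_dvdn_le (d m : nat) : (0 < m)%N -> (d %| m)%N ->
  (totient d <= totient m)%N.
Proof.
move=> m0 dm; have d0 := dvdn_gt0 m0 dm.
rewrite !totientE //.
have -> : primes d = [seq p <- primes m | p \in primes d].
  apply: lt_sorted_eq; first exact: sorted_primes.
    by apply: sorted_filter; [exact: ltn_trans | exact: sorted_primes].
  move=> p; rewrite mem_filter; case: (boolP (p \in primes d)) => //= pd.
  move: pd; rewrite !mem_primes m0 => /and3P[-> _ pd].
  by rewrite (dvdn_trans pd dm).
rewrite big_filter big_mkcond /= big_seq [leqRHS]big_seq.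
apply: leq_prod => p; rewrite mem_primes => /and3P[pp _ pm].
case: ifP => _.
  by rewrite leq_mul2l leq_pexp2l ?prime_gt0 ?orbT // -!subn1 leq_sub2r ?dvdn_leq_log.
by case: p pp pm => [|[|p]] // _ _; rewrite muln_gt0 expn_gt0.
Qed.

(** From Gauss's identity [m = sum of totient d over d | m], where no term exceeds [totient m]. It
    converts the factor [totient c] saved by orbit averaging into [c], at the price of [tau c]. *)
Lemma leq_totient_tau (m : nat) : (0 < m)%N -> (m <= totient m * tau m)%N.
Proof.
move=> m0; rewrite -[leqLHS]sum_totient_dvd.
rewrite -(big_mkord (fun d => d %| m)%N totient) -big_filter.
rewrite (perm_big (divisors m)); last first.
  apply: uniq_perm; rewrite ?filter_uniq ?iota_uniq ?divisors_uniq // => d.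
  rewrite mem_filter mem_index_iota -dvdn_divisors //=.
  by case: (boolP (d %| m)%N) => //= dm; rewrite ltnS dvdn_leq.
rewrite big_seq; apply: (@leq_trans (\sum_(d <- divisors m | d \in divisors m) totient m)%N).
  by apply: leq_sum => d; rewrite -dvdn_divisors // => dm; apply: totient_dvdn_le.
by rewrite -big_seq big_const_seq count_predT iter_addn_0.
Qed.

(** Subtracting one solution maps the solutions into the annihilator of [a], which consists of the
    multiples of [c / gcd(a, c)]. *)
Lemma card_lin_le n (a b : 'I_n.+2) :
  (#|[pred x : 'I_n.+2 | (a * x == b)%R]| <= gcdn a n.+2)%N.
Proof.
set c := n.+2.
case: (pickP [pred x : 'I_c | a * x == b]) => [x0 /= /eqP x0b|]; last first.
  by move=> e; rewrite eq_card0.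
have gc : (gcdn a c %| c)%N by rewrite dvdn_gcdr.
have g0 : (0 < gcdn a c)%N by rewrite gcdn_gt0 orbT.
have dc : (c %/ gcdn a c %| c)%N by rewrite dvdn_div.
have dgt0 : (0 < c %/ gcdn a c)%N by rewrite divn_gt0 // dvdn_leq.
have := card_multiples_le dgt0 dc.
rewrite -[X in (_ <= X)%N -> _]/(c %/ (c %/ gcdn a c))%N divnA // mulnC mulnK //.
apply: leq_trans.
rewrite -(card_in_imset (f := fun x : 'I_c => x - x0)); last by move=> x y _ _ /addIr.
apply: subset_leq_card; apply/fintype.subsetP => _ /imsetP[x xb ->].
have : a * (x - x0) = 0 by move: xb; rewrite inE mulrBr x0b => /eqP ->; rewrite subrr.
move=> /(congr1 val) /= /eqP; rewrite -/(dvdn _ _) => ax.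
have {}ax : (c %| a * (x - x0)%R)%N := ax.
rewrite inE /= -(@dvdn_pmul2l (gcdn a c)) // [X in (X %| _)%N]mulnC divnK //.
rewrite muln_gcdl dvdn_gcd ax /=.
by rewrite dvdn_mulr.
Qed.

Section Kloosterman.
Variables (R : rcfType) (n : nat).
Local Notation c := n.+2.
Local Notation A := 'I_c.
Local Notation normc := ComplexField.Normc.normc.
(** An abstract additive character with values on the unit circle. Orthogonality is all that the
    moment computations need; trigonometry enters only when a root of unity is supplied. *)
Variable ch : A -> R[i].
Hypothesis chD : forall x y, ch (x + y) = ch x * ch y.
Hypothesis norm_ch : forall x, normc (ch x) = 1.
Hypothesis ch_orth : forall x, \sum_m ch (m * x) = if x == 0 then c%:R else 0.

Definition kloosterman (a b : A) : R[i] :=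
  \sum_(x : A | x \is a GRing.unit) ch (a * x + b * x^-1).

Lemma norm_sum (I : Type) (r : seq I) (P : pred I) (F : I -> R[i]) :
  normc (\sum_(i <- r | P i) F i) <= \sum_(i <- r | P i) normc (F i).
Proof.
elim/big_rec2: _ => [|i y x _ le_xy]; first by rewrite ComplexField.Normc.normc0.
by apply: le_trans (le_normcD _ _) _; rewrite lerD2l.
Qed.

Lemma normc_ge0 (z : R[i]) : 0 <= normc z.
Proof. by case: z => x y; rewrite sqrtr_ge0. Qed.

Lemma normc_real (x : R) : normc x%:C%C = `|x|.
Proof. by rewrite /= expr0n /= addr0 sqrtr_sqr. Qed.

Lemma ch_neq0 x : ch x != 0.
Proof.
apply/eqP => e; move: (norm_ch x); rewrite e ComplexField.Normc.normc0.
by move/eqP; rewrite eq_sym oner_eq0.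
Qed.

Lemma ch0 : ch 0 = 1.
Proof. by apply: (mulfI (ch_neq0 0)); rewrite -chD addr0 mulr1. Qed.

Lemma sqr_normcE (z : R[i]) : (normc z ^+ 2)%:C%C = z * z^*.
Proof. by rewrite -normCK rmorphXn. Qed.

Lemma chN x : ch (- x) = (ch x)^*.
Proof.
apply: (mulfI (ch_neq0 x)); rewrite -chD subrr ch0 -sqr_normcE norm_ch.
by rewrite expr1n.
Qed.

Lemma sqr_norm_sum (I : finType) (U : pred I) (F : I -> R[i]) :
  (normc (\sum_(i | U i) F i) ^+ 2)%:C%C
  = \sum_(i | U i) \sum_(j | U j) F i * (F j)^*.
Proof. by rewrite sqr_normcE rmorph_sum big_distrlr. Qed.

(** Parseval in two frequencies: after the square is expanded, orthogonality in [a] and in [b]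
    detects coincidences. The index type is free: pairs of units give the fourth moment, single
    units the second. *)
Lemma sum_norm_ch_sqr (I : finType) (U : pred I) (P Q : I -> A) :
  \sum_a \sum_b normc (\sum_(i | U i) ch (a * P i + b * Q i)) ^+ 2
  = (c ^ 2)%:R * (\sum_(i | U i) \sum_(j | U j)
       ((P i == P j) && (Q i == Q j)))%:R.
Proof.
apply: (@complexI R); rewrite rmorphM /= !rmorph_nat rmorph_sum /=.
have E a : (\sum_b normc (\sum_(i | U i) ch (a * P i + b * Q i)) ^+ 2)%:C%C
    = \sum_(i | U i) \sum_(j | U j) ch (a * (P i - P j))
         * \sum_b ch (b * (Q i - Q j)).
  rewrite rmorph_sum /=.
  under eq_bigr => b _ do rewrite sqr_norm_sum.
  rewrite exchange_big; apply: eq_bigr => i _ /=.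
  rewrite exchange_big; apply: eq_bigr => j _ /=.
  rewrite mulr_sumr; apply: eq_bigr => b _.
  by rewrite -chN -!chD; congr ch; ring.
under eq_bigr => a _ do rewrite E.
rewrite exchange_big /= natr_sum mulr_sumr; apply: eq_bigr => i _.
rewrite exchange_big /= natr_sum mulr_sumr; apply: eq_bigr => j _.
rewrite -mulr_suml !ch_orth !subr_eq0.
by case: eqP => _; case: eqP => _; rewrite /= ?mul0r ?mulr0 // mulr1 natrX expr2.
Qed.

Notation unitA := [pred x : A | x \is a GRing.unit].

Lemma card_unitA : #|unitA| = totient c.
Proof.
rewrite totient_count_coprime big_mkord -sum1_card big_mkcond /=.
apply: eq_bigr => x _; have -> : (x \is a GRing.unit) = coprime c x by [].
by case: coprime.
Qed.

Definition unit_quad (p q : A * A) : bool :=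
  (p.1 + p.2 == q.1 + q.2) && (p.1^-1 + p.2^-1 == q.1^-1 + q.2^-1).

Definition unit_pair (p : A * A) : bool :=
  (p.1 \is a GRing.unit) && (p.2 \is a GRing.unit).

(* The quadruples counted by the fourth moment are zeros of a cubic form with
   three linear factors. *)
Lemma unit_quad_eq0 (x y z t : A) : unit_pair (x, y) -> unit_pair (z, t) ->
  unit_quad (x, y) (z, t) ->
  t = x + y - z /\ (x + y) * (z - x) * (z - y) = 0.
Proof.
move=> /andP[/= ux uy] /andP[/= uz ut] /andP[/= /eqP e1 /eqP e2].
have et : t = x + y - z by rewrite e1 addrC addKr.
split=> //; rewrite -mulrA.
have -> : (z - x) * (z - y) = x * y - z * t by rewrite et; ring.
have invD (a b : A) : a \is a GRing.unit -> b \is a GRing.unit ->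
    (a^-1 + b^-1) * (a * b) = a + b.
  move=> ua ub; transitivity (a^-1 * a * b + b^-1 * b * a); first by ring.
  by rewrite !mulVr // !mul1r addrC.
have e3 : (x + y) * (z * t) = (z + t) * (x * y).
  by rewrite -(invD x y) // -(invD z t) // e2 mulrAC.
by rewrite mulrBr e3 e1 subrr.
Qed.

Definition unit_quads : nat :=
  \sum_(p | unit_pair p) \sum_(q | unit_pair q) unit_quad p q.

Lemma unit_quads_le_cubic :
  (unit_quads <=
    \sum_(x : A) \sum_(y : A) \sum_(z : A) ((x + y) * (z - x) * (z - y) == 0)%R)%N.
Proof.
rewrite pair_bigA /= /unit_quads big_mkcond /=; apply: leq_sum => -[x y] _.
case: ifP => // uxy.
rewrite big_mkcond -(pair_bigA_idem (addn0 0)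
  (fun z t : A => if unit_pair (z, t) then unit_quad (x, y) (z, t) : nat else 0)%N) /=.
apply: leq_sum => z _.
rewrite (bigD1 (x + y - z)%R) //= big1 => [|t tneq]; last first.
  case: ifP => // uzt; case: (boolP (unit_quad _ _)) => // /(unit_quad_eq0 uxy uzt)[e _].
  by rewrite e eqxx in tneq.
rewrite addn0; case: ifP => // uzt.
by case: (boolP (unit_quad _ _)) => // /(unit_quad_eq0 uxy uzt)[_ ->]; rewrite eqxx.
Qed.

(** With [p = x + y] and [q = z - x] the form becomes [p q (2 x - (p - q))], which is linear in [x].
    For given [p] and [q] there are thus at most [gcd(2 p q, c) <= 2 gcd(p, c) gcd(q, c)] values of
    [x], and the sum over [p], [q] factors. *)
Lemma cubic_count_le :
  (\sum_(x : A) \sum_(y : A) \sum_(z : A) ((x + y) * (z - x) * (z - y) == 0)%R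
   <= 2 * (c * tau c) ^ 2)%N.
Proof.
have -> : (\sum_(x : A) \sum_(y : A) \sum_(z : A) ((x + y) * (z - x) * (z - y) == 0)%R
  = \sum_(p : A) \sum_(q : A) \sum_(x : A) ((p * q *+ 2) * x == p * q * (p - q))%R)%N.
  rewrite [RHS]exchange_big /=.
  under [RHS]eq_bigr => q _ do rewrite exchange_big.
  rewrite [RHS]exchange_big /=; apply: eq_bigr => x _.
  rewrite [RHS]exchange_big /=.
  rewrite (reindex_inj (addrI (- x))) /=; apply: eq_bigr => p _.
  rewrite (reindex_inj (addrI x)) /=; apply: eq_bigr => q _.
  congr (nat_of_bool _); rewrite -[RHS]subr_eq0; congr (_ == _); ring.
have g (p q : A) : (\sum_(x : A) ((p * q *+ 2) * x == p * q * (p - q))%R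
    <= gcdn p c * gcdn q c * 2)%N.
  apply: (@leq_trans (gcdn (p * q *+ 2)%R c)).
    apply: leq_trans (card_lin_le _ (p * q * (p - q))%R).
    rewrite -sum1_card [leqRHS]big_mkcond; apply: leq_sum => x _.
    by rewrite inE; case: eqP.
  rewrite Zp_mulrn /= gcdn_modl; apply: dvdn_leq.
    by rewrite !muln_gt0 !gcdn_gt0 !orbT.
  apply: (dvdn_trans (gcdnM_dvd _ _ _)); rewrite gcdn_modl.
  by apply: dvdn_mul (gcdnM_dvd _ _ _) (dvdn_gcdl _ _).
apply: leq_trans (leq_sum _ (fun p _ => leq_sum _ (fun q _ => g p q))) _.
under eq_bigr => p _ do rewrite -big_distrl -big_distrr /=.
rewrite -!big_distrl /= mulnC leq_mul2l /= expnS expn1.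
by apply: leq_mul; exact: sum_gcdn_le.
Qed.

Lemma kloosterman_moment4 :
  \sum_a \sum_b normc (kloosterman a b) ^+ 4
  <= (2 * c ^ 2 * (c * tau c) ^ 2)%:R.
Proof.
have E a b : normc (kloosterman a b) ^+ 4 = normc (\sum_(p | unit_pair p)
    ch (a * (p.1 + p.2) + b * (p.1^-1 + p.2^-1))) ^+ 2.
  rewrite -[4%N]/(2 * 2)%N exprM; congr (_ ^+ 2).
  rewrite expr2 -ComplexField.Normc.normcM big_distrlr /= pair_big /=; congr normc.
  by apply: eq_bigr => -[x y] _ /=; rewrite -chD; congr ch; ring.
under eq_bigr => a _ do under eq_bigr => b _ do rewrite E.
rewrite sum_norm_ch_sqr -natrM ler_nat [(2 * _)%N]mulnC -mulnA leq_pmul2l ?expn_gt0 //.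
exact: leq_trans unit_quads_le_cubic cubic_count_le.
Qed.

Lemma kloosterman_scale (a b u : A) : u \is a GRing.unit ->
  kloosterman (a * u) (b * u^-1) = kloosterman a b.
Proof.
move=> uu; rewrite /kloosterman [RHS](reindex_inj (mulrI uu)) /=.
apply: eq_big => x; first by rewrite unitrM uu.
by move=> ux; congr ch; rewrite mulrA invrM // -!mulrA [u^-1 * _]mulrC.
Qed.

Lemma kloostermanC (a b : A) : kloosterman a b = kloosterman b a.
Proof.
rewrite /kloosterman (reindex_inj (can_inj (@invrK A))) /=.
by apply: eq_big => x; rewrite ?unitrV // => _; rewrite invrK addrC.
Qed.

Lemma kloosterman_le (a b : A) : normc (kloosterman a b) <= c%:R.
Proof.
apply: le_trans (norm_sum _ _ _) _.
under eq_bigr do rewrite norm_ch.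
by rewrite sumr_const ler_nat -[leqRHS](card_ord c) max_card.
Qed.

(* Averages the invariance of [F] along the orbits u |-> (j u, m / u); for
   distinct [m] these orbits cover a given point at most [gcdn j c] times. *)
Lemma orbit_sum_le (j : A) (low : pred A) (F : A -> A -> R) :
  (forall a b, 0 <= F a b) ->
  (forall a b u, u \is a GRing.unit -> F (a * u) (b * u^-1) = F a b) ->
  {in low &, injective (fun m => j * m)} ->
  (totient c)%:R * \sum_(m | low m) F j m
  <= (gcdn j c)%:R * \sum_a \sum_b F a b.
Proof.
move=> F0 Fu injlow.
have -> : (totient c)%:R * \sum_(m | low m) F j m
    = \sum_(m | low m) \sum_(u : A | u \is a GRing.unit) F (j * u) (m * u^-1).
  rewrite mulr_sumr; apply: eq_bigr => m _.
  by rewrite (eq_bigr (fun=> F j m)) => [|u /Fu//]; rewrite sumr_const card_unitA mulr_natl.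
have -> : \sum_(m | low m) \sum_(u : A | u \is a GRing.unit) F (j * u) (m * u^-1)
    = \sum_(m | low m) \sum_(u : A | u \is a GRing.unit) \sum_a \sum_b
        ((j * u == a) && (m * u^-1 == b))%:R * F a b.
  apply: eq_bigr => m _; apply: eq_bigr => u _.
  rewrite (bigD1 (j * u)) //= (bigD1 (m * u^-1)) //= !eqxx mul1r.
  rewrite big1 ?addr0 => [|b /negPf]; last by rewrite eq_sym => ->; rewrite mul0r.
  rewrite big1 ?addr0 // => a /negPf; rewrite eq_sym => -> /=.
  by rewrite big1 // => b _; rewrite mul0r.
under eq_bigr => m _ do rewrite exchange_big.
rewrite exchange_big mulr_sumr; apply: ler_sum => a _.
under eq_bigr => m _ do rewrite exchange_big.
rewrite exchange_big mulr_sumr; apply: ler_sum => b _ /=.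
under eq_bigr => m _ do rewrite -mulr_suml.
rewrite -mulr_suml; apply: ler_wpM2r => //.
(* If [(j u, m / u) = (a, b)] then [j m = a b], which leaves at most one low [m]; then [u] solves
   [j u = a], which has at most [gcd(j, c)] solutions. *)
apply: (@le_trans _ _ (\sum_(m | low m && (j * m == a * b)) \sum_(u : A) (j * u == a)%:R)).
  rewrite big_mkcondr; apply: ler_sum => m lm; case: ifP => [_|jm].
    rewrite [leLHS]big_mkcond /=; apply: ler_sum => u _.
    by case: ifP; rewrite ?ler0n // => _; case: eqP => //= _; rewrite lern1 leq_b1.
  rewrite big1 // => u uu; case: eqP => //= ju; case: eqP => //= mu.
  by move: jm; rewrite -ju -mu mulrACA mulrV // mulr1 eqxx.
have card_le1 : (#|[pred m | low m && (j * m == a * b)%R]| <= 1)%N.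
  apply/card_le1_eqP => x y; rewrite !inE => /andP[lx /eqP xab] /andP[ly /eqP yab].
  by apply: injlow => //; rewrite xab yab.
rewrite sumr_const -natr_sum -mulrnA ler_nat.
apply: leq_trans (leq_mul (leqnn _) card_le1) _; rewrite muln1.
apply: leq_trans (card_lin_le j a); rewrite -sum1_card [leqRHS]big_mkcond.
by apply: leq_sum => x _; rewrite inE; case: eqP.
Qed.

End Kloosterman.

(** * Least absolute residues and weighted divisor sums *)

Definition absmod n (x : 'I_n.+2) : nat := minn x (n.+2 - x).

Section Absmod.
Variable n : nat.
Local Notation c := n.+2.
Local Notation A := 'I_c.

Lemma absmod_gt0 (x : A) : (0 < absmod x)%N = (x != 0).
Proof.
rewrite leq_min subn_gt0 ltn_ord andbT lt0n.
by rewrite -[(x : nat) == 0%N]/(x == 0).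
Qed.

Lemma gcdn_absmod (x : A) : gcdn (absmod x) c = gcdn x c.
Proof.
rewrite /absmod; case: leqP => // _.
have xc : (x <= c)%N by rewrite ltnW.
apply/eqP; rewrite eqn_dvd !dvdn_gcd !dvdn_gcdr !andbT.
rewrite -(dvdn_addr _ (dvdn_gcdl (c - x) c)) subnK // dvdn_gcdr.
by rewrite dvdn_sub ?dvdn_gcdl ?dvdn_gcdr.
Qed.

(** A size [k] is attained by at most two residues, [k] and [c - k]. *)
Lemma sum_absmod_le (R : numDomainType) (P : pred nat) (F : nat -> R) :
  (forall k, 0 <= F k) ->
  \sum_(x : A | (x != 0) && P (absmod x)) F (absmod x)
  <= 2 * \sum_(1 <= k < c | P k) F k.
Proof.
move=> F0; pose G k := if P k then F k else 0.
have G0 k : 0 <= G k by rewrite /G; case: ifP.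
apply: (@le_trans _ _ (\sum_(x : A | x != 0) (G x + G (c - x)%N))).
  rewrite big_mkcondr /=; apply: ler_sum => x _.
  rewrite -/(G (absmod x)) /absmod; case: leqP => _; rewrite ?lerDl ?lerDr //.
have E (H : nat -> R) : \sum_(x : A | x != 0) H x = \sum_(1 <= k < c) H k.
  rewrite (big_mkcond (fun x : A => x != 0)) /=.
  rewrite -(big_mkord xpredT (fun x => if (x != 0)%N then H x else 0)).
  rewrite big_ltn // add0r; apply: eq_big_nat => k /andP[k0 _].
  by rewrite -lt0n k0.
rewrite big_split /= (E G) (E (fun k => G (c - k)%N)) mulr_natl mulr2n.
rewrite [X in _ + X]big_nat_rev /= add1n.
rewrite [X in _ + X](eq_big_nat _ _ (F2 := G)); last first.
  move=> k /andP[k0 kc]; congr G; lia.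
by rewrite /G -big_mkcond.
Qed.

Definition sres (x : A) : int := if (x <= c - x)%N then x%:Z else x%:Z - c%:Z.

Lemma abs_sres (x : A) : `|sres x|%N = absmod x.
Proof.
have xc : (x <= c)%N by rewrite ltnW.
rewrite /sres /absmod; case: leqP => // _.
by rewrite distnC distnEl.
Qed.

Lemma intr_sres (x : A) : (sres x)%:~R = x :> A.
Proof.
have c0 : c%:R = 0 :> A by apply: val_inj; rewrite Zp_nat; exact: modnn.
by rewrite /sres; case: ifP => _; rewrite ?rmorphB /= -!pmulrn natr_Zp ?c0 ?subr0.
Qed.

Lemma intr_Zp_eq0 (z : int) : z%:~R = 0 :> A -> (c %| `|z|)%N.
Proof.
have nat0 m : m%:R = 0 :> A -> (c %| m)%N.
  by rewrite Zp_nat => /(congr1 val) /= /eqP.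
case: z => m; first exact: nat0.
by rewrite NegzE rmorphN /= => /eqP; rewrite oppr_eq0 => /eqP /nat0.
Qed.

(** Lifted to representatives of least absolute value, [j (x - y)] is a multiple of [c] of absolute
    value less than [c], hence zero. *)
Lemma mul_absmod_inj (j x y : A) : j != 0 ->
  (absmod j * (absmod x + absmod y) < c)%N -> j * x = j * y -> x = y.
Proof.
move=> j0 lt e.
have : (sres j * (sres x - sres y))%:~R = 0 :> A.
  by rewrite rmorphM rmorphB /= !intr_sres mulrBr e subrr.
move=> /intr_Zp_eq0; rewrite abszM abs_sres => dv.
have : (absmod j * `|sres x - sres y| < c)%N.
  apply: leq_ltn_trans lt; rewrite leq_mul2l; apply/orP; right.
  by rewrite -!abs_sres; lia.
have [/eqP m0 _|m0] := posnP (absmod j * `|sres x - sres y|); last first.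
  by rewrite ltnNge (dvdn_leq m0 dv).
move: m0; rewrite muln_eq0 -leqn0 leqNgt absmod_gt0 j0 /= => /eqP d0.
rewrite -[x]intr_sres -[y]intr_sres; congr _%:~R; lia.
Qed.

End Absmod.

Lemma sum_multiples_le (R : numDomainType) (F : nat -> R) (d N : nat) :
  (0 < d)%N -> (forall k, 0 <= F k) ->
  \sum_(1 <= k < N | (d %| k)%N) F k <= \sum_(1 <= k < N) F (d * k)%N.
Proof.
move=> d0 F0.
apply: (@le_trans _ _ (\sum_(1 <= k < N) \sum_(1 <= l < N) (k == d * l)%N%:R * F k)).
  rewrite big_mkcond; apply: ler_sum_nat => k /andP[k0 kN].
  case: ifP => [/dvdnP[l kl]|_]; last first.
    by apply: sumr_ge0 => l _; rewrite mulr_ge0 // ler0n.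
  rewrite (bigD1_seq l) ?iota_uniq //=.
    rewrite kl mulnC eqxx mul1r lerDl; apply: sumr_ge0 => i _.
    by rewrite mulr_ge0 // ler0n.
  rewrite mem_index_iota; nia.
rewrite exchange_big /=; apply: ler_sum_nat => l _.
have [dl|dl] := boolP (d * l \in index_iota 1 N)%N.
  rewrite (bigD1_seq (d * l)%N) ?iota_uniq //= eqxx mul1r big1 ?addr0 // => k /negPf ->.
  by rewrite mul0r.
rewrite big_nat_cond big1 // => k; rewrite andbT => kN; case: eqP => [e|]; last by rewrite mul0r.
by move: dl; rewrite mem_index_iota -e kN.
Qed.

Lemma le_gcdn_divisors (k m : nat) : (0 < m)%N ->
  (gcdn k m <= \sum_(d <- divisors m | d %| k) d)%N.
Proof.
move=> m0; rewrite big_mkcond (bigD1_seq (gcdn k m)) ?divisors_uniq -?dvdn_divisors ?dvdn_gcdr //=.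
by rewrite dvdn_gcdl leq_addr.
Qed.

(** The gcd is split over the divisors [d] of [m]. Along the multiples [d k] the factor [d] against
    [(d k)^(-5/4)] leaves [d^(-1/4) <= 1], so each divisor costs only the convergent sum of
    [k^(-5/4)]. *)
Lemma sum_gcdn_rt4_le (R : rcfType) (m N : nat) : (0 < m)%N ->
  \sum_(1 <= k < N) (gcdn k m)%:R * (k%:R * rt4 k%:R)^-1 <= 8 * (tau m)%:R :> R.
Proof.
move=> m0.
have F0 k : 0 <= (k%:R * rt4 k%:R : R)^-1 by rewrite invr_ge0 mulr_ge0 ?rt4_ge0.
apply: (@le_trans _ _ (\sum_(1 <= k < N) \sum_(d <- divisors m | (d %| k)%N)
    d%:R * (k%:R * rt4 k%:R)^-1)).
  apply: ler_sum_nat => k _; rewrite -mulr_suml ler_wpM2r //.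
  by rewrite -natr_sum ler_nat le_gcdn_divisors.
under eq_bigr => k _ do rewrite big_mkcond.
rewrite exchange_big /= big_seq.
apply: (@le_trans _ _ (\sum_(d <- divisors m | d \in divisors m) 8)); last first.
  by rewrite -big_seq big_const_seq count_predT iter_addr_0 /tau mulr_natr.
apply: ler_sum => d; rewrite -dvdn_divisors // => dm.
have d0 : (0 < d)%N by exact: dvdn_gt0 dm.
rewrite -big_mkcond -mulr_sumr.
apply: (@le_trans _ _ (d%:R * \sum_(1 <= k < N) ((d * k)%:R * rt4 (d * k)%:R)^-1)).
  by apply: ler_wpM2l => //; exact: (@sum_multiples_le _ (fun k => (k%:R * rt4 k%:R)^-1)).
apply: (@le_trans _ _ (\sum_(1 <= k < N) (k%:R * rt4 k%:R)^-1)); last first.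
  by apply: le_trans (sum_inv_rt4_le _ _ _) _; rewrite ?rt4_1 ?divr1.
rewrite mulr_sumr; apply: ler_sum_nat => k /andP[k0 _].
have dR : (0 : R) < d%:R by rewrite ltr0n.
have kR : (0 : R) < k%:R by rewrite ltr0n.
have -> : d%:R * ((d * k)%:R * rt4 (d * k)%:R)^-1
    = (k%:R * rt4 k%:R)^-1 / rt4 d%:R :> R.
  by rewrite natrM rt4M ?ler0n //; field; rewrite !gt_eqF ?rt4_gt0.
rewrite ler_piMr //.
rewrite invf_le1 ?rt4_gt0 // -{1}(@rt4_1 R); apply: ler_rt4.
by rewrite ler1n.
Qed.

Section KloostermanBounds.
Variables (R : rcfType) (n : nat).
Local Notation c := n.+2.
Local Notation A := 'I_c.
Local Notation normc := ComplexField.Normc.normc.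
Variable ch : A -> R[i].
Hypothesis chD : forall x y, ch (x + y) = ch x * ch y.
Hypothesis norm_ch : forall x, normc (ch x) = 1.
Hypothesis ch_orth : forall x, \sum_m ch (m * x) = if x == 0 then c%:R else 0.
Local Notation K := (kloosterman ch).

(** [K m 0] is a Ramanujan sum. Its explicit formula is bypassed by orbit averaging on the line
    [b = 0]: the only low frequency is 0, and the second moment along that line is [c * totient c]
    by Parseval. *)
Lemma kloosterman_fst_sqr_le (m : A) :
  normc (K m 0) ^+ 2 <= (gcdn m c * c)%:R.
Proof.
pose F (a b : A) := if b == 0 then normc (K a 0) ^+ 2 else 0.
have F0 a b : 0 <= F a b by rewrite /F; case: ifP; rewrite ?exprn_ge0 ?normc_ge0.
have Fu a b u : u \is a GRing.unit -> F (a * u) (b * u^-1) = F a b.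
  move=> uu; rewrite /F mulIr_eq0; last by apply: mulIr; rewrite unitrV.
  case: eqP => // _; congr (normc _ ^+ 2).
  by rewrite -[RHS](kloosterman_scale ch a 0 uu) mul0r.
have inj0 : {in pred1 0 &, injective (fun x : A => m * x)}.
  by move=> x y /eqP -> /eqP ->.
have := orbit_sum_le F0 Fu inj0.
rewrite big_pred1_eq /F eqxx.
under eq_bigr => a _ do rewrite -big_mkcond big_pred1_eq.
have := @sum_norm_ch_sqr R n ch chD norm_ch ch_orth A (fun x => x \is a GRing.unit) id (fun=> 0).
have -> : (\sum_(i : A | i \is a GRing.unit) \sum_(j : A | j \is a GRing.unit) ((i == j) && (0%R == 0%R :> A)) = totient c)%N.
  rewrite -card_unitA -sum1_card; apply: eq_bigr => i ui.
  rewrite (bigD1 i) //= !eqxx big1 // => j /andP[_ /negPf]; by rewrite eq_sym => ->.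
have -> : \sum_(a : A) \sum_(b : A) normc (\sum_(x : A | x \is a GRing.unit) ch (a * x + b * 0)) ^+ 2
   = c%:R * \sum_(a : A) normc (K a 0) ^+ 2.
  rewrite mulr_sumr; apply: eq_bigr => a _.
  rewrite (eq_bigr (fun=> normc (K a 0) ^+ 2)); last first.
    move=> b _; congr (normc _ ^+ 2); apply: eq_bigr => x _; congr ch.
    by rewrite mulr0 mul0r.
  by rewrite sumr_const card_ord mulr_natl.
have c0 : (0 : R) < c%:R by rewrite ltr0n.
have t0 : (0 : R) < (totient c)%:R by rewrite ltr0n totient_gt0.
move=> e; have {}e : \sum_(a : A) normc (K a 0) ^+ 2 = c%:R * (totient c)%:R.
  by apply: (mulfI (lt0r_neq0 c0)); rewrite e natrX expr2 -mulrA.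
rewrite e => h; rewrite -(ler_pM2l t0); apply: le_trans h _.
by rewrite natrM mulrA mulrC.
Qed.

(** Orbit averaging divides the full moment, of order [c^4 tau(c)^2], by [totient c]; replacing
    [totient c] by [c / tau c] produces the third factor [tau c]. *)
Lemma kloosterman_moment4_low (j : A) (low : pred A) :
  {in low &, injective (fun m => j * m)} ->
  \sum_(m | low m) normc (K j m) ^+ 4 <= (gcdn j c * (2 * c ^ 3 * tau c ^ 3))%:R.
Proof.
move=> inj.
have := @orbit_sum_le R n j low (fun a b => normc (K a b) ^+ 4)
  (fun a b => exprn_ge0 _ (normc_ge0 _)) _ inj.
have Fu a b u : u \is a GRing.unit ->
    normc (K (a * u) (b * u^-1)) ^+ 4 = normc (K a b) ^+ 4.
  by move=> uu; rewrite kloosterman_scale.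
move=> /(_ Fu); set S := \sum_(m | low m) _ => h.
have S0 : 0 <= S by apply: sumr_ge0 => m _; rewrite exprn_ge0 ?normc_ge0.
have c0 : (0 : R) < c%:R by rewrite ltr0n.
rewrite -(ler_pM2l c0).
apply: (@le_trans _ _ ((totient c * tau c)%:R * S)).
  by rewrite ler_wpM2r // ler_nat leq_totient_tau.
rewrite natrM mulrAC mulrC.
apply: le_trans (ler_wpM2l (ler0n _ (tau c)) h) _.
apply: le_trans (ler_wpM2l (ler0n _ (tau c))
  (ler_wpM2l (ler0n _ (gcdn j c)) (kloosterman_moment4 chD norm_ch ch_orth))) _.
rewrite -!natrM ler_nat; apply: eq_leq; ring.
Qed.

End KloostermanBounds.

Lemma le_add_pow4_div (R : realFieldType) (x y : R) : 0 <= x -> 0 < y ->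
  x <= y + x ^+ 4 / y ^+ 3.
Proof.
move=> x0 y0; have y3 : 0 < y ^+ 3 by rewrite exprn_gt0.
case: (leP x y) => [xy|/ltW yx].
  by rewrite (le_trans xy) // lerDl divr_ge0 ?exprn_ge0 // ltW.
rewrite (@le_trans _ _ (x ^+ 4 / y ^+ 3)) // ?lerDr ?(ltW y0) //.
rewrite ler_pdivlMr // [in leRHS]exprS ler_wpM2l // lerXn2r // nnegrE ltW //.
Qed.

Lemma big_nat_geq_cond (R : nmodType) (F : nat -> R) (i j N : nat) : (i <= j)%N ->
  \sum_(i <= k < N | (j <= k)%N) F k = \sum_(j <= k < N) F k.
Proof.
move=> ij; rewrite [RHS](big_nat_widenl j i) //.
Qed.

Section LowFrequencies.
Variables (R : rcfType) (n : nat).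
Local Notation c := n.+2.
Local Notation A := 'I_c.
Local Notation normc := ComplexField.Normc.normc.
Variable ch : A -> R[i].
Hypothesis chD : forall x y, ch (x + y) = ch x * ch y.
Hypothesis norm_ch : forall x, normc (ch x) = 1.
Hypothesis ch_orth : forall x, \sum_m ch (m * x) = if x == 0 then c%:R else 0.
Local Notation K := (kloosterman ch).
Local Notation L x := ((absmod x)%:R : R).
Variable k0 : nat.
Hypothesis k0_small : (2 * k0.-1 ^ 2 < c)%N.

Definition low (m : A) := (m != 0) && (absmod m < k0)%N.

Lemma low_mul_inj (j : A) : low j -> {in low &, injective (fun m => j * m)}.
Proof.
move=> /andP[j0 jk] x y /andP[_ xk] /andP[_ yk] e.
apply: mul_absmod_inj j0 _ e; apply: leq_ltn_trans k0_small.
rewrite expnS expn1 mulnCA leq_mul //; lia.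
Qed.

Local Notation rho := (rt4 (c%:R : R)).
Local Notation Y := (rho ^+ 3 * (tau c)%:R).

(* Young's inequality [x <= y + x^4 / y^3] with [y = rho^3 tau(c) m^(-1/4)]
   converts the fourth moment into a first moment. *)
Lemma kloosterman_low_le :
  \sum_(j | low j) \sum_(m | low m) normc (K j m) / (L j * L m) <= 576 * Y.
Proof.
have rho0 : 0 < rho by rewrite rt4_gt0 // ltr0n.
have tau0 : 0 < (tau c)%:R :> R.
  by rewrite ltr0n /tau lt0n size_eq0; apply/eqP => e; have := dvdn_divisors c (ltn0Sn n.+1); rewrite e dvdnn.
have Y0 : 0 < Y by rewrite mulr_gt0 // exprn_gt0.
pose T j m := normc (K j m) / (L j * L m).
have T0 j m : 0 <= T j m by rewrite divr_ge0 ?normc_ge0 // mulr_ge0.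
pose H := \sum_(j | low j) \sum_(m | low m && (absmod j <= absmod m)%N) T j m.
(* By the symmetry of [K] one may assume [absmod j <= absmod m]. This order makes the sum over [m] a
   tail of size [(L j)^(-1/4)], and allows [rt4 (L m)] to be replaced by [rt4 (L j)] in the moment
   term; both times the weight left for [j] is the summable [g]. *)
have half : \sum_(j | low j) \sum_(m | low m) T j m <= 2 * H.
  rewrite mulr_natl mulr2n {2}/H [X in _ <= _ + X](exchange_big_dep low) /=; last by move=> j m _ /andP[].
  rewrite -big_split /=; apply: ler_sum => j lj.
  rewrite [X in _ <= X + _]big_mkcondr [X in _ <= _ + X](eq_bigl (fun m => low m && (absmod m <= absmod j)%N)); last first.
    by move=> m; rewrite lj.
  rewrite [X in _ <= _ + X]big_mkcondr -big_split /=; apply: ler_sum => m lm.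
  have -> : T m j = T j m by rewrite /T kloostermanC [L m * _]mulrC.
  by case: leqP => jm; case: leqP => mj; rewrite ?lerDl ?add0r ?addr0 //; lia.
apply: le_trans half _.
suff : H <= 288 * Y by move=> ?; lra.
pose g k := (k%:R * rt4 (k%:R : R))^-1.
have g0 k : 0 <= g k by rewrite invr_ge0 mulr_ge0 ?rt4_ge0.
have step j : low j -> \sum_(m | low m && (absmod j <= absmod m)%N) T j m
    <= 16 * Y * g (absmod j) + 2 * c%:R ^+ 3 * (tau c)%:R ^+ 3 / Y ^+ 3
        * ((gcdn (absmod j) c)%:R * g (absmod j)).
  move=> lj; have Lj0 : 0 < L j by rewrite ltr0n absmod_gt0; case/andP: lj.
  have term m : low m && (absmod j <= absmod m)%N -> T j m <=
     Y / L j * g (absmod m) + normc (K j m) ^+ 4 * (g (absmod j) / Y ^+ 3).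
    move=> /andP[/andP[m0 _] jm].
    have Lm0 : 0 < L m by rewrite ltr0n absmod_gt0.
    have r0 : 0 < rt4 (L m) by rewrite rt4_gt0.
    have rj0 : 0 < rt4 (L j) by rewrite rt4_gt0.
    have rjm : rt4 (L j) <= rt4 (L m) by rewrite ler_rt4 // ler_nat.
    have := @le_add_pow4_div R (normc (K j m)) (Y / rt4 (L m)) (normc_ge0 _) (divr_gt0 Y0 r0).
    move=> /(ler_wpM2r (_ : 0 <= (L j * L m)^-1)) -/(_ _).
    have i0 : 0 <= (L j * L m)^-1 by rewrite invr_ge0 mulr_ge0.
    move=> /(_ i0) /le_trans; apply.
    rewrite mulrDl; apply: lerD.
      by rewrite le_eqVlt; apply/orP; left; apply/eqP; rewrite /g; field; rewrite !gt_eqF.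
    rewrite -[leLHS]mulrA; apply: ler_wpM2l; first by rewrite exprn_ge0 ?normc_ge0.
    have -> : ((Y / rt4 (L m)) ^+ 3)^-1 / (L j * L m) = rt4 (L m) ^+ 3 / (L j * L m) / Y ^+ 3.
      by field; rewrite !gt_eqF.
    apply: ler_wpM2r; first by rewrite invr_ge0 exprn_ge0 // ltW.
    have e4 := rt4X4 (ler0n R (absmod m)).
    have -> : rt4 (L m) ^+ 3 / (L j * L m) = (L j * rt4 (L m))^-1.
      by rewrite -{2}e4; field; rewrite !gt_eqF.
    rewrite /g.
    by rewrite lef_pV2 ?posrE ?mulr_gt0 // ler_wpM2l // ltW.
  apply: le_trans (ler_sum _ term) _.
  rewrite big_split /=; apply: lerD.
    rewrite -mulr_sumr.
    apply: (@le_trans _ _ (Y / L j * (2 * (8 / rt4 (L j))))); last first.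
      by rewrite le_eqVlt; apply/orP; left; apply/eqP; rewrite /g; field; rewrite !gt_eqF // rt4_gt0.
    apply: ler_wpM2l; first by rewrite divr_ge0 // ltW.
    apply: (@le_trans _ _ (\sum_(x : A | (x != 0) && (absmod j <= absmod x)%N) g (absmod x))).
      rewrite [leLHS]big_mkcond [leRHS]big_mkcond; apply: ler_sum => x _.
      by rewrite /low; case: (x != 0); case: (absmod x < k0)%N; case: (_ <= _)%N => /=.
    apply: le_trans (@sum_absmod_le n R (fun k => absmod j <= k)%N g g0) _.
    have lj1 : (0 < absmod j)%N by rewrite absmod_gt0; case/andP: lj.
    rewrite big_nat_geq_cond // ler_wpM2l //.
    exact: sum_inv_rt4_le.
  rewrite -mulr_suml.
  apply: (@le_trans _ _ ((gcdn j c * (2 * c ^ 3 * tau c ^ 3))%:R * (g (absmod j) / Y ^+ 3))).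
    apply: ler_wpM2r; first by rewrite divr_ge0 ?exprn_ge0 // ltW.
    apply: le_trans (kloosterman_moment4_low chD norm_ch ch_orth (low_mul_inj lj)).
    rewrite big_mkcondr; apply: ler_sum => m _; case: ifP => // _.
    by rewrite exprn_ge0 ?normc_ge0.
  rewrite gcdn_absmod !natrM.
  by rewrite le_eqVlt; apply/orP; left; apply/eqP; ring.
apply: le_trans (ler_sum _ step) _.
rewrite big_split /= -!mulr_sumr.
have s1 : \sum_(j : A | low j) g (absmod j) <= 16.
  apply: (@le_trans _ _ (2 * \sum_(1 <= k < c | (k < k0)%N) g k)).
    exact: (@sum_absmod_le n R (fun k => k < k0)%N g g0).
  have : \sum_(1 <= k < c | (k < k0)%N) g k <= 8.
    apply: (@le_trans _ _ (\sum_(1 <= k < c) g k)).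
      by rewrite big_mkcond; apply: ler_sum => k _; case: ifP.
    by apply: le_trans (sum_inv_rt4_le _ _ _) _; rewrite // rt4_1 divr1.
  by move=> ?; lra.
have s2 : \sum_(j : A | low j) (gcdn (absmod j) c)%:R * g (absmod j) <= 16 * (tau c)%:R.
  apply: (@le_trans _ _ (2 * \sum_(1 <= k < c | (k < k0)%N) (gcdn k c)%:R * g k)).
    apply: (@sum_absmod_le n R (fun k => k < k0)%N (fun k => (gcdn k c)%:R * g k)).
    by move=> k; rewrite mulr_ge0.
  have : \sum_(1 <= k < c | (k < k0)%N) (gcdn k c)%:R * g k <= 8 * (tau c)%:R.
    apply: (@le_trans _ _ (\sum_(1 <= k < c) (gcdn k c)%:R * g k)).
      by rewrite big_mkcond; apply: ler_sum => k _; case: ifP => // _; rewrite mulr_ge0.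
    exact: sum_gcdn_rt4_le.
  by move=> ?; lra.
(* The value of [Y] balances the two halves of Young's inequality: [c^3 tau(c)^4 / Y^3 = Y]. *)
pose Q := 2 * c%:R ^+ 3 * (tau c)%:R ^+ 3 / Y ^+ 3.
have e3 : Q * (tau c)%:R = 2 * Y.
  by rewrite /Q -{1}(rt4X4 (ler0n R c)); field; rewrite !gt_eqF.
have q0 : 0 <= Q.
  by rewrite divr_ge0 ?mulr_ge0 ?exprn_ge0 // ltW.
have h2 : Q * (\sum_(j : A | low j) (gcdn (absmod j) c)%:R * g (absmod j)) <= 32 * Y.
  apply: le_trans (ler_wpM2l q0 s2) _.
  have -> : Q * (16 * (tau c)%:R) = 16 * (Q * (tau c)%:R) by ring.
  by rewrite e3; lra.
have h1 : 16 * Y * \sum_(j : A | low j) g (absmod j) <= 16 * Y * 16.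
  by apply: ler_wpM2l => //; rewrite mulr_ge0 // ltW.
apply: le_trans (lerD h1 h2) _; lra.
Qed.

End LowFrequencies.

(** The least [k0] with [c <= 2 k0^2]. The upper bound on [k0] makes the products of low frequencies
    distinct modulo [c], the lower bound makes the tail beyond the cut small. *)
Lemma ex_frequency_cut (c : nat) : (0 < c)%N ->
  exists k0 : nat, [/\ (0 < k0)%N, (2 * k0.-1 ^ 2 < c)%N & (c <= 2 * k0 ^ 2)%N].
Proof.
move=> c0; have ex : exists k, (c <= 2 * k ^ 2)%N by exists c; nia.
have k0P := ex_minnP ex.
case: k0P => k0 k0P mink.
have k0pos : (0 < k0)%N by case: k0 k0P {mink} => //; lia.
exists k0; split => //; rewrite ltnNge; apply/negP => /mink; lia.
Qed.

Section FullError.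
Variables (R : rcfType) (n : nat).
Local Notation c := n.+2.
Local Notation A := 'I_c.
Local Notation normc := ComplexField.Normc.normc.
Variable ch : A -> R[i].
Hypothesis chD : forall x y, ch (x + y) = ch x * ch y.
Hypothesis norm_ch : forall x, normc (ch x) = 1.
Hypothesis ch_orth : forall x, \sum_m ch (m * x) = if x == 0 then c%:R else 0.
Local Notation K := (kloosterman ch).
Local Notation L x := ((absmod x)%:R : R).
Local Notation rho := (rt4 (c%:R : R)).
Local Notation h := (\sum_(1 <= k < c) (k%:R : R)^-1).

(** [F] and [G] stand for the absolute values of the Fourier coefficients of two smoothed intervals:
    the linear decay comes from the interval, the quadratic one from the average over [H] shifts.
    Two low frequencies are handled by the moment, a high one by quadratic decay and [|K| <= c], and
    [a = 0] separately. *)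
Lemma fourier_error_le (H : R) (F G : A -> R) :
  rho ^+ 3 <= H ->
  (forall m, 0 <= F m) -> (forall m, 0 <= G m) ->
  F 0 <= c%:R ->
  (forall m, m != 0 -> F m <= c%:R / (2 * L m)) ->
  (forall m, m != 0 -> F m <= c%:R ^+ 2 / (4 * H * L m ^+ 2)) ->
  (forall m, m != 0 -> G m <= c%:R / (2 * L m)) ->
  (forall m, m != 0 -> G m <= c%:R ^+ 2 / (4 * H * L m ^+ 2)) ->
  \sum_(m : A | m != 0) \sum_a F a * G m * normc (K a m)
  <= c%:R ^+ 2 * (rho ^+ 3 * (144 * (tau c)%:R + 3 * h + 4)).
Proof.
move=> Hrho F0 G0 F00 F1 F2 G1 G2.
have [k0 [k0pos k0_small k0_big]] := ex_frequency_cut (ltn0Sn n.+1).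
have c0 : 0 < c%:R :> R by rewrite ltr0n.
have rho0 : 0 < rho by rewrite rt4_gt0 // ltr0n.
have H0 : 0 < H by apply: lt_le_trans Hrho; rewrite exprn_gt0.
have c4 : rho ^+ 4 = c%:R by rewrite rt4X4.
have k0R : 0 < k0%:R :> R by rewrite ltr0n.
(* Since [c <= 2 k0^2], the inverse of [k0] is at most [sqrt 2 / rho^2]; [3/2] is a rational
   majorant of [sqrt 2]. *)
have k0rho : k0%:R^-1 <= 3 / (2 * rho ^+ 2).
  rewrite -[leLHS]mul1r ler_pdivrMr // mulrAC ler_pdivlMr ?mulr_gt0 ?exprn_gt0 // mul1r.
  rewrite -(@ler_pXn2r _ 2) ?nnegrE ?mulr_ge0 ?exprn_ge0 ?(ltW rho0) //.
  have : c%:R <= 2 * k0%:R ^+ 2 :> R by rewrite -natrX -natrM ler_nat.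
  have -> : (2 * rho ^+ 2) ^+ 2 = 4 * rho ^+ 4 by ring.
  rewrite c4 => ?; have -> : (3 * k0%:R) ^+ 2 = 9 * k0%:R ^+ 2 :> R by ring.
  have := sqr_ge0 (k0%:R : R); lra.
have Lpos (m : A) : m != 0 -> 0 < L m by rewrite -absmod_gt0 ltr0n.
have tail : \sum_(m : A | (m != 0) && (k0 <= absmod m)%N) (L m ^+ 2)^-1 <= 6 / rho ^+ 2.
  apply: le_trans (@sum_absmod_le n R (fun k => k0 <= k)%N (fun k => (k%:R ^+ 2)^-1) _) _.
    by move=> k; rewrite invr_ge0 exprn_ge0.
  rewrite big_nat_geq_cond //; have := sum_inv_sqr_le R c k0pos.
  have -> : 6 / rho ^+ 2 = 2 * (2 * (3 / (2 * rho ^+ 2))) by field; rewrite gt_eqF.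
  move=> t; rewrite ler_wpM2l //; apply: le_trans t _; by rewrite ler_wpM2l.
have harm : \sum_(m : A | m != 0) (L m)^-1 <= 2 * h.
  have := @sum_absmod_le n R xpredT (fun k => k%:R^-1) (fun k => _).
  by under eq_bigl do rewrite andbT; apply => k; rewrite invr_ge0.
have h0 : 0 <= h by apply: sumr_ge0 => k _; rewrite invr_ge0.
have cH : c%:R ^+ 2 / H <= rho ^+ 5.
  rewrite ler_pdivrMr // -{1}c4 -exprM -[(4 * 2)%N]/(5 + 3)%N exprD.
  by rewrite ler_wpM2l // exprn_ge0 // ltW.
have split0 : \sum_(m : A | m != 0) \sum_a F a * G m * normc (K a m)
  = \sum_(m : A | m != 0) F 0 * G m * normc (K 0 m)
    + \sum_(m : A | m != 0) \sum_(a : A | a != 0) F a * G m * normc (K a m).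
  by rewrite -big_split; apply: eq_bigr => m _; rewrite (bigD1 (0 : A)).
rewrite split0.
(* Here [F 0] can be as large as [c], with no decay in [a] to help; for low [m] the Ramanujan bound
   [|K 0 m|^2 <= absmod m * c] makes up for it. *)
have part0 : \sum_(m : A | m != 0) F 0 * G m * normc (K 0 m)
    <= c%:R ^+ 2 * (4 * rho ^+ 3).
  have pt (m : A) : m != 0 -> F 0 * G m * normc (K 0 m)
     <= (if (absmod m < k0)%N then c%:R ^+ 2 / 2 * rho ^+ 2 * (Num.sqrt (L m))^-1 else 0)
      + (if (k0 <= absmod m)%N then c%:R ^+ 2 / 4 * (c%:R ^+ 2 / H) * (L m ^+ 2)^-1 else 0).
    move=> m0; have Lm := Lpos m m0.
    case: ltnP => mk; rewrite ?addr0 ?add0r.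
      have sL0 : 0 < Num.sqrt (L m) by rewrite sqrtr_gt0.
      have sL : Num.sqrt (L m) ^+ 2 = L m by rewrite sqr_sqrtr // ltW.
      have Kb : normc (K 0 m) <= Num.sqrt (L m) * rho ^+ 2.
        rewrite -(@ler_pXn2r _ 2) ?nnegrE ?normc_ge0 ?mulr_ge0 ?exprn_ge0 ?(ltW rho0) ?(ltW sL0) //.
        rewrite exprMn sL -exprM c4 kloostermanC.
        apply: le_trans (kloosterman_fst_sqr_le chD norm_ch ch_orth m) _.
        rewrite natrM ler_wpM2r // ler_nat -gcdn_absmod dvdn_leq ?dvdn_gcdl //.
        by rewrite absmod_gt0.
      apply: (@le_trans _ _ (c%:R * (c%:R / (2 * L m)) * (Num.sqrt (L m) * rho ^+ 2))).
        apply: ler_pM; rewrite ?mulr_ge0 ?normc_ge0 //.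
        by apply: ler_pM => //; exact: G1.
      rewrite -{1}sL le_eqVlt; apply/orP; left; apply/eqP; field.
      by rewrite gt_eqF.
    apply: (@le_trans _ _ (c%:R * (c%:R ^+ 2 / (4 * H * L m ^+ 2)) * c%:R)).
      apply: ler_pM; rewrite ?mulr_ge0 ?normc_ge0 ?kloosterman_le //.
      by apply: ler_pM => //; exact: G2.
    rewrite le_eqVlt; apply/orP; left; apply/eqP; field.
    by rewrite !gt_eqF.
  apply: le_trans (ler_sum _ pt) _; rewrite big_split /= -!big_mkcondr -!mulr_sumr.
  have s1 : \sum_(m : A | (m != 0) && (absmod m < k0)%N) (Num.sqrt (L m))^-1 <= 4 * rho.
    apply: le_trans (@sum_absmod_le n R (fun k => k < k0)%N (fun k => (Num.sqrt k%:R)^-1) _) _.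
      by move=> k; rewrite invr_ge0 sqrtr_ge0.
    apply: (@le_trans _ _ (2 * (2 * Num.sqrt (k0.-1)%:R))).
      rewrite ler_wpM2l //; apply: le_trans (sum_inv_sqrt_le R k0.-1).
      rewrite prednK //.
      apply: (@le_trans _ _ (\sum_(1 <= k < c) if (k < k0)%N then (Num.sqrt k%:R)^-1 else 0)).
        by rewrite big_mkcond.
      case: (leqP c k0) => ck.
        rewrite [leRHS](big_cat_nat (n := c)) //=.
        rewrite ler_wpDr //; first by apply: sumr_ge0 => k _; rewrite invr_ge0 sqrtr_ge0.
        by apply: ler_sum => k _; case: ifP => // _; rewrite invr_ge0 sqrtr_ge0.
      rewrite (big_cat_nat (n := k0)) //=; last exact: ltnW.
      rewrite [X in _ + X]big_nat_cond [X in _ + X]big1 ?addr0; last first.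
        by move=> k /andP[/andP[kk _] _]; rewrite ltnNge kk.
      by apply: ler_sum => k _; case: ifP => // _; rewrite invr_ge0 sqrtr_ge0.
    have : Num.sqrt (k0.-1)%:R <= rho; last by move=> ?; lra.
    apply: ler_wsqrtr; rewrite -(@ler_pXn2r _ 2) ?nnegrE ?sqrtr_ge0 //.
    by rewrite sqr_sqrtr // -natrX ler_nat; lia.
  have q1 : 0 <= c%:R ^+ 2 / 2 * rho ^+ 2 by rewrite mulr_ge0 // ?divr_ge0 ?exprn_ge0 // ltW.
  have q2 : 0 <= c%:R ^+ 2 / 4 * (c%:R ^+ 2 / H).
    by rewrite mulr_ge0 // ?divr_ge0 ?exprn_ge0 // ltW.
  apply: le_trans (lerD (ler_wpM2l q1 s1) (ler_wpM2l q2 tail)) _.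
  apply: (@le_trans _ _ (c%:R ^+ 2 / 2 * rho ^+ 2 * (4 * rho)
      + c%:R ^+ 2 / 4 * rho ^+ 5 * (6 / rho ^+ 2))).
    rewrite lerD2l ler_wpM2r //; first by rewrite divr_ge0 // exprn_ge0 // ltW.
    by rewrite ler_wpM2l // divr_ge0 // exprn_ge0.
  have -> : c%:R ^+ 2 / 2 * rho ^+ 2 * (4 * rho) + c%:R ^+ 2 / 4 * rho ^+ 5 * (6 / rho ^+ 2)
     = c%:R ^+ 2 * (7 / 2 * rho ^+ 3) by field; rewrite gt_eqF.
  apply: ler_wpM2l; first by rewrite exprn_ge0.
  by apply: ler_wpM2r; [rewrite exprn_ge0 // ltW | lra].
have partn : \sum_(m : A | m != 0) \sum_(a : A | a != 0) F a * G m * normc (K a m)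
    <= c%:R ^+ 2 * (rho ^+ 3 * (144 * (tau c)%:R + 3 * h)).
  pose hi (m : A) := if (k0 <= absmod m)%N then (L m ^+ 2)^-1 else 0.
  have hi0 m : 0 <= hi m by rewrite /hi; case: ifP; rewrite ?invr_ge0 ?exprn_ge0.
  have pt (m a : A) : m != 0 -> a != 0 -> F a * G m * normc (K a m)
     <= c%:R ^+ 2 / 4 * (if low k0 a && low k0 m then normc (K a m) / (L a * L m) else 0)
      + (c%:R ^+ 2 / 8 * (c%:R ^+ 2 / H) * ((L a)^-1 * hi m)
      + c%:R ^+ 2 / 8 * (c%:R ^+ 2 / H) * ((L m)^-1 * hi a)).
    move=> m0 a0; have Lm := Lpos m m0; have La := Lpos a a0.
    have q : 0 <= c%:R ^+ 2 / 8 * (c%:R ^+ 2 / H).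
      by rewrite mulr_ge0 // ?divr_ge0 ?exprn_ge0 // ltW.
    rewrite /low m0 a0 /=.
    case: (ltnP (absmod m) k0) => mk; last first.
      rewrite andbF mulr0 add0r ler_wpDr //.
        by rewrite mulr_ge0 // mulr_ge0 // invr_ge0.
      apply: (@le_trans _ _ (c%:R / (2 * L a) * (c%:R ^+ 2 / (4 * H * L m ^+ 2)) * c%:R)).
        apply: ler_pM; rewrite ?mulr_ge0 ?normc_ge0 ?kloosterman_le //.
        by apply: ler_pM; rewrite ?F1 ?G2.
      rewrite /hi mk le_eqVlt; apply/orP; left; apply/eqP; field.
      by rewrite !gt_eqF.
    case: (ltnP (absmod a) k0) => ak; last first.
      rewrite /= mulr0 add0r ler_wpDl //.
        by rewrite mulr_ge0 // mulr_ge0 // invr_ge0.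
      apply: (@le_trans _ _ (c%:R ^+ 2 / (4 * H * L a ^+ 2) * (c%:R / (2 * L m)) * c%:R)).
        apply: ler_pM; rewrite ?mulr_ge0 ?normc_ge0 ?kloosterman_le //.
        by apply: ler_pM; rewrite ?F2 ?G1.
      rewrite /hi ak le_eqVlt; apply/orP; left; apply/eqP; field.
      by rewrite !gt_eqF.
    rewrite /hi (leqNgt k0 (absmod m)) mk (leqNgt k0 (absmod a)) ak /= !mulr0 !addr0.
    apply: (@le_trans _ _ (c%:R / (2 * L a) * (c%:R / (2 * L m)) * normc (K a m))).
      apply: ler_wpM2r; first exact: normc_ge0.
      by apply: ler_pM; rewrite ?F1 ?G1.
    rewrite le_eqVlt; apply/orP; left; apply/eqP; field.
    by rewrite !gt_eqF.
  apply: le_trans (ler_sum _ (fun m m0 => ler_sum _ (fun a a0 => pt m a m0 a0))) _.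
  have eqS : \sum_(m : A | m != 0) \sum_(a : A | a != 0)
       (c%:R ^+ 2 / 4 * (if low k0 a && low k0 m then normc (K a m) / (L a * L m) else 0)
      + (c%:R ^+ 2 / 8 * (c%:R ^+ 2 / H) * ((L a)^-1 * hi m)
      + c%:R ^+ 2 / 8 * (c%:R ^+ 2 / H) * ((L m)^-1 * hi a)))
    = c%:R ^+ 2 / 4 * (\sum_(m : A | m != 0) \sum_(a : A | a != 0)
        (if low k0 a && low k0 m then normc (K a m) / (L a * L m) else 0))
      + (c%:R ^+ 2 / 8 * (c%:R ^+ 2 / H) *
           (\sum_(m : A | m != 0) \sum_(a : A | a != 0) (L a)^-1 * hi m)
      + c%:R ^+ 2 / 8 * (c%:R ^+ 2 / H) *
           (\sum_(m : A | m != 0) \sum_(a : A | a != 0) (L m)^-1 * hi a)).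
    rewrite !mulr_sumr -!big_split /=; apply: eq_bigr => m _.
    by rewrite !mulr_sumr -!big_split.
  rewrite eqS.
  have S1 : \sum_(m : A | m != 0) \sum_(a : A | a != 0)
      (if low k0 a && low k0 m then normc (K a m) / (L a * L m) else 0)
      <= 576 * (rho ^+ 3 * (tau c)%:R).
    apply: le_trans (kloosterman_low_le chD norm_ch ch_orth k0_small).
    rewrite exchange_big [leRHS]big_mkcond [leLHS]big_mkcond /=; apply: ler_sum => a _.
    rewrite /low; case: (a != 0) => //=; case: (absmod a < k0)%N => /=; last by rewrite big1.
    rewrite [leLHS]big_mkcond [leRHS]big_mkcond; apply: ler_sum => m _ /=.
    by case: (m != 0); case: (absmod m < k0)%N.
  have Shi : \sum_(m : A | m != 0) hi m <= 6 / rho ^+ 2 by rewrite /hi -big_mkcondr.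
  have Shi0 : 0 <= \sum_(m : A | m != 0) hi m by apply: sumr_ge0.
  have Sh0 : 0 <= \sum_(m : A | m != 0) (L m)^-1.
    by apply: sumr_ge0 => m _; rewrite invr_ge0.
  have S2 : \sum_(m : A | m != 0) (\sum_(a : A | a != 0) (L a)^-1 * hi m)
      <= 2 * h * (6 / rho ^+ 2).
    under eq_bigr => m _ do rewrite -mulr_suml.
    by rewrite -mulr_sumr; apply: ler_pM.
  have S3 : \sum_(m : A | m != 0) (\sum_(a : A | a != 0) (L m)^-1 * hi a)
      <= 2 * h * (6 / rho ^+ 2).
    under eq_bigr => m _ do rewrite -mulr_sumr.
    by rewrite -mulr_suml; apply: ler_pM.
  have q0 : 0 <= c%:R ^+ 2 / 4 :> R by rewrite divr_ge0 // exprn_ge0.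
  have q : 0 <= c%:R ^+ 2 / 8 * (c%:R ^+ 2 / H).
    by rewrite mulr_ge0 // ?divr_ge0 ?exprn_ge0 // ltW.
  apply: le_trans (lerD (ler_wpM2l q0 S1) (lerD (ler_wpM2l q S2) (ler_wpM2l q S3))) _.
  have t0 : 0 <= 2 * h * (6 / rho ^+ 2).
    by rewrite !mulr_ge0 // invr_ge0 exprn_ge0 // ltW.
  have q5 : c%:R ^+ 2 / 8 * (c%:R ^+ 2 / H) <= c%:R ^+ 2 / 8 * rho ^+ 5.
    by rewrite ler_wpM2l // divr_ge0 // exprn_ge0.
  apply: le_trans (lerD (lexx _) (lerD (ler_wpM2r t0 q5) (ler_wpM2r t0 q5))) _.
  rewrite le_eqVlt; apply/orP; left; apply/eqP; field.
  by rewrite gt_eqF.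
apply: le_trans (lerD part0 partn) _; rewrite -mulrDr; apply: ler_wpM2l.
  by rewrite exprn_ge0.
by rewrite le_eqVlt; apply/orP; left; apply/eqP; ring.
Qed.

End FullError.

(** * Fourier analysis of intervals of residues *)

Section Trapezoid.
Variables (R : rcfType) (n : nat).
Local Notation c := n.+2.
Local Notation A := 'I_c.

(** Written as a sum of point masses, the indicator of [N] consecutive residues has explicit shifts
    and a geometric Fourier transform; for [N > c] it counts with multiplicity. *)
Definition itv (k : A) (N : nat) (a : A) : R :=
  \sum_(i < N) (a == k + i%:R)%:R.

(* The average of [H] shifts of an interval; its Fourier coefficients decay
   quadratically. *)
Definition trap (k : A) (N H : nat) (a : A) : R :=
  H%:R^-1 * \sum_(s < H) itv (k + s%:R) N a.

Lemma itv_ge0 k N a : 0 <= itv k N a.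
Proof. by apply: sumr_ge0 => i _; rewrite ler0n. Qed.

Lemma itv_le1 k N a : (N <= c)%N -> itv k N a <= 1.
Proof.
move=> Nc; rewrite /itv -natr_sum -[1]/(1%:R) ler_nat.
have inj : injective (fun i : 'I_N => i%:R : A).
  move=> i j; rewrite !Zp_nat => /(congr1 val) /=.
  by rewrite !modn_small ?(leq_trans (ltn_ord _) Nc) // => /val_inj.
case: (pickP (fun i : 'I_N => a == k + i%:R)) => [i /eqP ai|e]; last first.
  by rewrite big1 // => i _; rewrite e.
rewrite (bigD1 i) //= ai eqxx big1 // => j ji.
by rewrite (inj_eq (addrI k)) (inj_eq inj) eq_sym (negPf ji).
Qed.

Lemma sum_pred1 (b : A) : \sum_(a : A) (a == b)%:R = 1 :> R.
Proof.
rewrite (bigD1 b) //= eqxx big1 ?addr0 // => a /negPf ->.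
by [].
Qed.

Lemma sum_itv k N : \sum_a itv k N a = N%:R.
Proof.
rewrite /itv exchange_big /=; under eq_bigr => i _ do rewrite sum_pred1.
by rewrite sumr_const card_ord.
Qed.

Lemma itv_shift k N a :
  itv (k + 1) N a - itv k N a = (a == k + N%:R)%:R - (a == k)%:R.
Proof.
rewrite /itv; elim: N => [|N IH]; first by rewrite !big_ord0 addr0 !subrr.
rewrite !big_ord_recr /= opprD addrACA IH.
have -> : k + 1 + N%:R = k + N.+1%:R by rewrite -natr1; ring.
by ring.
Qed.

Lemma sum_itv_shift_le k N s :
  \sum_a `|itv (k + s%:R) N a - itv k N a| <= (2 * s)%:R.
Proof.
elim: s => [|s IH]; first by rewrite big1 // => a _; rewrite addr0 subrr normr0.
have -> : (2 * s.+1)%:R = 2 + (2 * s)%:R :> R by rewrite -natrD; congr _%:R; lia.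
apply: (@le_trans _ _ (\sum_a (((a == k + s%:R + N%:R)%:R + (a == k + s%:R)%:R)
   + `|itv (k + s%:R) N a - itv k N a|))).
  apply: ler_sum => a _.
  have -> : itv (k + s.+1%:R) N a - itv k N a
    = (itv (k + s%:R + 1) N a - itv (k + s%:R) N a) + (itv (k + s%:R) N a - itv k N a).
    by rewrite -natr1 addrA; ring.
  apply: le_trans (ler_normD _ _) _; rewrite lerD2r itv_shift.
  by apply: le_trans (ler_normB _ _) _; rewrite !normr_nat.
by rewrite !big_split /= !sum_pred1 lerD.
Qed.

Lemma sum_trap_itv_le k N H : (0 < H)%N ->
  \sum_a `|trap k N H a - itv k N a| <= 2 * H%:R.
Proof.
move=> H0; have HR : 0 < H%:R :> R by rewrite ltr0n.
have e a : `|trap k N H a - itv k N a|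
    <= H%:R^-1 * \sum_(s < H) `|itv (k + s%:R) N a - itv k N a|.
  have -> : trap k N H a - itv k N a
     = H%:R^-1 * \sum_(s < H) (itv (k + s%:R) N a - itv k N a).
    rewrite sumrB mulrBr sumr_const card_ord -[itv k N a *+ H]mulr_natl mulrA.
    by rewrite mulVf ?gt_eqF // mul1r.
  rewrite normrM ger0_norm ?invr_ge0 ?ler0n // ler_wpM2l ?invr_ge0 //.
  exact: ler_norm_sum.
apply: le_trans (ler_sum _ (fun a _ => e a)) _.
rewrite -mulr_sumr exchange_big /= ler_pdivrMl //.
apply: (@le_trans _ _ (\sum_(s < H) (2 * H%:R))).
  apply: ler_sum => s _; apply: le_trans (sum_itv_shift_le _ _ _) _.
  by rewrite natrM ler_wpM2l // ler_nat ltnW.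
by rewrite sumr_const card_ord le_eqVlt -[_ *+ H]mulr_natl eqxx.
Qed.

Lemma trap_ge0 k N H a : 0 <= trap k N H a.
Proof.
by apply: mulr_ge0; rewrite ?invr_ge0 //; apply: sumr_ge0 => s _; exact: itv_ge0.
Qed.

Lemma trap_le1 k N H a : (N <= c)%N -> trap k N H a <= 1.
Proof.
move=> Nc; case: (posnP H) => [->|H0]; first by rewrite /trap invr0 mul0r.
rewrite /trap ler_pdivrMl ?ltr0n // mulr1.
apply: (@le_trans _ _ (\sum_(s < H) 1)); last by rewrite sumr_const card_ord.
by apply: ler_sum => s _; exact: itv_le1.
Qed.

Local Notation normc := ComplexField.Normc.normc.
Variable ch : A -> R[i].
Hypothesis chD : forall x y, ch (x + y) = ch x * ch y.
Hypothesis norm_ch : forall x, normc (ch x) = 1.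
Hypothesis ch_orth : forall x, \sum_m ch (m * x) = if x == 0 then c%:R else 0.
Hypothesis ch_far : forall x,
  4 * (absmod x)%:R / c%:R <= normc (1 - ch x).
Local Notation K := (kloosterman ch).
Local Notation L x := ((absmod x)%:R : R).

Definition fourier (f : A -> R) (m : A) : R[i] :=
  \sum_a (f a)%:C%C * ch (- (m * a)).

Lemma fourier_inv (f : A -> R) (x : A) :
  \sum_m fourier f m * ch (m * x) = (c%:R * f x)%:C%C.
Proof.
rewrite /fourier.
under eq_bigr => m _ do rewrite mulr_suml.
rewrite exchange_big /=.
have E (a : A) : \sum_m (f a)%:C%C * ch (- (m * a)) * ch (m * x)
    = (f a)%:C%C * (if x == a then c%:R else 0).
  rewrite -subr_eq0 -ch_orth mulr_sumr; apply: eq_bigr => m _.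
  by rewrite -mulrA -chD; congr (_ * ch _); ring.
under eq_bigr => a _ do rewrite E.
rewrite (bigD1 x) //= eqxx big1 => [|a /negPf]; last first.
  by rewrite eq_sym => ->; rewrite mulr0.
by rewrite addr0 rmorphM /= rmorph_nat mulrC.
Qed.

Lemma fourier_kloosterman (f g : A -> R) :
  (c%:R ^+ 2 * \sum_(x : A | x \is a GRing.unit) f x * g x^-1)%:C%C
  = \sum_m \sum_a fourier f a * fourier g m * K a m.
Proof.
have E (x : A) : (c%:R ^+ 2 * (f x * g x^-1))%:C%C
   = \sum_m \sum_a fourier f a * fourier g m * ch (a * x + m * x^-1).
  have -> : c%:R ^+ 2 * (f x * g x^-1) = (c%:R * g x^-1) * (c%:R * f x) by ring.
  rewrite rmorphM /= -!fourier_inv big_distrlr /=; apply: eq_bigr => m _.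
  by apply: eq_bigr => a _; rewrite chD; ring.
rewrite mulr_sumr rmorph_sum /=.
under eq_bigr => x _ do rewrite E.
rewrite exchange_big /=; apply: eq_bigr => m _.
rewrite exchange_big /=; apply: eq_bigr => a _.
by rewrite -mulr_sumr.
Qed.

Lemma fourier0 (g : A -> R) : fourier g 0 = (\sum_a g a)%:C%C.
Proof.
rewrite /fourier rmorph_sum /=; apply: eq_bigr => a _.
by rewrite mul0r oppr0 (ch0 chD norm_ch) mulr1.
Qed.

(** The frequency [m = 0] of [g] is removed exactly: by inversion in [a] it contributes the density
    of [g] times the sum of [f] over the units. No equidistribution of units in intervals is
    used. *)
Lemma fourier_discrepancy (f g : A -> R) :
  c%:R ^+ 2 * `|\sum_(x : A | x \is a GRing.unit) f x * g x^-1
    - (\sum_a g a) / c%:R * \sum_(x : A | x \is a GRing.unit) f x|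
  <= \sum_(m : A | m != 0) \sum_a
       normc (fourier f a) * normc (fourier g m) * normc (K a m).
Proof.
have c0 : (c%:R : R) != 0 by rewrite pnatr_eq0.
have z0 : \sum_a fourier f a * fourier g 0 * K a 0
   = (c%:R * (\sum_a g a) * \sum_(x : A | x \is a GRing.unit) f x)%:C%C.
  rewrite fourier0; move: (\sum_a g a) => G.
  under eq_bigr => a _ do rewrite mulrAC mulr_sumr mulr_suml.
  rewrite exchange_big mulr_sumr rmorph_sum /=; apply: eq_bigr => x _.
  rewrite -mulr_suml.
  under eq_bigr => a _ do rewrite mul0r addr0.
  by rewrite fourier_inv -rmorphM /=; congr _%:C%C; ring.
have := fourier_kloosterman f g; rewrite [X in _ = X](bigD1 (0 : A)) //= z0.
set G := \sum_a g a; set S := \sum_(x : A | _) _ * _; set T := \sum_(x : A | _) _.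
move=> e.
have {}e : (c%:R ^+ 2 * (S - G / c%:R * T))%:C%C
   = \sum_(m | m != 0) \sum_a fourier f a * fourier g m * K a m.
  have gen (x s g0 t : R) : x != 0 -> x ^+ 2 * (s - g0 / x * t) = x ^+ 2 * s - x * g0 * t.
    by move=> x0; field.
  rewrite gen //.
  by rewrite rmorphB /= e addrAC subrr add0r.
rewrite -[leLHS]ger0_norm ?mulr_ge0 ?exprn_ge0 // normrM normr_id -normrM.
rewrite -normc_real e; apply: le_trans (norm_sum _ _ _) _.
apply: ler_sum => m _; apply: le_trans (norm_sum _ _ _) _.
by apply: ler_sum => a _; rewrite !ComplexField.Normc.normcM.
Qed.

Definition dirichlet (m : A) (N : nat) : R[i] := \sum_(i < N) ch (- (m * i%:R)).

Lemma norm_dirichlet_le m N : normc (dirichlet m N) <= N%:R.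
Proof.
apply: le_trans (norm_sum _ _ _) _; under eq_bigr do rewrite norm_ch.
by rewrite sumr_const card_ord.
Qed.

Lemma chX x i : ch (x * i%:R) = ch x ^+ i.
Proof.
elim: i => [|i IH]; first by rewrite mulr0 (ch0 chD norm_ch).
by rewrite -natr1 mulrDr mulr1 chD IH exprSr.
Qed.

Lemma norm_dirichlet_far m N : m != 0 ->
  normc (dirichlet m N) <= c%:R / (2 * L m).
Proof.
move=> m0; have Lm : 0 < L m by rewrite ltr0n absmod_gt0.
have c0 : 0 < c%:R :> R by rewrite ltr0n.
set z := ch (- m).
have zE : dirichlet m N = \sum_(i < N) z ^+ i.
  by apply: eq_bigr => i _; rewrite -mulNr chX.
have e : normc (z - 1) * normc (dirichlet m N) <= 2.
  rewrite -ComplexField.Normc.normcM zE -subrX1.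
  apply: le_trans (le_normcD _ _) _.
  rewrite normcN ComplexField.Normc.normc1.
  by rewrite -chX norm_ch.
have far : 4 * L m / c%:R <= normc (z - 1).
  have -> : normc (z - 1) = normc (ch m) * normc (z - 1) by rewrite norm_ch mul1r.
  rewrite -ComplexField.Normc.normcM mulrBr mulr1 /z -chD subrr (ch0 chD norm_ch).
  exact: ch_far.
have := ler_wpM2r (normc_ge0 (dirichlet m N)) far => h.
have := le_trans h e; rewrite mulrAC ler_pdivrMr // => h2.
rewrite ler_pdivlMr ?mulr_gt0 //; lra.
Qed.

(** A trapezoid is the convolution of two intervals, so its transform is a product of two geometric
    sums. Bounding one of them trivially gives linear decay, bounding neither trivially gives
    quadratic decay. *)
Lemma fourier_trap k N H m : (0 < H)%N ->
  fourier (trap k N H) m = (H%:R^-1)%:C%C * ch (- (m * k)) * dirichlet m H * dirichlet m N.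
Proof.
move=> H0; rewrite /fourier /trap.
under eq_bigr => a _ do rewrite rmorphM /= rmorph_sum /= -mulrA mulr_suml.
rewrite -mulr_sumr -!mulrA; congr (_ * _).
rewrite exchange_big big_distrlr /= [RHS]mulr_sumr; apply: eq_bigr => s _.
have E (a : A) : (itv (k + s%:R) N a)%:C%C * ch (- (m * a))
   = \sum_(i < N) (a == k + s%:R + i%:R)%:R * ch (- (m * a)).
  rewrite /itv rmorph_sum mulr_suml; apply: eq_bigr => i _.
  by rewrite rmorph_nat.
under eq_bigr => a _ do rewrite E.
rewrite exchange_big /= mulr_sumr; apply: eq_bigr => i _.
rewrite (bigD1 (k + s%:R + i%:R)) //= eqxx big1 => [|a /negPf ->].
  by rewrite addr0 mul1r -!chD; congr ch; ring.
by rewrite mul0r.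
Qed.

Lemma norm_fourier_trap k N H m : (0 < H)%N ->
  normc (fourier (trap k N H) m)
  = H%:R^-1 * normc (dirichlet m H) * normc (dirichlet m N).
Proof.
move=> H0; rewrite fourier_trap // !ComplexField.Normc.normcM norm_ch mulr1.
by rewrite normc_real ger0_norm // invr_ge0.
Qed.

(** In the sum of absolute values an interval and its trapezoid differ by at most [2 H]. Replacing
    both intervals costs [4 H] in the double sum and [2 H] in the expected term, whence [6 H]. *)
Lemma itv_discrepancy (k l : A) (N M H : nat) : (N <= c)%N -> (M <= c)%N ->
  (0 < H)%N -> rt4 c%:R ^+ 3 <= H%:R :> R ->
  `|\sum_(x : A | x \is a GRing.unit) itv k N x * itv l M x^-1
    - M%:R / c%:R * \sum_(x : A | x \is a GRing.unit) itv k N x|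
  <= 6 * H%:R + rt4 c%:R ^+ 3 * (144 * (tau c)%:R
       + 3 * \sum_(1 <= j < c) (j%:R : R)^-1 + 4).
Proof.
move=> Nc Mc H0 Hrho.
have HR : 0 < H%:R :> R by rewrite ltr0n.
have c0 : 0 < c%:R :> R by rewrite ltr0n.
set f := trap k N H; set g := trap l M H; set F := itv k N; set G := itv l M.
set E := rt4 _ ^+ 3 * _.
have sg : \sum_a g a = M%:R.
  rewrite /g /trap -mulr_sumr exchange_big /=.
  under eq_bigr do rewrite sum_itv.
  by rewrite sumr_const card_ord -[M%:R *+ H]mulr_natl mulKf ?gt_eqF.
have far1 q P m : m != 0 -> normc (fourier (trap q P H) m) <= c%:R / (2 * L m).
  move=> m0; rewrite norm_fourier_trap //.
  apply: le_trans _ (norm_dirichlet_far P m0).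
  rewrite ler_piMl ?normc_ge0 // ler_pdivrMl // mulr1.
  exact: norm_dirichlet_le.
have far2 q P m : m != 0 -> normc (fourier (trap q P H) m)
    <= c%:R ^+ 2 / (4 * H%:R * L m ^+ 2).
  move=> m0; rewrite norm_fourier_trap //.
  have Lm : 0 < L m by rewrite ltr0n absmod_gt0.
  have -> : c%:R ^+ 2 / (4 * H%:R * L m ^+ 2)
     = H%:R^-1 * (c%:R / (2 * L m)) * (c%:R / (2 * L m)).
    by field; rewrite !gt_eqF.
  apply: ler_pM; rewrite ?mulr_ge0 ?normc_ge0 ?invr_ge0 ?norm_dirichlet_far //.
  by rewrite ler_wpM2l ?invr_ge0 // norm_dirichlet_far.
have main : `|\sum_(x : A | x \is a GRing.unit) f x * g x^-1
    - M%:R / c%:R * \sum_(x : A | x \is a GRing.unit) f x| <= E.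
  have c2 : 0 < c%:R ^+ 2 :> R by rewrite exprn_gt0.
  rewrite -(ler_pM2l c2) -sg; apply: le_trans (fourier_discrepancy f g) _.
  apply: (@fourier_error_le R n ch chD norm_ch ch_orth H%:R
    (fun a => normc (fourier f a)) (fun a => normc (fourier g a))) => //.
  - by move=> m; exact: normc_ge0.
  - by move=> m; exact: normc_ge0.
  - rewrite norm_fourier_trap //; apply: (@le_trans _ _ N%:R); last by rewrite ler_nat.
    apply: le_trans _ (norm_dirichlet_le 0 N).
    by rewrite ler_piMl ?normc_ge0 // ler_pdivrMl // mulr1 norm_dirichlet_le.
  - exact: far1.
  - exact: far2.
  - exact: far1.
  - exact: far2.
have dF : \sum_(x : A | x \is a GRing.unit) `|f x - F x| <= 2 * H%:R.
  apply: le_trans _ (sum_trap_itv_le k N H0); rewrite big_mkcond.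
  by apply: ler_sum => x _; case: ifP.
have dG : \sum_(x : A | x \is a GRing.unit) `|g x^-1 - G x^-1| <= 2 * H%:R.
  apply: le_trans _ (sum_trap_itv_le l M H0).
  rewrite (reindex_inj (can_inj (@invrK A))) /= big_mkcond.
  by apply: ler_sum => x _; rewrite invrK; case: ifP.
set S := \sum_(x | _) f x * _ in main; set S' := \sum_(x | _) F x * _.
set T := \sum_(x | _) f x in main; set T' := \sum_(x | _) F x.
have dS : `|S' - S| <= 4 * H%:R.
  rewrite /S' /S -sumrB.
  apply: le_trans (ler_norm_sum _ _ _) _.
  apply: (@le_trans _ _ (\sum_(x : A | x \is a GRing.unit)
     (`|g x^-1 - G x^-1| + `|f x - F x|))); last by rewrite big_split /=; lra.
  apply: ler_sum => x _.
  have -> : F x * G x^-1 - f x * g x^-1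
     = - (F x * (g x^-1 - G x^-1) + g x^-1 * (f x - F x)) by ring.
  have gx : `|g x^-1| <= 1 by rewrite ger0_norm ?trap_le1 // /g trap_ge0.
  have Fx : `|F x| <= 1 by rewrite ger0_norm ?itv_le1 // /F itv_ge0.
  rewrite normrN; apply: le_trans (ler_normD _ _) _.
  rewrite (normrM (F x)) (normrM (g x^-1)).
  by apply: lerD; apply: ler_piMl.
have dT : `|T' - T| <= 2 * H%:R.
  rewrite distrC /T' /T -sumrB; exact: le_trans (ler_norm_sum _ _ _) dF.
have Mc1 : M%:R / c%:R <= 1 :> R by rewrite ler_pdivrMr // mul1r ler_nat.
have Mc0 : 0 <= M%:R / c%:R :> R by rewrite divr_ge0.
have dT' : `|M%:R / c%:R * (T' - T)| <= 2 * H%:R.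
  rewrite normrM ger0_norm //; apply: le_trans dT.
  by rewrite ler_piMl.
have -> : S' - M%:R / c%:R * T' = (S - M%:R / c%:R * T) + ((S' - S) - M%:R / c%:R * (T' - T)).
  by ring.
apply: le_trans (ler_normD _ _) _.
have h : `|S' - S - M%:R / c%:R * (T' - T)| <= 6 * H%:R.
  apply: le_trans (ler_normB _ _) _; lra.
by rewrite addrC lerD.
Qed.

End Trapezoid.

(** * Pairs of mutually inverse residues in intervals *)

(** Concavity through two mean values: were the sine below its chord at [x], its mean slope would be
    less than [2 / pi] before [x] and greater after, while the cosine decreases. *)
Lemma sin_ge_chord (R : realType) (x : R) : 0 <= x <= pi / 2 ->
  2 / pi * x <= sin x.
Proof.
move=> /andP[x0 xpi]; have pi0 := @pi_gt0 R.
have chord1 : 2 / pi * (pi / 2) = 1 :> R.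
  have gen (p : R) : 0 < p -> 2 / p * (p / 2) = 1 by move=> p0; field; rewrite gt_eqF.
  exact: gen.
rewrite leNgt; apply/negP => lt.
have mvt (a b : R) : a < b -> exists2 c, c \in `]a, b[ & sin b - sin a = cos c * (b - a).
  move=> ab; apply: (@MVT R (@sin R) (@cos R)) => //.
  by apply: continuous_subspaceT => y; exact: continuous_sin.
have x0' : 0 < x.
  by rewrite lt_neqAle x0 andbT; apply/eqP => x0e; move: lt; rewrite -x0e mulr0 sin0 ltxx.
have xpi' : x < pi / 2.
  rewrite lt_neqAle xpi andbT; apply/eqP => xe; move: lt; rewrite xe sin_pihalf.
  by rewrite chord1 ltxx.
have [y yx] := mvt _ _ x0'; rewrite sin0 !subr0 => ey.
have [z zx] := mvt _ _ xpi'; rewrite sin_pihalf => ez.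
move: yx zx; rewrite !in_itv /= => /andP[y0 yx] /andP[xz zpi].
have yz : y < z by exact: lt_trans xz.
have czy : cos z < cos y by rewrite ltr_cos // in_itv /=; apply/andP; split; lra.
have cy : cos y < 2 / pi by rewrite -(ltr_pM2r x0') -ey.
have cz : 2 / pi < cos z.
  have d0 : 0 < pi / 2 - x by rewrite subr_gt0.
  rewrite -(ltr_pM2r d0) -ez mulrBr.
  by rewrite chord1 ltrD2l ltrN2.
by have := lt_trans (lt_trans cz czy) cy; rewrite ltxx.
Qed.

Section RootOfUnity.
Variables (R : realType) (n : nat).
Local Notation c := n.+2.
Local Notation A := 'I_c.
Local Notation normc := ComplexField.Normc.normc.

Definition cexp (t : R) : R[i] := Complex (cos t) (sin t).

Lemma cexpD s t : cexp (s + t) = cexp s * cexp t.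
Proof. by rewrite /cexp cosD sinD; congr Complex; rewrite addrC // mulrC. Qed.

Lemma norm_cexp t : normc (cexp t) = 1.
Proof. by rewrite /= cos2Dsin2 sqrtr1. Qed.

Lemma cexpMn t i : cexp (t *+ i) = cexp t ^+ i.
Proof.
elim: i => [|i IH]; last by rewrite mulrS cexpD IH exprS.
by rewrite /cexp mulr0n cos0 sin0.
Qed.

Definition unity_char (x : A) : R[i] := cexp (pi *+ 2 / c%:R) ^+ x.
Local Notation ch := unity_char.

Lemma unity_charD x y : ch (x + y) = ch x * ch y.
Proof.
rewrite /ch -exprD expr_mod // -cexpMn.
have -> : pi *+ 2 / c%:R *+ c = pi *+ 2 :> R.
  by rewrite -[LHS]mulr_natr divfK ?pnatr_eq0.
by rewrite /cexp cos2pi sin2pi.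
Qed.

Lemma norm_unity_char x : normc (ch x) = 1.
Proof. by rewrite /ch -cexpMn norm_cexp. Qed.

(** With [t = pi x / c] the right side is [2 |sin t|]; reflection at [pi] brings the argument to
    [pi * absmod x / c <= pi / 2], where the chord bound applies. *)
Lemma unity_char_far x : 4 * (absmod x)%:R / c%:R <= normc (1 - ch x).
Proof.
have pi0 := @pi_gt0 R; have c0 : 0 < c%:R :> R by rewrite ltr0n.
set t := pi * (x%:R / c%:R) : R.
have -> : ch x = cexp (t *+ 2).
  rewrite /ch -cexpMn; congr cexp; rewrite /t; move: (pi : R) => p.
  by rewrite -[LHS]mulr_natr; field; rewrite gt_eqF.
have -> : normc (1 - cexp (t *+ 2)) = 2 * `|sin t|.
  have -> : 2 * `|sin t| = Num.sqrt ((2 * sin t) ^+ 2) by rewrite sqrtr_sqr normrM ger0_norm.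
  rewrite /cexp /= cos_mulr2n sin_mulr2n; congr Num.sqrt.
  have := cos2Dsin2 t; set C := cos t; set S := sin t => e.
  have {}e : C ^+ 2 = 1 - S ^+ 2 by rewrite -e; ring.
  rewrite add0r sqrrN; transitivity ((2 - 2 * C ^+ 2) ^+ 2 + 4 * (C ^+ 2 * S ^+ 2)).
    by ring.
  by rewrite e; ring.
have -> : 4 * (absmod x)%:R / c%:R = 2 * (2 / pi * (pi * ((absmod x)%:R / c%:R))) :> R.
  have gen (p a b : R) : 0 < p -> 0 < b -> 4 * a / b = 2 * (2 / p * (p * (a / b))).
    by move=> p0 b0; field; rewrite !gt_eqF.
  exact: gen.
rewrite ler_wpM2l //.
have sE : `|sin t| = sin (pi * ((absmod x)%:R / c%:R)).
  have xc : (x%:R : R) <= c%:R by rewrite ler_nat ltnW.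
  have t0 : 0 <= t <= pi.
    rewrite /t mulr_ge0 ?divr_ge0 ?(ltW pi0) //=.
    by rewrite -[leRHS]mulr1 ler_wpM2l ?(ltW pi0) // ler_pdivrMr // mul1r.
  rewrite ger0_norm ?sin_ge0_pi // /absmod; case: leqP => // _.
  rewrite natrB; last by rewrite ltnW.
  have -> : pi * ((c%:R - x%:R) / c%:R) = - (t - pi).
    by rewrite /t; move: (pi : R) => p; field; rewrite gt_eqF.
  by rewrite sinN sinB sinpi cospi mulr0 subr0 mulrN1 opprK.
rewrite sE; apply: sin_ge_chord.
rewrite mulr_ge0 ?divr_ge0 ?(ltW pi0) //=.
rewrite ler_wpM2l ?(ltW pi0) // ler_pdivrMr // mulrC ler_pdivlMr // -natrM ler_nat.
rewrite /absmod; have : (x < c)%N by []. lia.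
Qed.

Lemma unity_char_orth x : \sum_m ch (m * x) = if x == 0 then c%:R else 0.
Proof.
have E (m : A) : ch (m * x) = ch x ^+ m.
  by rewrite -(chX unity_charD norm_unity_char) natr_Zp mulrC.
under eq_bigr => m _ do rewrite E.
case: eqP => [->|/eqP x0].
  by rewrite (ch0 unity_charD norm_unity_char); under eq_bigr do rewrite expr1n; rewrite sumr_const card_ord.
have z1 : 1 - ch x != 0.
  apply/eqP => e; have := unity_char_far x; rewrite e ComplexField.Normc.normc0.
  by rewrite leNgt divr_gt0 ?mulr_gt0 ?ltr0n ?absmod_gt0.
rewrite subr_eq0 eq_sym -subr_eq0 in z1; apply: (mulfI z1); rewrite mulr0 -subrX1.
have -> : ch x ^+ c = 1.
  rewrite -(chX unity_charD norm_unity_char) (_ : c%:R = 0) ?mulr0 ?(ch0 unity_charD norm_unity_char) //.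
  by apply: val_inj; rewrite Zp_nat; exact: modnn.
by rewrite subrr.
Qed.

End RootOfUnity.

(** The smoothing length is the integer just above [c^(3/4)], hence at most [2 c^(3/4)]; the
    smoothing cost [6 H] then raises the additive constant from 4 to 16, rounded up to 20. *)
Definition modulus_error (R : realType) (c : nat) : R :=
  rt4 c%:R ^+ 3 * (144 * (tau c)%:R + 3 * \sum_(1 <= j < c) j%:R^-1 + 20).

Lemma intr_Zp_eq0E n (z : int) : (z%:~R == 0 :> 'I_n.+2) = (n.+2%:Z %| z)%Z.
Proof.
apply/eqP/idP => [/intr_Zp_eq0 //|/dvdzP[q ->]].
rewrite rmorphM /= -[X in _ * X]pmulrn (_ : n.+2%:R = 0) ?mulr0 //.
by apply: val_inj; rewrite Zp_nat; exact: modnn.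
Qed.

Lemma intr_Zp_mul1E n (z w : int) :
  (z%:~R * w%:~R == 1 :> 'I_n.+2) = (n.+2%:Z %| z * w - 1)%Z.
Proof. by rewrite -intr_Zp_eq0E rmorphB rmorphM /= subr_eq0. Qed.

Lemma intr_Zp_unitE n (z : int) :
  ((z%:~R : 'I_n.+2) \is a GRing.unit) = coprimez z n.+2.
Proof.
apply/idP/idP => [uz|/coprimezP[[u v] /= e]].
  have := intr_Zp_mul1E n z (val (z%:~R : 'I_n.+2)^-1)%:Z.
  rewrite -[X in _ * X == _]pmulrn natr_Zp divrr // eqxx => /esym /dvdzP[q e].
  apply/coprimezP; exists ((val (z%:~R : 'I_n.+2)^-1)%:Z, - q).
  by rewrite mulrC mulNr -e opprB addrC subrK.
apply/unitrP; exists (u%:~R); suff h : (u%:~R * z%:~R = 1 :> 'I_n.+2).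
  by rewrite h mulrC h.
apply/eqP; rewrite intr_Zp_mul1E; apply/dvdzP; exists (- v).
by rewrite -e mulNr opprD addNKr.
Qed.

Lemma inverse_pairs_discrepancy (R : realType) (c : nat) (k l : int) (N M : nat) :
  (0 < c)%N -> (N <= c)%N -> (M <= c)%N ->
  `|\sum_(i < N) \sum_(j < M) ((c%:Z %| (k + i%:Z) * (l + j%:Z) - 1)%Z)%:R
    - M%:R / c%:R * \sum_(i < N) (coprimez (k + i%:Z) c%:Z)%:R|
  <= modulus_error R c.
Proof.
move=> c0 Nc Mc.
have rho0 : 0 < rt4 (c%:R : R) by apply: rt4_gt0; rewrite ltr0n.
(* The ring ['I_n.+2] requires a modulus of at least 2. Modulo 1 every pair is counted and the
   discrepancy is zero. *)
case: c c0 Nc Mc rho0 => [//|[|n]] _ Nc Mc rho0.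
  have -> : \sum_(i < N) \sum_(j < M) ((1%:Z %| (k + i%:Z) * (l + j%:Z) - 1)%Z)%:R
     = N%:R * M%:R :> R.
    rewrite (eq_bigr (fun=> M%:R)) => [|i _].
      by rewrite sumr_const card_ord -[LHS]mulr_natl.
    by rewrite (eq_bigr (fun=> 1)) => [|j _]; rewrite ?dvd1z // sumr_const card_ord.
  have -> : \sum_(i < N) (coprimez (k + i%:Z) 1%:Z)%:R = N%:R :> R.
    by under eq_bigr => i _ do rewrite coprimezE coprimen1; rewrite sumr_const card_ord.
  rewrite divr1 mulrC subrr normr0 mulr_ge0 ?exprn_ge0 ?(ltW rho0) //.
  by rewrite !addr_ge0 ?mulr_ge0 // sumr_ge0 // => j _; rewrite invr_ge0.
set c := n.+2; set rho := rt4 _ in rho0 *.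
have rho1 : 1 <= rho ^+ 3.
  rewrite exprn_ege1 // -(@rt4_1 R); apply: ler_rt4; rewrite ler1n //.
pose H := (Num.truncn (rho ^+ 3)).+1.
have H1 : rho ^+ 3 <= H%:R by rewrite ltW // truncnS_gt.
have H2 : H%:R <= rho ^+ 3 + 1.
  by rewrite -natr1 lerD2r truncn_le // (le_trans ler01).
have := @itv_discrepancy R n (@unity_char R n) (@unity_charD R n) (@norm_unity_char R n)
  (@unity_char_orth R n) (@unity_char_far R n) k%:~R l%:~R N M H Nc Mc (ltn0Sn _) H1.
have unitE i : (k%:~R + i%:R : 'I_c) = (k + i%:Z)%:~R by rewrite rmorphD /= -pmulrn.
have unitE' i : (l%:~R + i%:R : 'I_c) = (l + i%:Z)%:~R by rewrite rmorphD /= -pmulrn.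
have sum1 (y : 'I_c) (P : pred 'I_c) (F : 'I_c -> R) :
    \sum_(x | P x) (x == y)%:R * F x = if P y then F y else 0.
  case: ifP => Py.
    rewrite (bigD1 y) //= eqxx mul1r big1 ?addr0 // => x /andP[_ /negPf ->].
    by rewrite mul0r.
  rewrite big1 // => x Px; case: eqP => [xy|_]; last by rewrite mul0r.
  by move: Py; rewrite -xy Px.
have -> : \sum_(x : 'I_c | x \is a GRing.unit) itv R k%:~R N x * itv R l%:~R M x^-1
   = \sum_(i < N) \sum_(j < M) ((c%:Z %| (k + i%:Z) * (l + j%:Z) - 1)%Z)%:R.
  under eq_bigr => x _ do rewrite /itv mulr_suml.
  rewrite exchange_big; apply: eq_bigr => i _ /=.
  rewrite sum1; case: ifP => u; last first.
    rewrite big1 // => j _; rewrite -intr_Zp_mul1E -unitE -unitE'.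
    case: eqP => // e; move: u; suff -> : k%:~R + i%:R \is a @GRing.unit 'I_c by [].
    by apply/unitrP; exists (l%:~R + j%:R); rewrite {1}mulrC e.
  apply: eq_bigr => j _; rewrite -intr_Zp_mul1E -unitE -unitE'.
  congr (nat_of_bool _)%:R; apply/eqP/eqP => [<-|e]; first by rewrite divrr.
  by apply: (mulrI u); rewrite divrr // e.
have -> : \sum_(x : 'I_c | x \is a GRing.unit) itv R k%:~R N x
   = \sum_(i < N) (coprimez (k + i%:Z) c%:Z)%:R.
  rewrite exchange_big; apply: eq_bigr => i _ /=.
  rewrite (eq_bigr (fun x : 'I_c => (x == k%:~R + i%:R)%:R * 1)) => [|x _]; last by rewrite mulr1.
  by rewrite (sum1 _ _ (fun=> 1)) unitE intr_Zp_unitE; case: coprimez.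
move=> /le_trans; apply.
rewrite -/rho /modulus_error -/rho.
set h := \sum_(1 <= j < c) _; have : 6 * H%:R <= 12 * rho ^+ 3 :> R by lra.
move: (rho ^+ 3) rho1 H1 H2 => r; move: (tau c)%:R => t; nra.
Qed.

(** * Summation over the moduli *)

(* [R^(7/4) log R], that is [R^2] times the rate of the theorem. *)
Definition errf (R : realType) (r : R) : R := r * rt4 r ^+ 3 * ln r.

Section Errors.
Variable R : realType.
Implicit Types r : R.

Lemma ln_ge_half r : 2 <= r -> 1 / 2 <= ln r.
Proof.
move=> r2; have r0 : 0 < r by lra.
have ri : r^-1 <= 1 / 2 by rewrite div1r lef_pV2 ?posrE.
have ri0 : 0 < r^-1 by rewrite invr_gt0.
have : ln (1 + (r^-1 - 1)) <= r^-1 - 1 by apply: le_ln1Dx; lra.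
by rewrite addrC subrK lnV ?posrE // => ?; lra.
Qed.

Lemma harmonic_le_ln (n : nat) : (0 < n)%N ->
  \sum_(1 <= j < n.+1) (j%:R : R)^-1 <= 1 + ln n%:R.
Proof.
case: n => // n _; elim: n => [|n IH].
  by rewrite big_nat1 invr1 ln1 addr0.
rewrite big_nat_recr //=; apply: le_trans (lerD IH (lexx _)) _.
rewrite -addrA lerD2l.
have n0 : 0 < n.+1%:R :> R by rewrite ltr0n.
have n1 : 0 < n.+2%:R :> R by rewrite ltr0n.
have i0 : 0 < n.+2%:R^-1 :> R by rewrite invr_gt0.
have i1 : n.+2%:R^-1 <= 1 / 2 :> R.
  by rewrite div1r lef_pV2 ?posrE ?ltr0n // ler_nat.
have : ln (1 + - (n.+2%:R)^-1) <= - (n.+2%:R^-1) :> R.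
  by apply: le_ln1Dx; move: i1; move: (n.+2%:R^-1 : R) => x i1; lra.
have -> : 1 + - (n.+2%:R)^-1 = n.+1%:R / n.+2%:R :> R.
  by rewrite -[n.+2%:R]natr1; field; rewrite gt_eqF // natr1.
by rewrite ln_div ?posrE //; move: (n.+2%:R^-1 : R) => x ?; lra.
Qed.

Lemma sum_tau_le (n : nat) :
  \sum_(1 <= c < n.+1) (tau c)%:R <= n%:R * \sum_(1 <= j < n.+1) (j%:R : R)^-1.
Proof.
apply: (@le_trans _ _ (\sum_(1 <= c < n.+1) \sum_(1 <= d < n.+1) (d %| c)%N%:R)).
  apply: ler_sum_nat => c /andP[c0 cn].
  rewrite -natr_sum ler_nat /tau.
  rewrite (eq_bigr (fun d => if (d %| c)%N then 1%N else 0%N)); last first.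
    by move=> d _; case: ifP.
  rewrite -big_mkcond -big_filter sum1_size; apply: eq_leq; apply: perm_size.
  apply: uniq_perm.
  - exact: divisors_uniq.
  - by rewrite filter_uniq // iota_uniq.
  move=> d; rewrite mem_filter mem_index_iota -dvdn_divisors //.
  case: (boolP (d %| c)%N) => //= dc.
  by rewrite (dvdn_gt0 c0 dc) (leq_ltn_trans _ cn) // dvdn_leq.
rewrite exchange_big mulr_sumr; apply: ler_sum_nat => d /andP[d0 _] /=.
rewrite ler_pdivlMr ?ltr0n // -natr_sum -natrM ler_nat.
apply: leq_trans (leq_trunc_div n d); rewrite leq_mul2r; apply/orP; right.
elim: n => [|n IH]; first by rewrite big_geq.
by rewrite big_nat_recr //= divnS // addnC leq_add2l.
Qed.

Lemma errf_ge0 r : 1 <= r -> 0 <= errf r.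
Proof.
by move=> r1; rewrite !mulr_ge0 ?exprn_ge0 ?rt4_ge0 ?ln_ge0 //; lra.
Qed.

Lemma modulus_error_ge0 c : 0 <= modulus_error R c.
Proof.
rewrite mulr_ge0 ?exprn_ge0 ?rt4_ge0 // !addr_ge0 ?mulr_ge0 //.
by apply: sumr_ge0 => j _; rewrite invr_ge0.
Qed.

(** The divisor function is logarithmic on average, so summation over the moduli costs one logarithm
    and no power of [r]. *)
Lemma sum_modulus_error_le r : 2 <= r ->
  \sum_(1 <= c < (Num.truncn r).+1) modulus_error R c <= 481 * errf r.
Proof.
move=> r2; have r0 : 0 <= r by lra.
set n := Num.truncn r; have nr : n%:R <= r by rewrite truncn_le.
have n0 : (0 < n)%N.
  by rewrite /n truncn_gt0; lra.
have n0R : 0 < n%:R :> R by rewrite ltr0n.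
set h := \sum_(1 <= j < n.+1) (j%:R : R)^-1.
have hL : h <= 3 * ln r.
  have := harmonic_le_ln n0; have := ln_ge_half r2.
  have : ln n%:R <= ln r by rewrite ler_ln ?posrE //; lra.
  rewrite -/h; lra.
have h0 : 0 <= h by apply: sumr_ge0 => j _; rewrite invr_ge0.
set rho := rt4 r ^+ 3.
have rho0 : 0 <= rho by rewrite exprn_ge0 ?rt4_ge0.
apply: (@le_trans _ _ (\sum_(1 <= c < n.+1) rho * (144 * (tau c)%:R + (3 * h + 20)))).
  apply: ler_sum_nat => c /andP[c0 cn]; rewrite /modulus_error -addrA.
  apply: ler_pM.
  - by rewrite exprn_ge0 ?rt4_ge0.
  - rewrite !addr_ge0 ?mulr_ge0 //.
    by apply: sumr_ge0 => j _; rewrite invr_ge0.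
  - rewrite lerXn2r ?nnegrE ?rt4_ge0 //; apply: ler_rt4; apply: le_trans nr.
    by rewrite ler_nat.
  - rewrite lerD2l lerD2r ler_wpM2l // /h (big_cat_nat c0 (ltnW cn)) /=.
    by rewrite lerDl; apply: sumr_ge0 => j _; rewrite invr_ge0.
rewrite -mulr_sumr big_split /= -mulr_sumr sumr_const_nat subn1 /=.
have ts := sum_tau_le n; rewrite -/h in ts.
have -> : errf r = rho * (r * ln r) by rewrite /errf -/rho; ring.
rewrite mulrCA; apply: ler_wpM2l => //.
have := ln_ge_half r2 => L2.
rewrite -[X in _ + X]mulr_natl.
apply: (@le_trans _ _ (144 * (n%:R * h) + n%:R * (3 * h + 20))).
  by rewrite lerD2r ler_wpM2l.
have -> : 144 * (n%:R * h) + n%:R * (3 * h + 20) = n%:R * (147 * h + 20) by ring.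
(* From [h <= 3 ln r] and [1 <= 2 ln r]: [147 * 3 + 20 * 2 = 481]. *)
apply: (@le_trans _ _ (r * (481 * ln r))); last by rewrite mulrCA.
by apply: ler_pM => //; lra.
Qed.

End Errors.

(** * The component of the companion vector along v *)

Definition lam (R : realType) (v w : int * int) : R :=
  (w.1%:~R * v.1%:~R + w.2%:~R * v.2%:~R) / (v.1%:~R ^+ 2 + v.2%:~R ^+ 2).

Section Lam.
Variable R : realType.

Lemma enorm_sqr (u : R * R) : enorm u ^+ 2 = u.1 ^+ 2 + u.2 ^+ 2.
Proof. by rewrite sqr_sqrtr // addr_ge0 // sqr_ge0. Qed.

Lemma enorm_ge0 (u : R * R) : 0 <= enorm u.
Proof. exact: sqrtr_ge0. Qed.

Lemma primitive_neq0 v : primitive v -> 0 < v.1%:~R ^+ 2 + v.2%:~R ^+ 2 :> R.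
Proof.
case: v => a b; rewrite /primitive /= => ab.
rewrite lt_neqAle addr_ge0 ?sqr_ge0 // andbT eq_sym paddr_eq0 ?sqr_ge0 //.
rewrite !sqrf_eq0 !intr_eq0; apply/negP => /andP[/eqP a0 /eqP b0].
by move: ab; rewrite a0 b0.
Qed.

(** Both [w + v] and [w - v] solve the same equation; comparing their norms with that of [w] bounds
    [2 |<w, v>|] by [|v|^2]. *)
Lemma lam_le_half v w : primitive v -> shortest_solution R v w -> `|lam R v w| <= 1 / 2.
Proof.
move=> pv [gw short]; have q0 := primitive_neq0 pv.
case: v w pv gw short q0 => a b [x y]; rewrite /gcd_solution /lam /= => _ gw short q0.
have le_sqr (w' : int * int) : gcd_solution (a, b) w' ->
    (x%:~R ^+ 2 + y%:~R ^+ 2 : R) <= w'.1%:~R ^+ 2 + w'.2%:~R ^+ 2.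
  move=> /short h; have := h; rewrite -(@ler_pXn2r _ 2) ?nnegrE ?enorm_ge0 //.
  by rewrite !enorm_sqr.
have := le_sqr (x + a, y + b); have := le_sqr (x - a, y - b).
rewrite /gcd_solution /= !rmorphB !rmorphD /=.
have g1 : b * (x - a) - a * (y - b) = 1 by rewrite -gw; ring.
have g2 : b * (x + a) - a * (y + b) = 1 by rewrite -gw; ring.
move=> /(_ g1) h1 /(_ g2) h2.
rewrite normrM [X in _ * X]ger0_norm ?invr_ge0 ?(ltW q0) // ler_pdivrMr //.
rewrite ler_norml; apply/andP; split; move: q0 h1 h2;
  set X := x%:~R; set Y := y%:~R; set a' := a%:~R; set b' := b%:~R; nra.
Qed.

(** The difference equals [- k / (c^2 + k^2)] by the gcd equation, and [2 |k| <= 1 + k^2]. *)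
Lemma lam_near c (k x y : int) : (0 < c) -> gcd_solution (c, k) (x, y) ->
  `|c%:~R * lam R (c, k) (x, y) - x%:~R| <= 1 / 2.
Proof.
rewrite /gcd_solution /lam /= => c0 g.
have cR : 1 <= c%:~R :> R by rewrite ler1z; lia.
have gR : k%:~R * x%:~R - c%:~R * y%:~R = 1 :> R by rewrite -!intrM -rmorphB g.
set C := c%:~R in cR gR *; set K := k%:~R in gR *; set X := x%:~R in gR *; set Y := y%:~R in gR *.
have q0 : 0 < C ^+ 2 + K ^+ 2 by nra.
have -> : C * ((X * C + Y * K) / (C ^+ 2 + K ^+ 2)) - X = - (K * (K * X - C * Y)) / (C ^+ 2 + K ^+ 2).
  by field; rewrite gt_eqF.
rewrite gR mulr1 normrM normrN [X in _ * X]ger0_norm ?invr_ge0 ?(ltW q0) //.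
rewrite ler_pdivrMr // ler_norml.
have C2 : 1 <= C ^+ 2 by rewrite exprn_ege1.
have K1 := sqr_ge0 (K + 1); have K2 := sqr_ge0 (K - 1).
by apply/andP; split; lra.
Qed.

End Lam.

Section PerModulus.
Variables (R : realType) (w : int * int -> int * int).
Hypothesis shortest_w : forall v, primitive v -> shortest_solution R v (w v).
Local Notation lamw v := (lam R v (w v)).

(* Only the upper bound is proved directly: the lower bound follows by applying
   it to the complementary intervals of [-1/2, 1/2]. *)
Lemma lam_count_closed_le (c N : nat) (k : int) (s t : R) :
  (0 < c)%N -> (N <= c)%N -> s <= t ->
  \sum_(i < N) (coprimez c (k + i%:Z) && (s <= lamw (c%:Z, k + i%:Z) <= t))%:R
  <= (t - s) * \sum_(i < N) (coprimez c (k + i%:Z))%:R + (modulus_error R c + 4).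
Proof.
move=> c0 Nc st.
have cR : 1 <= c%:R :> R by rewrite ler1n.
set l := Num.floor (c%:R * s); set u := Num.floor (c%:R * t).
have lu : l <= u by apply: le_floor; rewrite ler_wpM2l.
(* The first coordinate of the companion is within [1/2] of [c * lam], so it lies between [l] and
   [u + 1], a window of [u - l + 2] integers. *)
pose M := absz (u - l + 2).
have ME : (M%:Z = u - l + 2) by rewrite /M gez0_abs //; lia.
set T := \sum_(i < N) (coprimez c (k + i%:Z))%:R.
have T0 : 0 <= T by apply: sumr_ge0 => i _; rewrite ler0n.
have TN : T <= c%:R.
  apply: (@le_trans _ _ N%:R); last by rewrite ler_nat.
  rewrite -[leRHS]mulr1 mulr_natl -[N in leRHS]card_ord -sumr_const.
  by apply: ler_sum => i _; rewrite lern1 leq_b1.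
have E0 := modulus_error_ge0 R c.
have Mc : M%:R <= c%:R * (t - s) + 3.
  have -> : M%:R = u%:~R - l%:~R + 2 :> R by rewrite pmulrn ME !rmorphD rmorphN.
  have := floor_le (c%:R * t); rewrite -/u => h1.
  have := floorD1_gt (c%:R * s); rewrite -/l intrD => h2.
  move: h1 h2; rewrite mulrBr; lra.
case: (leqP M c) => [Mlec|cM].
  have := inverse_pairs_discrepancy R k l c0 Nc Mlec.
  set S := \sum_(i < N) _; rewrite (eq_bigr (fun i : 'I_N => (coprimez c (k + i%:Z))%:R)); last first.
    by move=> i _; rewrite coprimez_sym.
  rewrite -/T ler_norml => /andP[_ h].
  apply: (@le_trans _ _ S).
    apply: ler_sum => i _; case: (boolP (coprimez _ _)) => [cop|_] /=; last first.
      by rewrite sumr_ge0 // => j _; rewrite ler0n.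
    case: (boolP (_ <= _ <= _)) => [/andP[sl lt]|_]; last first.
      by rewrite sumr_ge0 // => j _; rewrite ler0n.
    have [gw _] := shortest_w (cop : primitive (c%:Z, k + i%:Z)).
    move: sl lt gw; case: (w _) => x y sl lt gw.
    have := lam_near R (_ : 0 < c%:Z) gw; rewrite ltz_nat => /(_ c0).
    rewrite ler_norml => /andP[n1 n2].
    have cRR : (c%:Z%:~R : R) = c%:R by rewrite pmulrn.
    have lx : l <= x.
      rewrite -ltzD1 -(ltr_int R) intrD.
      have := floor_le (c%:R * s); rewrite -/l => h3.
      have := ler_wpM2l (ltW (lt_le_trans ltr01 cR)) sl; rewrite -cRR; rewrite -cRR in h3.
      move=> ?; lra.
    have xu : x <= u + 1.
      rewrite -ltzD1 -(ltr_int R) !intrD.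
      have := floorD1_gt (c%:R * t); rewrite -/u intrD => h3.
      have := ler_wpM2l (ltW (lt_le_trans ltr01 cR)) lt; rewrite -cRR; rewrite -cRR in h3.
      move=> ?; lra.
    have jM : (`|x - l| < M)%N by lia.
    rewrite (bigD1 (Ordinal jM)) //= -[leLHS]addr0 lerD //.
      rewrite ler_nat lt0b; apply/dvdzP; exists y.
      have -> : l + `|x - l|%N%:Z = x by lia.
      by move: gw; rewrite /gcd_solution /= => gw; lia.
    by rewrite sumr_ge0 // => j _; rewrite ler0n.
  have : M%:R / c%:R * T <= (t - s) * T + 3.
    apply: (@le_trans _ _ ((t - s + 3 / c%:R) * T)).
      apply: ler_wpM2r => //; rewrite ler_pdivrMr ?(lt_le_trans ltr01) // mulrDl divfK.
        by rewrite mulrC.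
      by rewrite gt_eqF // (lt_le_trans ltr01).
    rewrite mulrDl lerD2l -mulrA ler_piMr // ler_pdivrMl ?(lt_le_trans ltr01) //.
    by rewrite mulr1.
  by move=> ?; lra.
(* When the window is longer than a period, [c (1 - (t - s)) < 3], and since [T <= c] the trivial
   bound [T] is already within 3 of [(t - s) T]. *)
have {}cM : c%:R < M%:R :> R by rewrite ltr_nat.
apply: (@le_trans _ _ T).
  by apply: ler_sum => i _; case: coprimez => //=; rewrite lern1 leq_b1.
nra.
Qed.

(** [I] may be any predicate between the open and the closed interval, so that the value [lam = 0]
    can be given to either sign class or to none. *)
Lemma lam_count_discrepancy (c N : nat) (k : int) (s t : R) (I : R -> bool) :
  (0 < c)%N -> (N <= c)%N -> - (1 / 2) <= s -> s <= t -> t <= 1 / 2 ->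
  (forall x, s < x < t -> I x) -> (forall x, I x -> s <= x <= t) ->
  `|\sum_(i < N) (coprimez c (k + i%:Z) && I (lamw (c%:Z, k + i%:Z)))%:R
    - (t - s) * \sum_(i < N) (coprimez c (k + i%:Z))%:R|
  <= 2 * (modulus_error R c + 4).
Proof.
move=> c0 Nc s0 st t1 I1 I2.
have h2 := lam_count_closed_le k c0 Nc st.
have h1 := lam_count_closed_le k c0 Nc s0.
have h3 := lam_count_closed_le k c0 Nc t1.
set T := \sum_(i < N) (coprimez c (k + i%:Z))%:R in h1 h2 h3 *.
set S := \sum_(i < N) _.
set S1 := \sum_(i < N) _ in h1; set S2 := \sum_(i < N) _ in h2; set S3 := \sum_(i < N) _ in h3.
have SS2 : S <= S2.
  apply: ler_sum => i _; case: (coprimez _ _) => //=.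
  by case: (boolP (I _)) => [/I2 ->|_]; rewrite ?ler0n.
have SS : T <= S + S1 + S3.
  rewrite -!big_split; apply: ler_sum => i _ /=.
  case: (boolP (coprimez _ _)) => [cop|_] /=; last by rewrite !addr0.
  have prim : primitive (c%:Z, k + i%:Z) by [].
  have := lam_le_half prim (shortest_w prim).
  rewrite ler_norml => /andP[l1 l2].
  case: (boolP (I _)) => [_|nI]; first by rewrite -addrA lerDl addr_ge0.
  rewrite l1 l2 /= andbT.
  case: (leP _ s) => [_|ls]; first by rewrite add0r lerDl.
  case: (leP t _) => [_|lt]; first by rewrite !add0r.
  by move/negP: nI; case; apply: I1; rewrite ls lt.
have E0 := modulus_error_ge0 R c.
rewrite ler_norml; apply/andP; split; lra.
Qed.

End PerModulus.

(** * Primitive points of a disc, row by row *)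

Definition zrange (n : nat) : seq int := [seq i%:Z - n%:Z | i <- iota 0 (2 * n).+1].

Definition box (n : nat) : seq (int * int) :=
  [seq (a, b) | a <- zrange n, b <- zrange n].

Definition disc (R : realType) (r : R) : seq (int * int) :=
  [seq v <- box (Num.truncn r) | primitive v && (enorm (vec R v) <= r)].

Lemma mem_zrange n z : (z \in zrange n) = (- n%:Z <= z <= n%:Z).
Proof.
apply/mapP/idP => [[ i ]|zn].
  by rewrite mem_iota /= add0n => ? ->; apply/andP; split; lia.
exists (absz (z + n%:Z)); first by rewrite mem_iota /=; lia.
lia.
Qed.

Lemma zrange_uniq n : uniq (zrange n).
Proof. by rewrite map_inj_uniq ?iota_uniq // => i j; lia. Qed.

Lemma mem_box n v : (v \in box n) = (v.1 \in zrange n) && (v.2 \in zrange n).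
Proof.
apply/allpairsP/idP => [[[a b] [/= an bn ->]]|/andP[an bn]].
  by rewrite /= an bn.
by exists v; rewrite -surjective_pairing.
Qed.

Lemma box_uniq n : uniq (box n).
Proof. by apply: allpairs_uniq; rewrite ?zrange_uniq // => -[a b] [c d] _ _ [-> ->]. Qed.

Section Disc.
Variable R : realType.
Implicit Types r : R.

Lemma disc_uniq r : uniq (disc r).
Proof. by rewrite filter_uniq // box_uniq. Qed.

Lemma enorm_vec_le r (v : int * int) : 0 <= r ->
  (enorm (vec R v) <= r) = (v.1%:~R ^+ 2 + v.2%:~R ^+ 2 <= r ^+ 2).
Proof.
move=> r0; rewrite -(@ler_pXn2r _ 2) ?nnegrE ?enorm_ge0 //.
by rewrite enorm_sqr.
Qed.

Lemma le_truncn_int r (z : int) : 0 <= r -> z%:~R ^+ 2 <= r ^+ 2 ->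
  z \in zrange (Num.truncn r).
Proof.
move=> r0 zr; rewrite mem_zrange.
have : `|z%:~R| <= r :> R.
  by rewrite -(@ler_pXn2r _ 2) ?nnegrE // real_normK ?num_real.
rewrite -intr_norm => h.
have : (absz z <= Num.truncn r)%N.
  by rewrite truncn_ge_nat // pmulrn abszE.
by lia.
Qed.

Lemma mem_disc r v : 0 <= r -> (v \in disc r) = primitive v && (enorm (vec R v) <= r).
Proof.
move=> r0; rewrite mem_filter; case: (boolP (primitive v)) => //= _.
case: (boolP (enorm (vec R v) <= r)) => //=; rewrite enorm_vec_le // => vr.
rewrite mem_box !le_truncn_int //; apply: le_trans vr.
  by rewrite lerDr sqr_ge0.
by rewrite lerDl sqr_ge0.
Qed.

(** A row fixes the first coordinate [c], which is also the modulus, so each row is a sum over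
    consecutive integers [k] to which the estimates modulo [c] apply. *)
Lemma sum_disc_rows r (Q : pred (int * int)) (F : int * int -> R) (lo hi : nat -> int) :
  0 <= r ->
  (forall c, (c <= Num.truncn r)%N -> lo c <= hi c) ->
  (forall v, v \in disc r -> Q v -> 0 < v.1) ->
  (forall c k, (0 < c <= Num.truncn r)%N -> coprimez c k ->
     Q (c%:Z, k) && (enorm (vec R (c%:Z, k)) <= r) = (lo c <= k < hi c)) ->
  \sum_(v <- disc r | Q v) F v
  = \sum_(1 <= c < (Num.truncn r).+1) \sum_(i < absz (hi c - lo c))
      (coprimez c (lo c + i%:Z))%:R * F (c%:Z, lo c + i%:Z).
Proof.
move=> r0 lohi Qpos Qint; set n := Num.truncn r in lohi Qint *.
pose rows := [seq (c%:Z, lo c + i%:Z) | c <- iota 1 n, i <- iota 0 (absz (hi c - lo c))].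
transitivity (\sum_(v <- rows | primitive v) F v).
  rewrite -big_filter -[RHS]big_filter; apply: perm_big; apply: uniq_perm.
  - by rewrite filter_uniq // disc_uniq.
  - rewrite filter_uniq //; apply: allpairs_uniq_dep; rewrite ?iota_uniq //.
      by move=> *; rewrite iota_uniq.
    move=> [c i] [c' i'] _ _ /= [cc]; move: i' cc => i' [cc] /=; move: i'.
    rewrite -cc => i' e; congr existT; lia.
  move=> [a k]; rewrite mem_filter mem_disc // [RHS]mem_filter /=.
  apply/idP/idP.
    move=> /andP[Qa /andP[pa na]].
    have vd : (a, k) \in disc r by rewrite mem_disc // pa.
    have /= a0 := Qpos _ vd Qa.
    have an : a \in zrange n.
      apply: le_truncn_int => //; move: na; rewrite enorm_vec_le //= => na.
      by apply: le_trans na; rewrite lerDl sqr_ge0.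
    rewrite mem_zrange in an.
    have aE : a = (absz a)%:Z by lia.
    have ac : (0 < absz a <= n)%N by lia.
    rewrite pa /=; apply/allpairsPdep; exists (absz a), (absz (k - lo (absz a))).
    have := Qint _ k ac; rewrite -aE Qa na => /(_ pa) /esym /andP[l1 l2].
    by split; [rewrite mem_iota | rewrite mem_iota /=; lia | congr (_, _); lia].
  move=> /andP[pa /allpairsPdep[c [i [ci ii [ae ke]]]]].
  have cn : (0 < c <= n)%N by move: ci; rewrite mem_iota; lia.
  have lh := lohi c; have {}lh := lh _; case/andP: (cn) => _ cn'; have {}lh := lh cn'.
  have := Qint c k cn; rewrite -ae => h; have {}h := h pa.
  have : lo c <= k < hi c by move: ii; rewrite ke mem_iota; lia.
  by rewrite -h pa => /andP[-> ->].
rewrite big_mkcond big_allpairs_dep /= /index_iota subn1 /=.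
apply: eq_bigr => c _; rewrite -[X in iota 0 X]subn0 -/(index_iota 0 _) big_mkord.
by apply: eq_bigr => i _; rewrite /primitive /=; case: coprimez; rewrite ?mul1r ?mul0r.
Qed.

End Disc.

Definition wedge (R : realType) (s1 s2 : R) (v : int * int) : bool :=
  (0 < v.1) && (s1 * v.1%:~R <= v.2%:~R < s2 * v.1%:~R).

(** Slopes of one sign and at most 1 in absolute value: row [c] then meets at most [c] integers, a
    single period modulo [c], and the square of the slope is monotone. *)
Definition half_octant (R : realType) (s1 s2 : R) : Prop :=
  [/\ -1 <= s1, s1 <= s2, s2 <= 1 & 0 <= s1 \/ s2 <= 0].

Section Wedge.
Variable R : realType.
Implicit Types r s t : R.

Definition row_bound r (c : nat) : int := Num.floor (Num.sqrt (r ^+ 2 - c%:R ^+ 2)).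

Definition row_lo r s1 (c : nat) : int :=
  Num.max (Num.ceil (s1 * c%:R)) (- row_bound r c).

(** The outer [max] gives an empty row the length 0; lengths are read through [absz], which would
    turn a negative difference into a positive length. *)
Definition row_hi r s1 s2 (c : nat) : int :=
  Num.max (row_lo r s1 c) (Num.min (Num.ceil (s2 * c%:R)) (row_bound r c + 1)).

Lemma row_width r s1 s2 c : half_octant s1 s2 ->
  (absz (row_hi r s1 s2 c - row_lo r s1 c) <= c)%N.
Proof.
move=> [s1m s12 s21 half].
set x := Num.ceil (s1 * c%:R); set y := Num.ceil (s2 * c%:R).
have xy : x <= y by apply: le_ceil; rewrite ler_wpM2r.
have cR : 0 <= c%:R :> R by [].
have yx : y - x <= c%:Z.
  case: half => h.
    have x0 : 0 <= x by rewrite ceil_ge0 (lt_le_trans (ltrN10 R)) // mulr_ge0.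
    have : y <= c%:Z by rewrite ceil_le_int -pmulrn; nra.
    lia.
  have y0 : y <= 0 by rewrite ceil_le_int; nra.
  have : - c%:Z <= x.
    rewrite -ltzD1 -ltrBlDr ceil_gt_int rmorphB rmorphN /= -pmulrn; nra.
  lia.
rewrite /row_hi /row_lo -/x -/y; lia.
Qed.

Lemma wedge_rowP r s1 s2 (c : nat) (k : int) : half_octant s1 s2 -> 0 <= r ->
  (0 < c <= Num.truncn r)%N ->
  wedge s1 s2 (c%:Z, k) && (enorm (vec R (c%:Z, k)) <= r)
  = (row_lo r s1 c <= k < row_hi r s1 s2 c).
Proof.
move=> ho r0 /andP[c0 cn].
have cr : c%:R <= r :> R.
  have nr : (Num.truncn r)%:R <= r by rewrite truncn_le.
  by apply: le_trans nr; rewrite ler_nat.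
rewrite /wedge /= enorm_vec_le //= -!pmulrn ltz_nat c0 /=.
have d0 : 0 <= r ^+ 2 - c%:R ^+ 2 by rewrite subr_ge0 lerXn2r // nnegrE.
have -> : (c%:R ^+ 2 + k%:~R ^+ 2 <= r ^+ 2 :> R) = (- row_bound r c <= k <= row_bound r c).
  rewrite -lerBrDl -(sqr_sqrtr d0) /row_bound; set q := Num.sqrt _.
  have q0 : 0 <= q by exact: sqrtr_ge0.
  rewrite -(real_normK (num_real k%:~R)) ler_pXn2r ?nnegrE // ler_norml.
  by rewrite [in RHS]lerNl !floor_ge_int rmorphN /= lerNl.
rewrite -ceil_le_int -ceil_gt_int /row_hi /row_lo.
rewrite ge_max !lt_max lt_min ltzD1.
by case: (lerP (Num.ceil (s1 * c%:R)) k) => //= _; case: (lerP (- _) k) => //= _; rewrite ?andbF.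
Qed.

Lemma sum_wedge r s1 s2 (F : int * int -> R) : half_octant s1 s2 -> 0 <= r ->
  \sum_(v <- disc r | wedge s1 s2 v) F v
  = \sum_(1 <= c < (Num.truncn r).+1)
      \sum_(i < absz (row_hi r s1 s2 c - row_lo r s1 c))
      (coprimez c (row_lo r s1 c + i%:Z))%:R * F (c%:Z, row_lo r s1 c + i%:Z).
Proof.
move=> ho r0; apply: sum_disc_rows => //.
- by move=> c _; rewrite /row_hi le_max lexx.
- by move=> v _ /andP[].
- by move=> c k cn _; apply: wedge_rowP.
Qed.

Lemma wedge_lam_discrepancy (w : int * int -> int * int) r s1 s2 s t (I : R -> bool) :
  (forall v, primitive v -> shortest_solution R v (w v)) ->
  half_octant s1 s2 -> 2 <= r ->
  - (1 / 2) <= s -> s <= t -> t <= 1 / 2 ->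
  (forall x, s < x < t -> I x) -> (forall x, I x -> s <= x <= t) ->
  `|\sum_(v <- disc r | wedge s1 s2 v) (I (lam R v (w v)))%:R
    - (t - s) * \sum_(v <- disc r | wedge s1 s2 v) 1| <= 1000 * errf r.
Proof.
move=> sw ho r2 s0 st t1 I1 I2; have r0 : 0 <= r by lra.
rewrite !sum_wedge // mulr_sumr -sumrB.
apply: le_trans (ler_norm_sum _ _ _) _.
apply: (@le_trans _ _ (\sum_(1 <= c < (Num.truncn r).+1) 2 * (modulus_error R c + 4))).
  apply: ler_sum_nat => c /andP[c0 _].
  have := lam_count_discrepancy sw (row_lo r s1 c) c0 (row_width r c ho) s0 st t1 I1 I2.
  set S := \sum_(i < _) _; set T := \sum_(i < _) _.
  set S' := \sum_(i < _) _; set T' := \sum_(i < _) _.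
  have -> : S' = S by apply: eq_bigr => i _; case: coprimez; rewrite ?mul1r ?mul0r.
  by have -> : T' = T by apply: eq_bigr => i _; rewrite mulr1.
rewrite -mulr_sumr big_split /= sumr_const_nat subn1 /=.
have h := sum_modulus_error_le r2.
have nr : (Num.truncn r)%:R <= r by rewrite truncn_le.
rewrite -[X in _ + X]mulr_natr.
(* The additive 4 of each row sums to at most [4 r <= 8 errf r]; altogether [2 * (481 + 8) = 978],
   rounded up to 1000. *)
have : r <= 2 * errf r.
  have L := ln_ge_half r2.
  have q1 : 1 <= rt4 r ^+ 3.
    by rewrite exprn_ege1 // -(@rt4_1 R); apply: ler_rt4; lra.
  rewrite /errf; move: q1 L; set q := rt4 r ^+ 3; set L := ln r => q1 L1.
  have : 1 / 2 <= q * L by nra.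
  rewrite -mulrA => ?; nra.
lra.
Qed.

End Wedge.

(** * Primitive points in sectors *)

(** The Moebius function; for [n = 1] there are no primes and the value is 1. *)
Definition mu (n : nat) : int :=
  if all (fun p => logn p n == 1%N) (primes n) then (-1) ^+ size (primes n) else 0.

Lemma abs_mu_le1 n : `|mu n| <= 1.
Proof. by rewrite /mu; case: ifP => _; rewrite ?normrX ?normrN1 ?expr1n ?normr0. Qed.

Lemma mu_sqr_dvd p n : prime p -> (0 < n)%N -> (p ^ 2 %| n)%N -> mu n = 0.
Proof.
move=> pp n0 pn; rewrite /mu ifF //; apply/negP => /allP/(_ p).
have pn1 : (p %| n)%N by rewrite (dvdn_trans _ pn) // dvdn_exp.
rewrite mem_primes pp n0 pn1 => /(_ isT) /eqP l1.
by move: pn; rewrite pfactor_dvdn // l1.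
Qed.

Lemma muM_prime p n : prime p -> (0 < n)%N -> ~~ (p %| n)%N -> mu (p * n) = - mu n.
Proof.
move=> pp n0 pn; have p0 := prime_gt0 pp.
have perm : perm_eq (primes (p * n)) (p :: primes n).
  apply: uniq_perm; rewrite ?primes_uniq //=.
    by rewrite primes_uniq mem_primes (negPf pn) !andbF.
  by move=> q; rewrite primesM // primes_prime // !inE.
rewrite /mu (perm_all _ perm) (perm_size perm) /= lognM // logn_prime // eqxx.
rewrite (lognE p n) (negPf pn) !andbF /=.
have -> : all (fun q => logn q (p * n) == 1%N) (primes n) = all (fun q => logn q n == 1%N) (primes n).
  apply: eq_in_all => q; rewrite mem_primes => /and3P[qp _ qn].
  rewrite lognM // logn_prime // (_ : (q == p) = false) //.
  by apply/negP => /eqP qe; move: pn; rewrite -qe qn.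
by case: ifP; rewrite ?oppr0 // exprS mulN1r.
Qed.

(** For a prime [p] dividing [n], the divisors [d] prime to [p] cancel against [p d], and those
    divisible by [p ^ 2] contribute nothing. *)
Lemma sum_mu_divisors n : (0 < n)%N -> \sum_(d <- divisors n) mu d = (n == 1)%N%:Z.
Proof.
move=> n0; case: (ltngtP n 1) => [|n1|->]; first by rewrite ltnNge n0.
  2: by rewrite /divisors /= big_seq1.
set p := pdiv n; have pp : prime p by exact: pdiv_prime.
have pn : (p %| n)%N by exact: pdiv_dvd.
rewrite (bigID (fun d => p %| d)%N) /=.
suff -> : \sum_(d <- divisors n | (p %| d)%N) mu d
    = - \sum_(d <- divisors n | ~~ (p %| d)%N) mu d by rewrite addNr.
rewrite (bigID (fun d => p ^ 2 %| d)%N) /= big_seq_cond big1 ?add0r; last first.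
  move=> d /andP[dn /andP[_ pd]]; apply: (mu_sqr_dvd pp) => //.
  by move: dn; rewrite -dvdn_divisors // => /(dvdn_gt0 n0).
rewrite -big_filter -[X in - X]big_filter.
rewrite (perm_big (map (muln p) [seq d <- divisors n | ~~ (p %| d)%N])) /=.
  rewrite big_map -sumrN big_seq [RHS]big_seq; apply: eq_bigr => d.
  rewrite mem_filter -dvdn_divisors // => /andP[pd dn].
  by rewrite muM_prime // (dvdn_gt0 n0 dn).
apply: uniq_perm; rewrite ?filter_uniq ?divisors_uniq //.
  rewrite map_inj_uniq ?filter_uniq ?divisors_uniq // => x y /eqP.
  by rewrite eqn_pmul2l ?prime_gt0 // => /eqP.
have p0 := prime_gt0 pp.
move=> d; apply/idP/mapP => [|[e]].
  rewrite mem_filter -dvdn_divisors // => /andP[/andP[pd p2d] dn].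
  exists (d %/ p)%N; last by rewrite mulnC divnK.
  rewrite mem_filter -dvdn_divisors // (dvdn_trans (dvdn_div pd) dn) andbT.
  apply: contra p2d => pdp; rewrite -(divnK pd) expnS expn1.
  by rewrite dvdn_mul.
rewrite !mem_filter -!dvdn_divisors // => /andP[pe en] ->.
rewrite dvdn_mulr //= expnS expn1 dvdn_pmul2l // pe /=.
by rewrite Gauss_dvd ?pn ?en // prime_coprime.
Qed.

Lemma coprimez_sum_mu (R : realType) (c : nat) (k : int) : (0 < c)%N ->
  (coprimez c k)%:R = \sum_(d <- divisors c | (d%:Z %| k)%Z) (mu d)%:~R :> R.
Proof.
move=> c0; set g := gcdn c (absz k).
have g0 : (0 < g)%N by rewrite gcdn_gt0 c0.
have -> : (coprimez c k)%:R = ((g == 1)%N%:Z)%:~R :> R.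
  by rewrite coprimezE /coprime /=; case: (gcdn _ _ == 1)%N.
rewrite -(sum_mu_divisors g0) rmorph_sum /= -[RHS]big_filter; apply: perm_big.
apply: uniq_perm; rewrite ?filter_uniq ?divisors_uniq // => d.
rewrite mem_filter -!dvdn_divisors // dvdn_gcd andbC.
by rewrite -[(_ %| k)%Z]/(d %| absz k)%N.
Qed.

Section Kappa.
Variable R : realType.

(* A partial sum of [1 / zeta 2]; keeping it instead of the limit avoids the
   tail, since only [kappa >= 1/4] matters. *)
Definition kappa (n : nat) : R := \sum_(1 <= d < n.+1) (mu d)%:~R / d%:R ^+ 2.

Lemma norm_muR_le1 d : `|(mu d)%:~R| <= 1 :> R.
Proof. by rewrite -intr_norm -[1]/(1%:~R) ler_int abs_mu_le1. Qed.

(** The term [d = 1] is 1. The others amount to at most [3/4] in absolute value: [1/4] for [d = 2],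
    and a telescoping [1/2] for [d >= 3]. *)
Lemma kappa_bounds n : (0 < n)%N -> 1 / 4 <= kappa n <= 2.
Proof.
have tail m : \sum_(2 <= d < m.+3) (d%:R ^+ 2 : R)^-1 <= 3 / 4 - m.+2%:R^-1.
  elim: m => [|m IH].
    by rewrite big_nat1; lra.
  rewrite big_nat_recr //=; apply: le_trans (lerD IH (lexx _)) _.
  have m0 : 2 <= m.+2%:R :> R by rewrite ler_nat.
  rewrite -[m.+3%:R]natr1; move: m0; move: (m.+2%:R : R) => x x2.
  have -> : 3 / 4 - (x + 1)^-1 = 3 / 4 - x^-1 + (x * (x + 1))^-1.
    by field; rewrite !gt_eqF //; lra.
  by rewrite lerD2l lef_pV2 ?posrE; nra.
case: n => // -[|n] _; rewrite /kappa.
  by rewrite big_nat1 /mu /= expr1n divr1; lra.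
rewrite big_ltn // [X in X + _](_ : _ = 1); last by rewrite /mu /= expr1n divr1.
set S := \sum_(2 <= d < _) _.
have : `|S| <= 3 / 4.
  apply: le_trans (ler_norm_sum _ _ _) _.
  apply: le_trans (_ : _ <= 3 / 4 - n.+2%:R^-1) _; last by rewrite gerBl invr_ge0.
  apply: le_trans (tail n); apply: ler_sum_nat => d _.
  rewrite normrM normfV (ger0_norm (exprn_ge0 _ _)) //.
  by apply: ler_piMl; rewrite ?invr_ge0 ?exprn_ge0 ?norm_muR_le1.
rewrite ler_norml => /andP[S1 S2]; apply/andP; split; lra.
Qed.

End Kappa.

Section Triangle.
Variable R : realType.
Implicit Types x y s X : R.

Definition zint x y : seq int :=
  [seq Num.ceil x + i%:Z | i <- iota 0 (absz (Num.ceil y - Num.ceil x))].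

Lemma mem_zint x y (k : int) : x <= y -> (k \in zint x y) = (x <= k%:~R < y).
Proof.
move=> xy; have cxy : Num.ceil x <= Num.ceil y by exact: le_ceil.
rewrite -ceil_le_int -ceil_gt_int /zint.
move: (Num.ceil x) (Num.ceil y) cxy => a b ab; apply/mapP/idP => [[ i ]|kxy].
  by rewrite mem_iota => ? ->; lia.
exists (absz (k - a)); last lia.
by rewrite mem_iota; lia.
Qed.

Lemma zint_uniq x y : uniq (zint x y).
Proof. by rewrite map_inj_uniq ?iota_uniq // => i j; lia. Qed.

Lemma size_zint_near x y : x <= y -> `|(size (zint x y))%:R - (y - x)| <= 1.
Proof.
move=> xy; have cxy : Num.ceil x <= Num.ceil y by exact: le_ceil.
rewrite size_map size_iota.
have -> : (absz (Num.ceil y - Num.ceil x))%:R = (Num.ceil y)%:~R - (Num.ceil x)%:~R :> R.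
  by rewrite pmulrn gez0_abs ?subr_ge0 // rmorphB.
have := ceil_itv x; have := ceil_itv y; rewrite !rmorphB /= => /andP[a b] /andP[c d].
by rewrite ler_norml; apply/andP; split; lra.
Qed.

(** Scaling respects half-open intervals, so there is no rounding error: the multiples of [d] in row
    [c] correspond exactly to row [c / d]. *)
Lemma zint_multiples x y (d : nat) : (0 < d)%N -> x <= y ->
  \sum_(k <- zint (x * d%:R) (y * d%:R) | (d%:Z %| k)%Z) 1 = (size (zint x y))%:R :> R.
Proof.
move=> d0 xy; have dR : 0 < d%:R :> R by rewrite ltr0n.
have dE : (d%:Z%:~R : R) = d%:R by rewrite pmulrn.
have xyd : x * d%:R <= y * d%:R by rewrite ler_wpM2r // ltW.
rewrite -big_filter (perm_big (map (fun k => k * d%:Z) (zint x y))) /=.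
  by rewrite big_map big_const_seq count_predT iter_addr_0.
apply: uniq_perm; rewrite ?filter_uniq ?zint_uniq //.
  by rewrite map_inj_uniq ?zint_uniq // => a b /(mulIf _) ->//; lia.
move=> k; rewrite mem_filter mem_zint //; apply/idP/mapP.
  move=> /andP[/dvdzP[q ->]]; rewrite rmorphM /= dE.
  rewrite ler_pM2r // ltr_pM2r // => xq; exists q => //; by rewrite mem_zint.
move=> [q]; rewrite mem_zint // => xq ->.
by rewrite rmorphM /= dE dvdz_mull //= ler_pM2r // ltr_pM2r.
Qed.

Definition row_count s1 s2 (c : nat) : R :=
  \sum_(k <- zint (s1 * c%:R) (s2 * c%:R)) (coprimez c k)%:R.

Definition row_size s1 s2 (c : nat) : R := (size (zint (s1 * c%:R) (s2 * c%:R)))%:R.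

Lemma row_count_mu s1 s2 c : (0 < c)%N -> s1 <= s2 ->
  row_count s1 s2 c
  = \sum_(1 <= d < c.+1 | (d %| c)%N) (mu d)%:~R * row_size s1 s2 (c %/ d).
Proof.
move=> c0 s12; rewrite /row_count.
under eq_bigr => k _ do rewrite (coprimez_sum_mu R k c0) big_mkcond.
rewrite exchange_big /= -[RHS]big_filter.
rewrite (perm_big [seq d <- index_iota 1 c.+1 | (d %| c)%N]); last first.
  apply: uniq_perm; rewrite ?divisors_uniq ?filter_uniq ?iota_uniq // => d.
  rewrite mem_filter mem_index_iota -dvdn_divisors //.
  by case: (boolP (d %| c)%N) => //= dc; rewrite ltnS (dvdn_gt0 c0 dc) dvdn_leq.
rewrite !big_filter; apply: eq_bigr => d dc.
have d0 := dvdn_gt0 c0 dc.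
rewrite -big_mkcond /row_size -(@zint_multiples _ _ d) ?ler_wpM2r //.
rewrite mulr_sumr -!mulrA -natrM divnK //.
by apply: eq_bigr => k _; rewrite mulr1.
Qed.

Lemma sum_dvdn_reindex (F : nat -> R) (d m : nat) : (0 < d)%N ->
  \sum_(1 <= c < m.+1 | (d %| c)%N) F (c %/ d)%N = \sum_(1 <= c < (m %/ d).+1) F c.
Proof.
move=> d0; elim: m => [|m IH]; first by rewrite div0n !big_geq.
rewrite big_mkcond big_nat_recr //= -big_mkcond IH divnS //.
by case: (d %| m.+1)%N; rewrite ?addr0 // add1n [RHS]big_nat_recr.
Qed.

Lemma sum_row_count s1 s2 (m n : nat) : s1 <= s2 -> (m <= n)%N ->
  \sum_(1 <= c < m.+1) row_count s1 s2 c
  = \sum_(1 <= d < n.+1) (mu d)%:~R * \sum_(1 <= c < (m %/ d).+1) row_size s1 s2 c.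
Proof.
move=> s12 mn.
transitivity (\sum_(1 <= c < m.+1) \sum_(1 <= d < n.+1)
    if (d %| c)%N then (mu d)%:~R * row_size s1 s2 (c %/ d) else 0).
  apply: eq_big_nat => c /andP[c0 cm]; rewrite row_count_mu //.
  rewrite big_mkcond [RHS](big_cat_nat (n := c.+1)) //=; last by lia.
  rewrite [X in _ + X]big_nat_cond [X in _ + X]big1 ?addr0 // => d /andP[/andP[cd _] _].
  by case: ifP => // /(dvdn_leq c0); lia.
rewrite exchange_big; apply: eq_big_nat => d /andP[d0 _] /=.
rewrite -big_mkcond mulr_sumr.
by rewrite -(sum_dvdn_reindex (fun c => (mu d)%:~R * row_size s1 s2 c)).
Qed.

Lemma sum_row_size_near s1 s2 q : s1 <= s2 ->
  `|\sum_(1 <= c < q.+1) row_size s1 s2 c - (s2 - s1) * (q%:R * (q%:R + 1) / 2)|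
  <= q%:R.
Proof.
move=> s12; elim: q => [|q IH].
  by rewrite big_geq // !mul0r mulr0 subrr normr0.
rewrite big_nat_recr //=.
have h : `|row_size s1 s2 q.+1 - (s2 - s1) * q.+1%:R| <= 1.
  by rewrite mulrBl; apply: size_zint_near; rewrite ler_wpM2r.
set S := \sum_(1 <= c < q.+1) _ in IH *.
have -> : S + row_size s1 s2 q.+1 - (s2 - s1) * (q.+1%:R * (q.+1%:R + 1) / 2)
  = (S - (s2 - s1) * (q%:R * (q%:R + 1) / 2)) + (row_size s1 s2 q.+1 - (s2 - s1) * q.+1%:R).
  by rewrite -[q.+1%:R]natr1; field.
apply: le_trans (ler_normD _ _) _; rewrite -[leRHS]natr1; exact: lerD.
Qed.

(** Division by [d] maps the triangle to a smaller similar one, with [O(X / d)] error in its lattice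
    point count, whence the harmonic sum. The range [n] of the Moebius sum may exceed the size of
    the triangle, so that triangles of different sizes share the same [kappa n]. *)
Lemma triangle_count s1 s2 X n : -1 <= s1 -> s1 <= s2 -> s2 <= 1 -> 0 <= X ->
  (Num.truncn X <= n)%N ->
  `|\sum_(1 <= c < (Num.truncn X).+1) row_count s1 s2 c
    - kappa R n * ((s2 - s1) * X ^+ 2 / 2)|
  <= 2 * X * \sum_(1 <= d < n.+1) (d%:R)^-1.
Proof.
move=> s1m s12 s21 X0 mn; set m := Num.truncn X in mn *.
rewrite (sum_row_count s12 mn) /kappa mulr_suml -sumrB mulr_sumr.
apply: le_trans (ler_norm_sum _ _ _) _; apply: ler_sum_nat => d /andP[d0 _].
have dR : 0 < d%:R :> R by rewrite ltr0n.
set q := (m %/ d)%N; set x := X / d%:R.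
have x0 : 0 <= x by rewrite divr_ge0 // ltW.
have qx : q%:R <= x.
  rewrite ler_pdivlMr // -natrM.
  have mX : m%:R <= X by rewrite truncn_le.
  by apply: le_trans mX; rewrite ler_nat leq_trunc_div.
have xq : x < q%:R + 1.
  rewrite ltr_pdivrMr // natr1 -natrM.
  apply: lt_le_trans (truncnS_gt X) _; rewrite -/m ler_nat.
  by rewrite ltn_ceil.
have -> : (mu d)%:~R * (\sum_(1 <= c < q.+1) row_size s1 s2 c) - (mu d)%:~R / d%:R ^+ 2 * ((s2 - s1) * X ^+ 2 / 2)
   = (mu d)%:~R * (\sum_(1 <= c < q.+1) row_size s1 s2 c - (s2 - s1) * x ^+ 2 / 2).
  by rewrite /x; field; rewrite gt_eqF.
have -> : 2 * X * d%:R^-1 = 1 * (2 * x) by rewrite /x mul1r mulrA.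
rewrite normrM.
apply: ler_pM => //; first exact: norm_muR_le1.
have h := sum_row_size_near q s12.
set S := \sum_(1 <= c < _) _ in h *.
have q0 : 0 <= q%:R :> R by [].
have sq : `|q%:R * (q%:R + 1) - x ^+ 2| <= x.
  rewrite ler_norml; apply/andP; split; nra.
have -> : S - (s2 - s1) * x ^+ 2 / 2 = (S - (s2 - s1) * (q%:R * (q%:R + 1) / 2))
    + (s2 - s1) / 2 * (q%:R * (q%:R + 1) - x ^+ 2) by field.
apply: le_trans (ler_normD _ _) _.
have : `|(s2 - s1) / 2 * (q%:R * (q%:R + 1) - x ^+ 2)| <= 1 * x.
  have d1 : 0 <= (s2 - s1) / 2 by lra.
  have d2 : (s2 - s1) / 2 <= 1 by lra.
  by rewrite normrM (ger0_norm d1); apply: ler_pM.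
move=> ?; lra.
Qed.

End Triangle.

Section WedgeCount.
Variable R : realType.
Implicit Types r s : R.

Lemma wedge_count_rows r s1 s2 : half_octant s1 s2 -> 0 <= r ->
  \sum_(v <- disc r | wedge s1 s2 v) (1 : R)
  = \sum_(1 <= c < (Num.truncn r).+1)
      \sum_(k <- zint (s1 * c%:R) (s2 * c%:R) | enorm (vec R (c%:Z, k)) <= r)
        (coprimez c k)%:R.
Proof.
move=> ho r0; rewrite sum_wedge //; apply: eq_big_nat => c cn.
have [_ s12 _ _] := ho.
have s12c : s1 * c%:R <= s2 * c%:R by rewrite ler_wpM2r.
rewrite -(big_mkord xpredT (fun i => (coprimez c (row_lo r s1 c + i%:Z))%:R * 1)).
have lohi : row_lo r s1 c <= row_hi r s1 s2 c by rewrite le_max lexx.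
transitivity (\sum_(k <- [seq row_lo r s1 c + i%:Z | i <- index_iota 0 (absz (row_hi r s1 s2 c - row_lo r s1 c))]) (coprimez c k)%:R : R).
  by rewrite big_map; apply: eq_bigr => i _; rewrite mulr1.
rewrite -[RHS]big_filter; apply: perm_big; apply: uniq_perm.
- by rewrite map_inj_uniq ?iota_uniq // => i j; lia.
- by rewrite filter_uniq // zint_uniq.
move=> k; rewrite mem_filter mem_zint //.
have -> : (enorm (vec R (c%:Z, k)) <= r) && (s1 * c%:R <= k%:~R < s2 * c%:R)
   = (row_lo r s1 c <= k < row_hi r s1 s2 c).
  rewrite -(wedge_rowP k ho r0) // andbC /wedge /= -!pmulrn ltz_nat.
  by case/andP: cn => ->.
move: (row_lo r s1 c) (row_hi r s1 s2 c) lohi => a b ab.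
apply/mapP/idP => [[ i ]|kab]; first by rewrite mem_index_iota => ? ->; lia.
exists (absz (k - a)); last lia.
by rewrite mem_index_iota; lia.
Qed.

Lemma half_octant_sqr s1 s2 : half_octant s1 s2 ->
  exists m1 m2 : R, [/\ 0 <= m1, m1 <= m2, m2 <= m1 + 2 * (s2 - s1) &
    forall x, s1 <= x <= s2 -> m1 <= x ^+ 2 <= m2].
Proof.
move=> [s1m s12 s21 [s10|s20]].
- exists (s1 ^+ 2), (s2 ^+ 2); split; rewrite ?sqr_ge0 //; [nra|nra|].
  by move=> x /andP[x1 x2]; apply/andP; split; nra.
- exists (s2 ^+ 2), (s1 ^+ 2); split; rewrite ?sqr_ge0 //; [nra|nra|].
  by move=> x /andP[x1 x2]; apply/andP; split; nra.
Qed.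

Lemma atan_increment (a b m1 m2 : R) : a <= b -> 0 <= m1 ->
  (forall x, a <= x <= b -> m1 <= x ^+ 2 <= m2) ->
  (b - a) / (1 + m2) <= atan b - atan a <= (b - a) / (1 + m1).
Proof.
move=> ab m10 m12.
have [|x xab ->] := @MVT_segment R (@atan R) (fun x => (1 + x ^+ 2)^-1) a b ab.
  by apply: continuous_subspaceT => x; exact: continuous_atan.
have /m12/andP[x1 x2] : a <= x <= b by move: xab; rewrite in_itv.
rewrite mulrC [X in _ <= X]mulrC [(1 + x ^+ 2)^-1 * _]mulrC.
rewrite ![(b - a) * _]mulrC.
have ba : 0 <= b - a by rewrite subr_ge0.
apply/andP; split; apply: ler_wpM2r => //; rewrite lef_pV2 ?posrE; lra.
Qed.

(* A thin sector of the disc lies between two triangles with a vertical side. *)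
Lemma thin_wedge_count r s1 s2 : half_octant s1 s2 -> 2 <= r ->
  `|\sum_(v <- disc r | wedge s1 s2 v) 1
    - kappa R (Num.truncn r) / 2 * (atan s2 - atan s1) * r ^+ 2|
  <= 2 * (s2 - s1) ^+ 2 * r ^+ 2 + 2 * r * \sum_(1 <= d < (Num.truncn r).+1) (d%:R)^-1.
Proof.
move=> ho r2; have r0 : 0 <= r by lra.
have [s1m s12 s21 _] := ho.
have [m1 [m2 [m10 m12 m21 msq]]] := half_octant_sqr ho.
have /andP[at1 at2] := atan_increment s12 m10 msq.
set n := Num.truncn r; set h := \sum_(1 <= d < n.+1) _.
have h0 : 0 <= h by apply: sumr_ge0 => j _; rewrite invr_ge0.
have n0 : (0 < n)%N by rewrite /n truncn_gt0; lra.
have /andP[k1 k2] := kappa_bounds R n0.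
(* [X m] is the first coordinate at which a line of squared slope [m] leaves the disc of radius [r];
   [X m2] and [X m1] are the vertical sides of the inner and the outer triangle. *)
pose X m := r / Num.sqrt (1 + m) : R.
have q1 (m : R) : 0 <= m -> 1 <= Num.sqrt (1 + m).
  by move=> m0; rewrite -[leLHS]sqrtr1; apply: ler_wsqrtr; lra.
have X0 m : 0 <= m -> 0 <= X m.
  by move=> m0; rewrite divr_ge0 // sqrtr_ge0.
have Xr m : 0 <= m -> X m <= r.
  move=> m0; have qm := q1 _ m0; rewrite /X ler_pdivrMr ?(lt_le_trans ltr01) //.
  by rewrite ler_peMr.
have Xn m : 0 <= m -> (Num.truncn (X m) <= n)%N.
  by move=> m0; apply: le_truncn; exact: Xr.
have X2 m : 0 <= m -> X m ^+ 2 = r ^+ 2 / (1 + m).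
  by move=> m0; rewrite exprMn exprVn sqr_sqrtr //; lra.
have m20 : 0 <= m2 by exact: le_trans m12.
have row0 c : 0 <= row_count s1 s2 c by apply: sumr_ge0 => k _; rewrite ler0n.
have kc c (k : int) : (0 < c)%N -> k \in zint (s1 * c%:R) (s2 * c%:R) ->
    (c%:R : R) ^+ 2 * (1 + m1) <= c%:R ^+ 2 + k%:~R ^+ 2 <= c%:R ^+ 2 * (1 + m2).
  move=> c0; have cR : 0 < c%:R :> R by rewrite ltr0n.
  rewrite mem_zint ?ler_wpM2r // => /andP[a b].
  have : s1 <= k%:~R / c%:R <= s2 by rewrite ler_pdivlMr // ler_pdivrMr // a ltW.
  move=> /msq; rewrite exprMn exprVn => /andP[].
  rewrite ler_pdivlMr ?exprn_gt0 // ler_pdivrMr ?exprn_gt0 // => e1 e2.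
  by apply/andP; split; rewrite mulrDr mulr1 lerD2l mulrC.
set N := \sum_(v <- disc r | _) _.
have NE : N = \sum_(1 <= c < n.+1) \sum_(k <- zint (s1 * c%:R) (s2 * c%:R) | enorm (vec R (c%:Z, k)) <= r) (coprimez c k)%:R.
  exact: wedge_count_rows.
have lower : \sum_(1 <= c < (Num.truncn (X m2)).+1) row_count s1 s2 c <= N.
  rewrite NE [leRHS](big_cat_nat (n := (Num.truncn (X m2)).+1)) //=; last first.
    by rewrite ltnS Xn.
  rewrite ler_wpDr //.
    by apply: sumr_ge0 => c _; apply: sumr_ge0 => k _; rewrite ler0n.
  apply: ler_sum_nat => c /andP[c0 cX].
  rewrite /row_count big_seq [leRHS]big_seq_cond.
  rewrite le_eqVlt; apply/orP; left; apply/eqP; apply: eq_bigl => k.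
  case: (boolP (k \in _)) => //= kz; apply/esym; rewrite enorm_vec_le //= -pmulrn.
  have /andP[_ e] := kc c k c0 kz; apply: le_trans e _.
  have : c%:R <= X m2.
    have : (Num.truncn (X m2))%:R <= X m2 by rewrite truncn_le X0.
    by apply: le_trans; rewrite ler_nat.
  move=> cX2; rewrite -ler_pdivlMr; last by lra.
  by rewrite -X2 // lerXn2r // ?nnegrE // X0.
have upper : N <= \sum_(1 <= c < (Num.truncn (X m1)).+1) row_count s1 s2 c.
  rewrite NE [leLHS](big_cat_nat (n := (Num.truncn (X m1)).+1)) //=; last first.
    by rewrite ltnS Xn.
  rewrite [X in _ + X]big_nat_cond [X in _ + X]big1 ?addr0.
    apply: ler_sum_nat => c _; rewrite big_mkcond; apply: ler_sum => k _.
    by case: ifP.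
  move=> c /andP[/andP[cX _] _].
  have c0 : (0 < c)%N by exact: leq_trans cX.
  rewrite big_seq_cond big1 // => k /andP[kz]; rewrite enorm_vec_le //= -pmulrn.
  have /andP[e _] := kc c k c0 kz => e2; have := le_trans e e2.
  rewrite -ler_pdivlMr; last by lra.
  rewrite -X2 // ler_pXn2r ?nnegrE ?X0 //.
  have h1 : X m1 < (Num.truncn (X m1)).+1%:R := truncnS_gt _.
  by rewrite leNgt (lt_le_trans h1) // ler_nat.
have T1 := triangle_count s1m s12 s21 (X0 _ m20) (Xn _ m20).
have T2 := triangle_count s1m s12 s21 (X0 _ m10) (Xn _ m10).
rewrite -/h X2 // in T1; rewrite -/h X2 // in T2.
set K := kappa R n in k1 k2 T1 T2 *.
have U1 : 2 * X m2 * h <= 2 * r * h by rewrite ler_wpM2r // ler_wpM2l // Xr.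
have U2 : 2 * X m1 * h <= 2 * r * h by rewrite ler_wpM2r // ler_wpM2l // Xr.
move: T1 T2; rewrite !ler_norml => /andP[T1 _] /andP[_ T2].
set D := s2 - s1 in T1 T2 at1 at2 m21 *; set A := atan s2 - atan s1 in at1 at2 *.
have D0 : 0 <= D by rewrite subr_ge0.
have i2 : 0 < (1 + m2)^-1 by rewrite invr_gt0; lra.
have i12 : (1 + m1)^-1 - (1 + m2)^-1 <= 2 * D.
  have -> : (1 + m1)^-1 - (1 + m2)^-1 = (m2 - m1) / ((1 + m1) * (1 + m2)).
    by field; rewrite !gt_eqF //; lra.
  rewrite ler_pdivrMr ?mulr_gt0 //; try lra.
  apply: (@le_trans _ _ (2 * D * 1)); first by lra.
  apply: ler_wpM2l; nra.
have rr : 0 <= r ^+ 2 by rewrite sqr_ge0.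
have e1 : K * (D * (r ^+ 2 / (1 + m2)) / 2) = K / 2 * (D / (1 + m2)) * r ^+ 2 by ring.
have e2 : K * (D * (r ^+ 2 / (1 + m1)) / 2) = K / 2 * (D / (1 + m1)) * r ^+ 2 by ring.
rewrite e1 in T1; rewrite e2 in T2.
have gap : K / 2 * (D / (1 + m1)) * r ^+ 2 - K / 2 * (D / (1 + m2)) * r ^+ 2 <= 2 * D ^+ 2 * r ^+ 2.
  have -> : K / 2 * (D / (1 + m1)) * r ^+ 2 - K / 2 * (D / (1 + m2)) * r ^+ 2
     = K / 2 * (D * ((1 + m1)^-1 - (1 + m2)^-1)) * r ^+ 2 by ring.
  apply: ler_wpM2r => //.
  apply: (@le_trans _ _ (1 * (D * (2 * D)))); last by rewrite le_eqVlt; apply/orP; left; apply/eqP; ring.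
  apply: ler_pM; rewrite ?mulr_ge0 //; try lra.
    by rewrite subr_ge0 lef_pV2 ?posrE; lra.
  exact: ler_wpM2l.
have K20 : 0 <= K / 2 by lra.
have A1 : K / 2 * (D / (1 + m2)) * r ^+ 2 <= K / 2 * A * r ^+ 2.
  by rewrite ler_wpM2r // ler_wpM2l.
have A2 : K / 2 * A * r ^+ 2 <= K / 2 * (D / (1 + m1)) * r ^+ 2.
  by rewrite ler_wpM2r // ler_wpM2l.
apply/andP; split; lra.
Qed.

Lemma wedge_cat (F : int * int -> R) r s1 s s2 : s1 <= s -> s <= s2 ->
  \sum_(v <- disc r | wedge s1 s2 v) F v
  = \sum_(v <- disc r | wedge s1 s v) F v + \sum_(v <- disc r | wedge s s2 v) F v.
Proof.
move=> s1s ss2; rewrite (bigID (wedge s1 s)) /=; congr (_ + _); apply: eq_bigl => -[a b];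
  rewrite /wedge /=; case: (ltP 0 a) => //= a0.
- have aR : 0 < a%:~R :> R by rewrite ltr0z.
  apply/idP/idP => [/andP[]//|/andP[x y]]; rewrite x y /= andbT.
  by apply: lt_le_trans y _; rewrite ler_pM2r.
- have aR : 0 < a%:~R :> R by rewrite ltr0z.
  apply/idP/idP => [/andP[/andP[x ->]]|/andP[x y]].
    by rewrite x /= -leNgt => ->.
  rewrite y [b%:~R < _]ltNge x andbF andbT /= andbT.
  by apply: le_trans x; rewrite ler_pM2r.
Qed.

(** Cutting into [M] thin wedges gives a total error of order [r^2 / M] from the curved side and
    [M r log r] from the triangles. With [M] about [sqrt r] both are [O(r^(3/2) log r)], well below
    [errf r]. *)
Lemma wedge_count r s1 s2 : half_octant s1 s2 -> 2 <= r ->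
  `|\sum_(v <- disc r | wedge s1 s2 v) 1
    - kappa R (Num.truncn r) / 2 * (atan s2 - atan s1) * r ^+ 2| <= 20 * errf r.
Proof.
move=> ho r2; have [s1m s12 s21 half] := ho.
have r0 : 0 <= r by lra.
have n0 : (0 < Num.truncn r)%N by rewrite truncn_gt0; lra.
set K := kappa R _ / 2; set h := \sum_(1 <= d < (Num.truncn r).+1) (d%:R : R)^-1.
pose M := (Num.truncn (Num.sqrt r)).+1.
have M0 : 0 < M%:R :> R by rewrite ltr0n.
pose d := (s2 - s1) / M%:R.
have d0 : 0 <= d by rewrite divr_ge0 // ?subr_ge0 // ltW.
have dM : d * M%:R = s2 - s1 by rewrite divfK ?gt_eqF.
have main j : (j <= M)%N ->
  `|\sum_(v <- disc r | wedge s1 (s1 + d * j%:R) v) 1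
    - K * (atan (s1 + d * j%:R) - atan s1) * r ^+ 2|
  <= j%:R * (2 * d ^+ 2 * r ^+ 2 + 2 * r * h).
  elim: j => [|j IH] jM.
    rewrite mulr0 addr0 subrr mulr0 !mul0r subr0.
    rewrite big_pred0 ?normr0 // => -[a b]; rewrite /wedge /=.
    by case: (ltP 0 a) => //= _; rewrite ltNge andbN.
  have jM' : j%:R + 1 <= M%:R :> R by rewrite natr1 ler_nat.
  have dj : d * (j%:R + 1) <= s2 - s1 by rewrite -dM ler_wpM2l.
  have dj0 : 0 <= d * j%:R by rewrite mulr_ge0.
  have dj1 : d * (j%:R + 1) = d * j%:R + d by rewrite mulrDr mulr1.
  rewrite -natr1.
  rewrite (@wedge_cat _ r s1 (s1 + d * j%:R)); [|lra|lra].
  have ho' : half_octant (s1 + d * j%:R) (s1 + d * (j%:R + 1)).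
    split; [lra|lra|lra|]; case: half => half; [left|right]; lra.
  have t := thin_wedge_count ho' r2.
  have e : s1 + d * (j%:R + 1) - (s1 + d * j%:R) = d by rewrite dj1; ring.
  rewrite e -/h -/K in t.
  have := IH (ltnW jM); move: t.
  set S1 := \sum_(v <- _ | _) _; set S2 := \sum_(v <- _ | _) _.
  set a0 := atan s1; set a1 := atan (s1 + d * j%:R); set a2 := atan _ => t1 t2.
  have -> : S2 + S1 - K * (a2 - a0) * r ^+ 2
    = (S2 - K * (a1 - a0) * r ^+ 2) + (S1 - K * (a2 - a1) * r ^+ 2) by ring.
  apply: le_trans (ler_normD _ _) _; rewrite mulrDl mul1r; exact: lerD.
have e12 : s1 + (s2 - s1) = s2 by ring.
have := main M (leqnn _); rewrite dM e12 => /le_trans; apply.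
have L := ln_ge_half r2.
have hL : h <= 3 * ln r.
  have := harmonic_le_ln R n0.
  have nr : (Num.truncn r)%:R <= r by rewrite truncn_le.
  have : ln (Num.truncn r)%:R <= ln r by rewrite ler_ln ?posrE ?ltr0n //; lra.
  rewrite -/h; lra.
have h0 : 0 <= h by apply: sumr_ge0 => j _; rewrite invr_ge0.
set q := Num.sqrt r.
have q1 : 1 <= q by rewrite -[leLHS]sqrtr1; apply: ler_wsqrtr; lra.
have q2 : q ^+ 2 = r by rewrite sqr_sqrtr.
have qM : q <= M%:R by rewrite ltW // truncnS_gt.
have Mq : M%:R <= q + 1.
  by rewrite -natr1 lerD2r truncn_le sqrtr_ge0.
have p1 : q <= rt4 r ^+ 3.
  rewrite /q -rt4_sqr; apply: ler_weXn2l => //.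
  by rewrite -(@rt4_1 R); apply: ler_rt4; lra.
have Md : M%:R * d ^+ 2 <= q^-1.
  rewrite /d exprMn exprVn.
  have -> : M%:R * ((s2 - s1) ^+ 2 / M%:R ^+ 2) = (s2 - s1) ^+ 2 / M%:R by field; rewrite gt_eqF.
  apply: (@le_trans _ _ (1 / M%:R)).
    rewrite ler_wpM2r ?invr_ge0 //.
    have : 0 <= s2 - s1 <= 1 by case: half => half; apply/andP; split; lra.
    by move=> /andP[? ?]; rewrite expr_le1.
  rewrite div1r lef_pV2 ?posrE //; lra.
have qr : q^-1 * r ^+ 2 = r * q.
  by rewrite -q2; field; rewrite gt_eqF //; lra.
have part1 : M%:R * (2 * d ^+ 2 * r ^+ 2) <= 2 * (r * q).
  have -> : M%:R * (2 * d ^+ 2 * r ^+ 2) = 2 * (M%:R * d ^+ 2 * r ^+ 2) by ring.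
  by rewrite -qr ler_wpM2l // ler_wpM2r // sqr_ge0.
have part2 : M%:R * (2 * r * h) <= 12 * (r * q * ln r).
  have -> : 12 * (r * q * ln r) = (2 * q) * (2 * r * (3 * ln r)) by ring.
  apply: ler_pM; rewrite ?mulr_ge0 //; first by lra.
  by apply: ler_wpM2l => //; lra.
have rq0 : 0 <= r * q by rewrite mulr_ge0 //; lra.
have part3 : r * q <= 2 * (r * q * ln r) by nra.
have part4 : r * q * ln r <= errf r.
  rewrite /errf ler_wpM2r //; first by lra.
  by rewrite ler_wpM2l.
rewrite mulrDr; have : 0 <= r * q * ln r by rewrite mulr_ge0 //; lra.
lra.
Qed.

End WedgeCount.

(** * From half octants to arbitrary arcs of directions *)

Section Arcs.
Variable R : realType.
Implicit Types (r s t : R).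

(** The angle [tau] is not normalised: an arc may pass the angle [2 pi], and a quarter turn is a
    plain shift of [s1] and [s2]. *)
Definition in_arc s1 s2 (v : int * int) : bool :=
  `[< exists tau : R, s1 <= tau < s2 /\ vec R v = enorm (vec R v) *: cis tau >].

Lemma polarP (u : R * R) (tau : R) :
  u = enorm u *: cis tau <-> u.1 = enorm u * cos tau /\ u.2 = enorm u * sin tau.
Proof.
split=> [e|[e1 e2]]; first by split; rewrite [in LHS]e.
by rewrite [LHS]surjective_pairing e1 e2.
Qed.

Lemma cos_eq1_small (d : R) : 0 <= d < 2 * pi -> cos d = 1 -> d = 0.
Proof.
move=> /andP[d0 d2] cd; apply/eqP; rewrite eq_le d0 andbT leNgt; apply/negP => dpos.
have : 0 < sin (d / 2).
  apply: sin_gt0_pi; move: d2 dpos; move: (pi : R) => p *; apply/andP; split; lra.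
have : cos (d / 2 *+ 2) = 1 by rewrite -[_ *+ 2]mulr_natr divfK // pnatr_eq0.
rewrite cos_mulr2n cos2sin2 => e sp.
have : sin (d / 2) ^+ 2 = 0 by move: e; rewrite mulr2n; move: (sin _) => x; lra.
by move/eqP; rewrite sqrf_eq0 => /eqP e0; move: sp; rewrite e0 ltxx.
Qed.

Lemma enorm_vec_gt0 v : primitive v -> 0 < enorm (vec R v).
Proof. by move=> pv; rewrite sqrtr_gt0; exact: primitive_neq0. Qed.

Lemma polar_inj (u : R * R) (a b : R) : 0 < enorm u -> a <= b < a + 2 * pi ->
  u = enorm u *: cis a -> u = enorm u *: cis b -> a = b.
Proof.
move=> u0 /andP[ab ba] /polarP[a1 a2] /polarP[b1 b2].
have c : cos a = cos b by apply: (mulfI (lt0r_neq0 u0)); rewrite -a1 -b1.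
have s : sin a = sin b by apply: (mulfI (lt0r_neq0 u0)); rewrite -a2 -b2.
apply/eqP; rewrite eq_sym -subr_eq0; apply/eqP; apply: cos_eq1_small.
  by rewrite subr_ge0 ab /= ltrBlDl.
by rewrite cosB c s -!expr2 cos2Dsin2.
Qed.

Lemma piquarter_lt (s : R) : - (pi / 4) <= s <= pi / 4 -> - (pi / 2) < s < pi / 2.
Proof.
have := @pi_gt0 R; move: (pi : R) => p p0 /andP[a b]; apply/andP; split; lra.
Qed.

Lemma cos_gt0_piquarter (s : R) : - (pi / 4) <= s <= pi / 4 -> 0 < cos s.
Proof. by move=> /piquarter_lt; exact: cos_gt0_pihalf. Qed.

Lemma in_itv_tan (s : R) : - (pi / 4) <= s <= pi / 4 -> s \in `](- (pi / 2)), (pi / 2)[.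
Proof. by move=> /piquarter_lt; rewrite in_itv. Qed.

Lemma in_arc_wedge s1 s2 v : primitive v ->
  - (pi / 4) <= s1 -> s1 <= s2 -> s2 <= pi / 4 ->
  in_arc s1 s2 v = wedge (tan s1) (tan s2) v.
Proof.
move=> pv s1m s12 s2m; have u0 := enorm_vec_gt0 pv.
have i1 : s1 \in `](- (pi / 2)), (pi / 2)[ by apply: in_itv_tan; rewrite s1m (le_trans s12).
have i2 : s2 \in `](- (pi / 2)), (pi / 2)[ by apply: in_itv_tan; rewrite s2m (le_trans s1m).
apply/asboolP/idP.
  move=> [tau [/andP[t1 t2] /polarP[/= e1 e2]]].
  have tm : - (pi / 4) <= tau <= pi / 4 by rewrite (le_trans s1m) //= ltW // (lt_le_trans t2).
  have ct := cos_gt0_piquarter tm; have it := in_itv_tan tm.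
  have v1 : 0 < v.1%:~R :> R by rewrite e1 mulr_gt0.
  have tE : v.2%:~R = tan tau * v.1%:~R :> R.
    by rewrite e1 e2 /tan; field; rewrite gt_eqF.
  rewrite /wedge -(ltr0z R) v1 tE /= ler_pM2r // ltr_pM2r //.
  by rewrite leNgt !ltr_tan // -leNgt t1 t2.
move=> /andP[v1 /andP[l1 l2]]; rewrite -(ltr0z R) in v1.
set x := v.2%:~R / v.1%:~R : R.
have xE : v.2%:~R = x * v.1%:~R by rewrite divfK // gt_eqF.
move: l1 l2; rewrite xE ler_pM2r // ltr_pM2r // => l1 l2.
exists (atan x); split.
  by rewrite -(tanK i1) -(tanK i2) le_atan // lt_atan.
have q0 : 0 < Num.sqrt (1 + x ^+ 2) by rewrite sqrtr_gt0 ltr_wpDr // sqr_ge0.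
have nE : enorm (vec R v) = v.1%:~R * Num.sqrt (1 + x ^+ 2).
  rewrite -[RHS]ger0_norm ?mulr_ge0 ?(ltW v1) ?(ltW q0) // -sqrtr_sqr exprMn sqr_sqrtr.
    by rewrite /enorm /= xE; congr Num.sqrt; ring.
  by rewrite addr_ge0 // sqr_ge0.
have cE : cos (atan x) = (Num.sqrt (1 + x ^+ 2))^-1 by rewrite cos_atan.
have sE : sin (atan x) = x * cos (atan x).
  by rewrite -{2}(atanK x) /tan divfK // cE invr_eq0 gt_eqF.
apply/polarP; split; rewrite /= nE ?sE cE.
  by rewrite -mulrA mulfV ?mulr1 // gt_eqF.
by rewrite xE; field; rewrite gt_eqF.
Qed.

(** The choice [w] of shortest solutions is quantified inside, because a quarter turn replaces it by
    a conjugate choice. *)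
Definition arc_estimate (C s1 s2 : R) : Prop :=
  forall w, (forall v, primitive v -> shortest_solution R v (w v)) ->
  forall r s t (I : R -> bool), 2 <= r -> - (1 / 2) <= s -> s <= t -> t <= 1 / 2 ->
  (forall x, s < x < t -> I x) -> (forall x, I x -> s <= x <= t) ->
  `|\sum_(v <- disc r | in_arc s1 s2 v) (I (lam R v (w v)))%:R
    - kappa R (Num.truncn r) / 2 * (s2 - s1) * (t - s) * r ^+ 2| <= C * errf r.

Lemma half_octant_tan s1 s2 : - (pi / 4) <= s1 -> s1 <= s2 -> s2 <= pi / 4 ->
  0 <= s1 \/ s2 <= 0 -> half_octant (tan s1) (tan s2).
Proof.
move=> s1m s12 s2m half.
have i1 : s1 \in `](- (pi / 2)), (pi / 2)[ by apply: in_itv_tan; rewrite s1m (le_trans s12).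
have i2 : s2 \in `](- (pi / 2)), (pi / 2)[ by apply: in_itv_tan; rewrite s2m (le_trans s1m).
have pi0 := @pi_gt0 R.
have i0 : (0 : R) \in `](- (pi / 2)), (pi / 2)[.
  by rewrite in_itv /=; move: pi0; move: (pi : R) => p p0; apply/andP; split; lra.
have q0 : - (pi / 4) <= (pi : R) / 4 <= pi / 4.
  by move: pi0; move: (pi : R) => p p0; apply/andP; split; lra.
have q1 : - (pi / 4) <= - ((pi : R) / 4) <= pi / 4.
  by move: pi0; move: (pi : R) => p p0; apply/andP; split; lra.
have mono x y : x \in `](- (pi / 2)), (pi / 2)[ -> y \in `](- (pi / 2)), (pi / 2)[ ->
    x <= y -> tan x <= tan y :> R.
  by move=> ix iy xy; rewrite leNgt ltr_tan // -leNgt.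
split.
- by rewrite -(@tan_piquarter R) -tanN; apply: mono => //; exact: in_itv_tan.
- exact: mono.
- by rewrite -(@tan_piquarter R); apply: mono => //; exact: in_itv_tan.
- by case: half => h; [left|right]; rewrite -(@tan0 R); apply: mono.
Qed.

(** Here [1020 = 1000 + 20]: the distribution of [lam] inside the wedge, and the size of the wedge,
    whose error is multiplied by [t - s <= 1]. *)
Lemma arc_estimate_base s1 s2 : - (pi / 4) <= s1 -> s1 <= s2 -> s2 <= pi / 4 ->
  0 <= s1 \/ s2 <= 0 -> arc_estimate 1020 s1 s2.
Proof.
move=> s1m s12 s2m half w sw r s t I r2 s0 st t1 I1 I2.
have ho := half_octant_tan s1m s12 s2m half.
have i1 : s1 \in `](- (pi / 2)), (pi / 2)[ by apply: in_itv_tan; rewrite s1m (le_trans s12).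
have i2 : s2 \in `](- (pi / 2)), (pi / 2)[ by apply: in_itv_tan; rewrite s2m (le_trans s1m).
have h1 := wedge_lam_discrepancy sw ho r2 s0 st t1 I1 I2.
have h2 := wedge_count ho r2; rewrite !tanK // in h2.
have r0 : 0 <= r by lra.
have E0 : 0 <= errf r by apply: errf_ge0; lra.
have -> : \sum_(v <- disc r | in_arc s1 s2 v) (I (lam R v (w v)))%:R
    = \sum_(v <- disc r | wedge (tan s1) (tan s2) v) (I (lam R v (w v)))%:R :> R.
  rewrite big_seq_cond [RHS]big_seq_cond; apply: eq_bigl => v.
  case: (boolP (v \in disc r)) => //=; rewrite mem_disc // => /andP[pv _].
  exact: in_arc_wedge.
set S := \sum_(v <- _ | _) (I _)%:R in h1 *; set T := \sum_(v <- _ | _) 1 in h1 h2 *.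
set K := kappa R _ / 2 in h2 *.
have -> : S - K * (s2 - s1) * (t - s) * r ^+ 2
   = (S - (t - s) * T) + (t - s) * (T - K * (s2 - s1) * r ^+ 2) by ring.
apply: le_trans (ler_normD _ _) _.
have h3 : `|(t - s) * (T - K * (s2 - s1) * r ^+ 2)| <= 1 * (20 * errf r).
  have ts0 : 0 <= t - s by lra.
  by rewrite normrM (ger0_norm ts0); apply: ler_pM => //; lra.
lra.
Qed.

Definition quarter (v : int * int) : int * int := (- v.2, v.1).
Definition unquarter (v : int * int) : int * int := (v.2, - v.1).

Lemma quarterK : cancel quarter unquarter.
Proof. by case=> a b; rewrite /unquarter /= opprK. Qed.

Lemma unquarterK : cancel unquarter quarter.
Proof. by case=> a b; rewrite /quarter /= opprK. Qed.

Lemma enorm_quarter v : enorm (vec R (quarter v)) = enorm (vec R v).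
Proof. by rewrite /enorm /= rmorphN /= sqrrN addrC. Qed.

Lemma primitive_quarter v : primitive (quarter v) = primitive v.
Proof. by rewrite /primitive /= coprimeNz coprimez_sym. Qed.

Lemma perm_disc_quarter r : 0 <= r -> perm_eq (map quarter (disc r)) (disc r).
Proof.
move=> r0; apply: uniq_perm; rewrite ?disc_uniq ?(map_inj_uniq (can_inj quarterK)) ?disc_uniq //.
move=> v; rewrite -{1}(unquarterK v) (mem_map (can_inj quarterK)) !mem_disc //.
by rewrite -primitive_quarter -enorm_quarter unquarterK.
Qed.

Lemma in_arc_quarter s1 s2 v :
  in_arc (s1 + pi / 2) (s2 + pi / 2) (quarter v) = in_arc s1 s2 v.
Proof.
apply/asboolP/asboolP => -[tau [/andP[t1 t2] /polarP[e1 e2]]].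
  exists (tau - pi / 2); rewrite lerBrDr t1 ltrBlDr t2; split => //.
  apply/polarP; rewrite -enorm_quarter cosBpihalf sinBpihalf.
  move: e1 e2; rewrite /= rmorphN /= => e1 e2; split; first by rewrite e2.
  by rewrite mulrN -e1 opprK.
exists (tau + pi / 2); rewrite lerD2r t1 ltrD2r t2; split => //.
apply/polarP; rewrite enorm_quarter cosDpihalf sinDpihalf.
by move: e1 e2; rewrite /= rmorphN /= => -> ->; rewrite mulrN.
Qed.

Lemma gcd_solution_quarter v w : gcd_solution (quarter v) (quarter w) <-> gcd_solution v w.
Proof.
case: v w => a b [x y]; rewrite /gcd_solution /=.
by have -> : a * - y - - b * x = b * x - a * y by ring.
Qed.

(** The quarter turn is an isometry of the lattice preserving orientation, hence the gcd equation,
    shortest solutions and [lam]. The hypothesis is applied to [w] conjugated by it. *)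
Lemma arc_estimate_quarter C s1 s2 :
  arc_estimate C s1 s2 -> arc_estimate C (s1 + pi / 2) (s2 + pi / 2).
Proof.
move=> est w sw r s t I r2 s0 st t1 I1 I2; have r0 : 0 <= r by lra.
pose w' v := unquarter (w (quarter v)).
have sw' v : primitive v -> shortest_solution R v (w' v).
  rewrite -primitive_quarter => /sw[g short]; split.
    by apply/gcd_solution_quarter; rewrite unquarterK.
  move=> z /gcd_solution_quarter /short.
  by rewrite enorm_quarter -[in X in X -> _](unquarterK (w _)) enorm_quarter.
have h := est w' sw' r s t I r2 s0 st t1 I1 I2.
have -> : s2 + pi / 2 - (s1 + pi / 2) = s2 - s1 by move: (pi / 2 : R) => p; ring.
rewrite -(perm_big _ (perm_disc_quarter r0)) big_map /=.
suff <- : \sum_(v <- disc r | in_arc s1 s2 v) (I (lam R v (w' v)))%:R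
  = \sum_(v <- disc r | in_arc (s1 + pi / 2) (s2 + pi / 2) (quarter v))
      (I (lam R (quarter v) (w (quarter v))))%:R :> R by [].
apply: eq_big => v; first by rewrite in_arc_quarter.
move=> _; congr (nat_of_bool (I _))%:R; rewrite /w' /lam; case: (w _) => x y /=.
by rewrite !rmorphN /= sqrrN mulrN [X in _ = _ / X]addrC; congr (_ / _); ring.
Qed.

(** A quarter turn lowers [j] by two. Octant 0 is a base case, and octant 1 turns into the one just
    below angle 0, which is the other. *)
Lemma arc_estimate_octant (j : nat) s1 s2 : j%:R * (pi / 4) <= s1 -> s1 <= s2 ->
  s2 <= (j%:R + 1) * (pi / 4) -> arc_estimate 1020 s1 s2.
Proof.
have pi0 := @pi_gt0 R.
have -> : (pi / 4 : R) = pi / 2 / 2 by move: (pi : R) => p; field.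
have quarterE a : a = a - pi / 2 + pi / 2 :> R by rewrite subrK.
have pE : (pi / 2 / 2 : R) = pi / 4 by move: (pi : R) => p; field.
move: j s1 s2; apply: ltn_ind => -[|[|j]] IH s1 s2 a b c.
- by apply: arc_estimate_base => //; move: a c; rewrite pE; move: pi0; move: (pi : R) => p *; [lra|lra|left; lra].
- rewrite (quarterE s1) (quarterE s2); apply: arc_estimate_quarter.
  by apply: arc_estimate_base; move: a c; move: pi0; move: (pi : R) => p *; [lra|lra|lra|right; lra].
- rewrite (quarterE s1) (quarterE s2); apply: arc_estimate_quarter.
  apply: (IH j); rewrite ?ltnS ?leqnSn ?leqW //; move: a c; rewrite -2!natr1;
  move: (pi / 2 : R) (j%:R : R) => p x *; lra.
Qed.

Lemma in_arc_cat (F : int * int -> R) r s1 s s2 : 0 <= r -> s1 <= s -> s <= s2 -> s2 <= s1 + 2 * pi ->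
  \sum_(v <- disc r | in_arc s1 s2 v) F v
  = \sum_(v <- disc r | in_arc s1 s v) F v + \sum_(v <- disc r | in_arc s s2 v) F v.
Proof.
move=> r0 s1s ss2 s21; rewrite (bigID (in_arc s1 s)) /=; congr (_ + _).
  apply: eq_bigl => v; apply/andP/idP => [[]//|h]; split=> //.
  move/asboolP: h => [tau [/andP[a b] e]]; apply/asboolP; exists tau.
  by rewrite a (lt_le_trans b).
rewrite big_seq_cond [RHS]big_seq_cond; apply: eq_bigl => v.
case: (boolP (v \in disc r)) => //=; rewrite mem_disc // => /andP[pv _].
apply/andP/idP.
  move=> [/asboolP[tau [/andP[a b] e]] /asboolP nA]; apply/asboolP; exists tau.
  rewrite b andbT; split=> //; rewrite leNgt; apply/negP => ts; apply: nA.
  by exists tau; rewrite a ts.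
move=> /asboolP[tau [/andP[a b] e]]; split; apply/asboolP.
  by exists tau; rewrite (le_trans s1s a) b.
move=> [tau' [/andP[a' b'] e']].
have := polar_inj (enorm_vec_gt0 pv) _ e' e => h.
have tt : tau' = tau.
  apply: h; rewrite (le_trans (ltW b') a) /=.
  by apply: lt_le_trans b _; apply: le_trans s21 _; rewrite lerD2r.
by move: b'; rewrite tt ltNge a.
Qed.

Lemma arc_estimate_cat C C' s1 s s2 : s1 <= s -> s <= s2 -> s2 <= s1 + 2 * pi ->
  arc_estimate C s1 s -> arc_estimate C' s s2 -> arc_estimate (C + C') s1 s2.
Proof.
move=> s1s ss2 s21 e1 e2 w sw r a b I r2 a0 ab b1 I1 I2.
rewrite (in_arc_cat _ _ s1s ss2 s21); last by lra.
have h1 := e1 w sw r a b I r2 a0 ab b1 I1 I2.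
have h2 := e2 w sw r a b I r2 a0 ab b1 I1 I2.
set S1 := \sum_(v <- _ | _) _ in h1 *; set S2 := \sum_(v <- _ | _) _ in h2 *.
set K := kappa R _ / 2 in h1 h2 *.
have -> : S1 + S2 - K * (s2 - s1) * (b - a) * r ^+ 2
   = (S1 - K * (s - s1) * (b - a) * r ^+ 2) + (S2 - K * (s2 - s) * (b - a) * r ^+ 2) by ring.
by rewrite mulrDl; apply: le_trans (ler_normD _ _) _; exact: lerD.
Qed.

Lemma arc_estimate_le C C' s1 s2 : C <= C' -> arc_estimate C s1 s2 -> arc_estimate C' s1 s2.
Proof.
move=> CC e w sw r a b I r2 a0 ab b1 I1 I2.
apply: le_trans (e w sw r a b I r2 a0 ab b1 I1 I2) _.
by rewrite ler_wpM2r // errf_ge0 //; lra.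
Qed.

Lemma arc_estimate_octants (m j : nat) s1 s2 : j%:R * (pi / 4) <= s1 -> s1 <= s2 ->
  s2 <= (j%:R + m%:R + 1) * (pi / 4) -> s2 <= s1 + 2 * pi ->
  arc_estimate (1020 * (m%:R + 1)) s1 s2.
Proof.
have pi0 : 0 < pi / 4 :> R by rewrite divr_gt0 // pi_gt0.
elim: m j s1 s2 => [|m IH] j s1 s2 a b c d.
  by rewrite add0r mulr1; apply: (@arc_estimate_octant j) => //; rewrite addr0 in c.
pose x : R := (j%:R + 1) * (pi / 4).
have e1 : j.+1%:R * (pi / 4) = x by rewrite -natr1.
have c' : s2 <= (j.+1%:R + m%:R + 1) * (pi / 4).
  by apply: le_trans c _; rewrite ler_pM2r // -2!natr1; lra.
case: (leP s2 x) => [s2x|xs2].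
  apply: (@arc_estimate_le 1020); last exact: (@arc_estimate_octant j).
  by move: (ler0n R m.+1); move: (m.+1%:R : R) => y y0; lra.
case: (leP x s1) => [xs1|s1x].
  apply: (@arc_estimate_le (1020 * (m%:R + 1))); last by apply: (IH j.+1); rewrite ?e1.
  by rewrite -[m.+1%:R]natr1; move: (m%:R : R) => y; lra.
have -> : 1020 * (m.+1%:R + 1) = 1020 + 1020 * (m%:R + 1) :> R by rewrite -[m.+1%:R]natr1; move: (m%:R : R) => y; ring.
apply: (@arc_estimate_cat _ _ _ x) => //; try exact: ltW.
  by apply: (@arc_estimate_octant j) => //; exact: ltW.
apply: (IH j.+1); rewrite ?e1 ?(ltW xs2) //.
by apply: le_trans d _; rewrite lerD2r ltW.
Qed.

(** Such an arc lies in [[0, 4 pi]], which consists of sixteen octants, and [1020 * 16 <= 20000]. *)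
Lemma arc_estimate_all s1 s2 : 0 <= s1 -> s1 <= 2 * pi -> s1 <= s2 ->
  s2 <= s1 + 2 * pi -> arc_estimate 20000 s1 s2.
Proof.
move=> a b c d; apply: (@arc_estimate_le (1020 * (15%:R + 1))); first by lra.
apply: (@arc_estimate_octants 15 0) => //; first by rewrite mul0r.
by move: b d; move: (pi : R) => p *; lra.
Qed.

End Arcs.

(** * Arcs and arc length *)

Section CircleAngle.
Variable R : realType.
Implicit Types (u : R * R) (a l x th : R).

Lemma enorm_cis th : enorm (cis th) = 1.
Proof. by rewrite /enorm /= cos2Dsin2 sqrtr1. Qed.

Lemma cosDn2pi th : cos (th + 2 * pi) = cos th.
Proof. by rewrite mulr_natl cosD2pi. Qed.

Lemma sinDn2pi th : sin (th + 2 * pi) = sin th.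
Proof. by rewrite mulr_natl sinD2pi. Qed.

Lemma cisD2pi th : cis (th + 2 * pi) = cis th.
Proof. by rewrite /cis cosDn2pi sinDn2pi. Qed.

(* Half-angle formula, in a form that is visibly a Borel function of [u]. *)
Definition angle u : R :=
  if u.1 == -1 then pi else 2 * atan (u.2 * (1 + u.1) `^ (-1)).

Definition angle_pos u : R := if angle u < 0 then angle u + 2 * pi else angle u.

(* For [u] on the circle and [0 <= a < 2 pi], the anticlockwise angle from
   [cis a] to [u]. *)
Definition arc_param a u : R :=
  if angle_pos u < a then angle_pos u + 2 * pi - a else angle_pos u - a.

Lemma circle_sqr u : enorm u = 1 -> u.1 ^+ 2 + u.2 ^+ 2 = 1.
Proof. by move=> e; rewrite -enorm_sqr e expr1n. Qed.

Lemma angle_range u : - pi < angle u <= pi.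
Proof.
have pi0 := @pi_gt0 R.
rewrite /angle; case: ifP => _; first by rewrite lexx andbT (lt_trans _ pi0) // oppr_lt0.
set y := u.2 * _; have := @atan_gtNpi2 R y; have := @atan_ltpi2 R y.
by move: (atan y) pi0; move: (pi : R) => p q p0 *; apply/andP; split; lra.
Qed.

Lemma cis_angle u : enorm u = 1 -> cis (angle u) = u.
Proof.
move=> /circle_sqr; case: u => x y /= e; rewrite /angle /=.
have x1 : -1 <= x by nra.
case: eqP => [xm|/eqP xm].
  have y0 : y = 0 by apply/eqP; rewrite -sqrf_eq0; apply/eqP; move: e; rewrite xm; lra.
  by rewrite /cis cospi sinpi xm y0.
have x0 : 0 < 1 + x by rewrite addrC -ltrBlDr sub0r lt_neqAle eq_sym xm.
rewrite powR_inv1 ?(ltW x0) //; set z := y / (1 + x).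
have z2 : 1 + z ^+ 2 = 2 / (1 + x).
  rewrite /z exprMn exprVn (_ : y ^+ 2 = 1 - x ^+ 2); last by rewrite -e; ring.
  by field; rewrite gt_eqF.
have cz : cos (atan z) ^+ 2 = (1 + x) / 2.
  rewrite cos_atan exprVn sqr_sqrtr ?z2 ?divr_ge0 ?(ltW x0) //.
  by rewrite invf_div.
have c0 : cos (atan z) != 0.
  by rewrite -sqrf_eq0 cz mulf_neq0 ?gt_eqF.
have sz : sin (atan z) = z * cos (atan z).
  by rewrite -{2}(atanK z) /tan divfK.
rewrite /cis mulr_natl cos_mulr2n sin_mulr2n; congr pair.
  by rewrite cz; field.
rewrite sz mulrCA -expr2 cz /z; by field; rewrite gt_eqF.
Qed.

Lemma angle_pos_range u : 0 <= angle_pos u < 2 * pi.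
Proof.
have := angle_range u; rewrite /angle_pos; have := @pi_gt0 R; move: (pi : R) (angle u) => p q p0.
by case: (ltP q 0) => q0 /andP[a b]; apply/andP; split; lra.
Qed.

Lemma cis_angle_pos u : enorm u = 1 -> cis (angle_pos u) = u.
Proof.
by move=> u1; rewrite /angle_pos; case: ifP => _; rewrite ?cisD2pi cis_angle.
Qed.

Lemma arc_param_range a u : 0 <= a < 2 * pi -> 0 <= arc_param a u < 2 * pi.
Proof.
have := angle_pos_range u; rewrite /arc_param; have := @pi_gt0 R.
move: (pi : R) (angle_pos u) => p q p0 /andP[c d] /andP[a0 a1].
by case: (ltP q a) => qa; apply/andP; split; lra.
Qed.

Lemma cis_arc_param a u : enorm u = 1 -> cis (a + arc_param a u) = u.
Proof.
move=> u1; rewrite /arc_param; case: ifP => _; last by rewrite addrC subrK cis_angle_pos.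
by rewrite addrC subrK cisD2pi cis_angle_pos.
Qed.

Lemma cis_inj a x : a <= x < a + 2 * pi -> cis a = cis x -> a = x.
Proof.
move=> ax e; have u1 := enorm_cis a.
apply: (@polar_inj R (cis a)); rewrite ?u1 ?scale1r //.
Qed.

Lemma arc_param_cis a x : 0 <= x < 2 * pi -> 0 <= a < 2 * pi -> arc_param a (cis (a + x)) = x.
Proof.
move=> /andP[x0 x1] ap.
have /andP[t0 t1] := arc_param_range (cis (a + x)) ap.
have e := cis_arc_param a (enorm_cis (a + x)).
set t := arc_param a _ in t0 t1 e *.
case: (leP t x) => [tx|/ltW xt]; apply: (@addrI _ a).
  apply: cis_inj => //; rewrite lerD2l tx /= -addrA ltrD2l.
  by apply: lt_le_trans x1 _; rewrite lerDr.
apply/esym; apply: cis_inj => //; rewrite lerD2l xt /= -addrA ltrD2l.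
by apply: lt_le_trans t1 _; rewrite lerDr.
Qed.

Lemma measurable_arc_param a : measurable_fun [set: R * R] (arc_param a).
Proof.
have m_angle : measurable_fun [set: R * R] angle.
  apply: measurable_fun_ifT.
  - by apply: measurable_fun_eqr => //; exact: measurable_fst.
  - exact: measurable_cst.
  - apply: measurable_funM => //.
    apply: (@measurableT_comp _ _ _ _ _ _ (@atan R)).
      by apply: continuous_measurable_fun => y; exact: continuous_atan.
    apply: measurable_funM; first exact: measurable_snd.
    apply: (@measurableT_comp _ _ _ _ _ _ (fun y : R => y `^ (-1))).
      exact: measurable_powR.
    by apply: measurable_funD => //; exact: measurable_fst.
have m_pos : measurable_fun [set: R * R] angle_pos.
  apply: measurable_fun_ifT => //; first exact: measurable_fun_ltr.
  exact: measurable_funD.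
apply: measurable_fun_ifT; first exact: measurable_fun_ltr.
  by apply: measurable_funB => //; exact: measurable_funD.
exact: measurable_funB.
Qed.

End CircleAngle.

Section ArcMeasure.
Variable R : realType.
Implicit Types (u : R * R) (a l x th : R) (A : set (R * R)).
Local Notation leb := (@lebesgue_measure R).

Definition arc (b1 b2 : bool) a l : set (R * R) :=
  (@cis R) @` [set` Interval (BSide b1 a) (BSide b2 (a + l))].

Lemma arc_circle b1 b2 a l u : arc b1 b2 a l u -> enorm u = 1.
Proof. by case=> th _ <-; exact: enorm_cis. Qed.

Lemma arc_param_le b1 b2 a l u : 0 <= a < 2 * pi -> 0 <= l <= 2 * pi ->
  arc b1 b2 a l u -> arc_param a u <= l.
Proof.
move=> ap /andP[l0]; rewrite le_eqVlt => /orP[/eqP->|l2].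
  by move=> _; have /andP[_ /ltW] := arc_param_range u ap.
case=> th /=; rewrite in_itv /= => /andP[h1 h2] <-.
have a1 : a <= th by case: b1 h1 => //= /ltW.
have a2 : th <= a + l by case: b2 h2 => //= /ltW.
rewrite -[th](subrKC a) arc_param_cis //.
  by rewrite lerBlDl.
by rewrite subr_ge0 a1 /= ltrBlDl (le_lt_trans a2) // ltrD2l.
Qed.

Lemma arc_of_param b1 b2 a l u : 0 <= a < 2 * pi -> enorm u = 1 ->
  0 < arc_param a u < l -> arc b1 b2 a l u.
Proof.
move=> ap u1 /andP[t0 tl]; exists (a + arc_param a u); last exact: cis_arc_param.
rewrite /= in_itv /=; case: b1; case: b2; rewrite /= ?ltrDl ?lerDl ?ltrD2l ?lerD2l ?t0 ?tl ?(ltW t0) ?(ltW tl) //.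
Qed.

Lemma measurable_circle : measurable (@circle R).
Proof.
have -> : @circle R = setT `&` (fun u : R * R => u.1 ^+ 2 + u.2 ^+ 2) @^-1` [set 1].
  rewrite setTI; apply/seteqP; split => u /=; first exact: circle_sqr.
  by rewrite /circle /enorm /= => ->; rewrite sqrtr1.
have m : measurable_fun [set: R * R] (fun u : R * R => u.1 ^+ 2 + u.2 ^+ 2).
  apply: measurable_funD; apply: measurable_funX; [exact: measurable_fst|exact: measurable_snd].
by apply: m => //; exact: measurable_set1.
Qed.

Lemma measurable_plane_set1 u : measurable [set u].
Proof.
have -> : [set u] = [set u.1] `*` [set u.2].
  by apply/seteqP; split => -[x y] /=; [move=> <-|case: u => p q /= [-> ->]].
by apply: measurableX; exact: measurable_set1.
Qed.

(** Up to its two ends an arc is the part of the circle where [arc_param a] is in [(0, l)]. Treating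
    the ends as separate singletons covers all choices of endpoints, and the full circle, at
    once. *)
Lemma measurable_arc b1 b2 a l : 0 <= a < 2 * pi -> 0 <= l <= 2 * pi ->
  measurable (arc b1 b2 a l).
Proof.
move=> ap lp.
have E : arc b1 b2 a l =
   (@circle R `&` (arc_param a @^-1` `]0, l[%classic))
   `|` ((arc b1 b2 a l `&` [set cis a]) `|` (arc b1 b2 a l `&` [set cis (a + l)])).
  apply/seteqP; split => u; last first.
    by case=> [[u1]|[[]|[]]] //=; rewrite in_itv /=; exact: arc_of_param.
  move=> Xu; have u1 := arc_circle Xu; have tl := arc_param_le ap lp Xu.
  have /andP[t0 _] := arc_param_range u ap; have e := cis_arc_param a u1.
  move: t0; rewrite le_eqVlt => /orP[/eqP t0|t0].
    by right; left; split=> //=; rewrite -e -t0 addr0.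
  move: tl; rewrite le_eqVlt => /orP[/eqP tl|tl].
    by right; right; split=> //=; rewrite -e tl.
  by left; split=> //=; rewrite in_itv /= t0.
have single (B : set (R * R)) u : measurable (B `&` [set u]).
  case: (pselect (B u)) => Bu.
    have -> : B `&` [set u] = [set u] by apply/seteqP; split => [x []//|x /= ->]; split.
    exact: measurable_plane_set1.
  by have -> : B `&` [set u] = set0 by apply/seteqP; split => [x [Bx /= e]|//]; apply: Bu; rewrite -e.
rewrite E; apply: measurableU; last by apply: measurableU; exact: single.
apply: measurableI; first exact: measurable_circle.
rewrite -[X in measurable X]setTI; apply: measurable_arc_param => //.
Qed.

Lemma arc_lengthE A : arc_length A = leb ((@cis R) @^-1` A `&` `[0, 2 * pi[%classic).
Proof. by []. Qed.

(** The angles of an arc starting at [a], cut at [2 pi]: those past it reappear from 0 on. The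
    boolean puts [a] itself in or out without changing the measure. *)
Lemma leb_two_pieces b a x : 0 <= a < 2 * pi -> 0 <= x <= 2 * pi ->
  leb ([set` Interval (BSide b a) (BSide true (Num.min (a + x) (2 * pi)))]
        `|` `[0, a + x - 2 * pi[%classic) = x%:E.
Proof.
move=> /andP[a0 a2] /andP[x0 x2].
rewrite measureU //; last first.
  apply/seteqP; split => y //= []; rewrite !in_itv /= => /andP[h1 _] /andP[_ h2].
  have a1 : a <= y by case: b h1 => //= /ltW.
  by move: h2; rewrite ltNge => /negP; apply; apply: le_trans a1; rewrite lerBlDl addrC lerD2r.
rewrite [X in (X + _)%E = _](lebesgue_measure_itv (Interval _ _)).
rewrite [X in (_ + X)%E = _](lebesgue_measure_itv `[_, _[) /= !lte_fin.
case: (leP (a + x) (2 * pi)) => [ax|ax].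
  rewrite [X in (_ + X)%E](_ : _ = 0%E); last by rewrite ifF // ltNge subr_le0 ax.
  rewrite adde0 ltrDl; case: ltP => x0'; first by rewrite -EFinB addrC addKr.
  by congr _%:E; apply/eqP; rewrite eq_le x0 x0'.
rewrite a2 subr_gt0 ax -!EFinB -EFinD; congr _%:E.
by move: (2 * pi : R) => p; ring.
Qed.

Lemma arc_param_cisE a th : 0 <= a < 2 * pi -> 0 <= th < 2 * pi ->
  arc_param a (cis th) = if th < a then th + 2 * pi - a else th - a.
Proof.
move=> ap /andP[th0 th2]; have /andP[a0 a2] := ap; case: ltP => tha.
  rewrite -cisD2pi -{1}[th + 2 * pi](subrKC a) arc_param_cis //.
  rewrite subr_ge0 ltrBlDl ltrD2r tha andbT.
  by apply: ltW; apply: lt_le_trans a2 _; rewrite lerDr.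
rewrite -{1}[th](subrKC a) arc_param_cis // subr_ge0 tha ltrBlDl.
by apply: lt_le_trans th2 _; rewrite lerDr.
Qed.

(** The angles lie between the two sets of [leb_two_pieces], with and without [a], which have equal
    measure. So [arc_param a] is uniformly distributed on the arc whatever its endpoints. *)
Lemma arc_length_level b1 b2 a l x : 0 <= a < 2 * pi -> 0 <= l <= 2 * pi ->
  0 <= x <= l ->
  arc_length (arc b1 b2 a l `&` [set u | arc_param a u < x]) = x%:E.
Proof.
move=> ap lp /andP[x0 xl]; have /andP[l0 l2] := lp; have /andP[a0 a2] := ap.
have xp : 0 <= x <= 2 * pi by rewrite x0 (le_trans xl).
have mX : measurable (arc b1 b2 a l `&` [set u | arc_param a u < x]).
  apply: measurableI; first exact: measurable_arc.
  have -> : [set u | arc_param a u < x] = setT `&` (arc_param a) @^-1` `]-oo, x[%classic.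
    by apply/seteqP; split => u /=; rewrite in_itv /=; [|case].
  exact: measurable_arc_param.
rewrite arc_lengthE.
set B := _ `&` _.
have mB : measurable B.
  apply: measurableI; last exact: measurable_period.
  by rewrite -[X in measurable X]setTI; apply: (@measurable_cis R).
have param th := @arc_param_cisE a th ap.
apply/eqP; rewrite eq_le; apply/andP; split.
  rewrite -(leb_two_pieces true ap xp); apply: le_measure; rewrite ?inE //; first exact: measurableU.
  move=> th [[_ /= tx]]; rewrite /= in_itv /= => thp.
  move: tx; rewrite param //; case: (ltP (th : R) a) => tha tx.
    right; rewrite /= in_itv /=; case/andP: thp => -> _ /=.
    by move: tx; move: (2 * pi : R) => p ?; lra.
  left; rewrite /= in_itv /= tha lt_min; case/andP: thp => _ ->; rewrite andbT.
  by rewrite -ltrBlDl.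
rewrite -(leb_two_pieces false ap xp); apply: le_measure; rewrite ?inE //; first exact: measurableU.
move=> th [|] /=; rewrite in_itv /=.
  rewrite lt_min => /andP[ath /andP[thx th2]].
  have thp : 0 <= th < 2 * pi by rewrite th2 (le_trans a0) // ltW.
  have tE : arc_param a (cis th) = th - a by rewrite param // ltNge ltW.
  split; last by rewrite /= in_itv.
  split; last by rewrite /= tE ltrBlDl.
  apply: arc_of_param => //; first exact: enorm_cis.
  by rewrite tE subr_gt0 ath ltrBlDl (lt_le_trans thx) // lerD2l.
move=> /andP[th0 thx].
have tha : th < a.
  by apply: lt_le_trans thx _; rewrite lerBlDl addrC lerD2r (le_trans xl).
have thp : 0 <= th < 2 * pi by rewrite th0 (lt_trans tha).
have tE : arc_param a (cis th) = th + 2 * pi - a by rewrite param // tha.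
have tx : arc_param a (cis th) < x.
  by rewrite tE; move: thx; move: (2 * pi : R) => p ?; lra.
split; last by rewrite /= in_itv.
split; last exact: tx.
apply: arc_of_param => //; first exact: enorm_cis.
apply/andP; split; last exact: lt_le_trans tx xl.
by rewrite tE; move: th0 a2; move: (2 * pi : R) => p *; lra.
Qed.

(** The level [l] misses only the points with [arc_param a u = l]; their angle is [a + l] or
    [a + l - 2 pi], so they form a null set. *)
Lemma arc_lengthP b1 b2 a l : 0 <= a < 2 * pi -> 0 <= l <= 2 * pi ->
  arc_length (arc b1 b2 a l) = l%:E.
Proof.
move=> ap lp; have /andP[l0 l2] := lp.
set X := arc b1 b2 a l.
have mX : measurable X by exact: measurable_arc.
set L := [set u | arc_param a u < l].
have mL : measurable L.
  have -> : L = setT `&` (arc_param a) @^-1` `]-oo, l[%classic.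
    by apply/seteqP; split => u /=; rewrite in_itv /=; [|case].
  exact: measurable_arc_param.
have mlev := measurableI _ _ mX mL.
have mtop := measurableD mX mL.
rewrite (measureDI _ mX mL).
rewrite [X in (_ + X)%E = _](arc_length_level b1 b2 ap lp) ?l0 ?lexx // [X in (X + _)%E](_ : _ = 0%E) ?add0e //.
apply/eqP; rewrite eq_le measure_ge0 andbT.
set P := ((@cis R) @^-1` (X `\` L) `&` `[0, 2 * pi[%classic).
change (leb P <= 0)%E.
set p1 := a + l; set p2 := p1 - 2 * pi.
apply: (@le_trans _ _ (leb ([set p1] `|` [set p2]))).
  apply: le_measure; rewrite ?inE.
  - apply: measurableI; last exact: measurable_period.
    by rewrite -[X in measurable X]setTI; apply: (@measurable_cis R).
  - by apply: measurableU; exact: measurable_set1.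
  move=> th [[Xt /negP]]; rewrite /L /= -leNgt => lt; rewrite in_itv /= => thp.
  have tE : arc_param a (cis th) = l by apply/eqP; rewrite eq_le lt (arc_param_le ap lp Xt).
  move: tE; rewrite arc_param_cisE //; case: ltP => _ e; [right|left]; rewrite /= /p2 /p1 -e.
    by move: (2 * pi : R) => p; ring.
  by ring.
rewrite (@le_trans _ _ (leb [set p1] + leb [set p2])%E) //.
  apply: measureU2; exact: measurable_set1.
by rewrite [leb [set p1]]lebesgue_measure_set1 [leb [set p2]]lebesgue_measure_set1 adde0.
Qed.

End ArcMeasure.

(** * From counting functions to Lipschitz averages *)

Section StepApproximation.
Variables (R : realType) (phi : R -> R) (L l : R) (M : nat).
Hypothesis phi_lip : forall x y, `|phi x - phi y| <= L * `|x - y|.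
Hypothesis l_gt0 : 0 < l.
Hypothesis M_gt0 : (0 < M)%N.

Definition node (j : nat) : R := j%:R * (l / M%:R).
Definition jump (j : nat) : R := phi (node j) - phi (node j.-1).
(* Abel summation: a combination of the functions [x < node j], whose averages
   are the counting functions. *)
Definition step (x : R) : R :=
  phi l - \sum_(1 <= j < M.+1) jump j * (x < node j)%R%:R.

Lemma lip_ge0 : 0 <= L.
Proof.
have := phi_lip 0 1; rewrite sub0r normrN normr1 mulr1.
by apply: le_trans; exact: normr_ge0.
Qed.

Lemma node_width : 0 < l / M%:R.
Proof. by rewrite divr_gt0 // ltr0n. Qed.

Lemma nodeM : node M = l.
Proof. by rewrite /node mulrCA mulfV ?mulr1 // pnatr_eq0 -lt0n. Qed.

Lemma norm_jump_le j : (0 < j)%N -> `|jump j| <= L * (l / M%:R).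
Proof.
move=> j0; apply: le_trans (phi_lip _ _) _; apply: ler_wpM2l; first exact: lip_ge0.
rewrite /node -mulrBl -[in j%:R](prednK j0) -natr1 addrAC subrr add0r mul1r.
by rewrite ger0_norm // ltW // node_width.
Qed.

Lemma sum_norm_jump_le : \sum_(1 <= j < M.+1) `|jump j| <= L * l.
Proof.
apply: (@le_trans _ _ (\sum_(1 <= j < M.+1) L * (l / M%:R))).
  by apply: ler_sum_nat => j /andP[j0 _]; exact: norm_jump_le.
rewrite sumr_const_nat subn1 /= -[_ *+ M]mulr_natr mulrA divfK //.
by rewrite pnatr_eq0 -lt0n.
Qed.

Lemma step_near x : 0 <= x <= l -> `|step x - phi x| <= L * (l / M%:R).
Proof.
move=> /andP[x0 xl]; have wd := node_width.
have MR : 0 < M%:R :> R by rewrite ltr0n.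
have L0 := lip_ge0.
have node_le j : (j <= M)%N -> node j <= l.
  by move=> jM; rewrite -nodeM ler_pM2r // ler_nat.
move: xl; rewrite le_eqVlt => /orP[/eqP->|xl].
  rewrite /step big_nat_cond big1 ?subr0 ?subrr ?normr0 ?mulr_ge0 ?invr_ge0 ?(ltW l_gt0) //.
  by move=> j /andP[/andP[_ jM] _]; rewrite ltNge node_le // mulr0.
set k := Num.truncn (x / (l / M%:R)).
have xw : 0 <= x / (l / M%:R) by rewrite divr_ge0 // ltW.
have kx : node k <= x.
  by rewrite /node -ler_pdivlMr // truncn_le.
have xk : x < node k.+1.
  by rewrite /node -ltr_pdivrMr // truncnS_gt.
have kM : (k < M)%N.
  rewrite -(ltr_nat R) -(ltr_pM2r wd).
  by apply: le_lt_trans kx _; rewrite -[_ * _]/(node M) nodeM.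
(* Only the jumps with [j > k] remain, and they telescope to [phi l - phi (node k)]. *)
have -> : step x = phi (node k).
  rewrite /step (big_cat_nat (n := k.+1)) //=; last by rewrite ltnS ltnW.
  rewrite big_nat_cond big1 ?add0r; last first.
    move=> j /andP[/andP[_ jk] _]; rewrite ltNge (le_trans _ kx) ?mulr0 //.
    by rewrite ler_pM2r // ler_nat.
  rewrite (eq_big_nat _ _ (F2 := jump)); last first.
    move=> j /andP[kj _]; rewrite (lt_le_trans xk) ?mulr1 //.
    by rewrite ler_pM2r // ler_nat.
  rewrite big_add1 /= (telescope_sumr (fun j => phi (node j))); last exact: ltnW.
  by rewrite nodeM opprB addrC subrK.
apply: le_trans (phi_lip _ _) _; apply: ler_wpM2l => //.
rewrite distrC ger0_norm ?subr_ge0 // lerBlDl ltW //.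
by move: xk; rewrite /node -natr1 mulrDl mul1r.
Qed.

End StepApproximation.

Section SumSide.
Variables (R : realType) (T : Type) (S : seq T) (t : T -> R) (phi : R -> R) (L l k E : R).
Hypothesis phi_lip : forall x y, `|phi x - phi y| <= L * `|x - y|.
Hypothesis l_gt0 : 0 < l.
Hypothesis t_range : all (fun v => 0 <= t v <= l) S.
Hypothesis total : `|(size S)%:R - k * l| <= E.
Hypothesis counts : forall x, 0 <= x <= l ->
  `|\sum_(v <- S) (t v < x)%R%:R - k * x| <= E.

(** The counting error is multiplied by [|phi l|] and by the total variation of the steps, at most
    [L l] for every [M]; only the last term depends on [M], and it disappears in the limit. *)
Lemma sum_step_near (M : nat) : (0 < M)%N ->
  `|\sum_(v <- S) phi (t v) - k * (phi l * l - \sum_(1 <= j < M.+1) jump phi l M j * node l M j)|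
  <= (`|phi l| + L * l) * E + (size S)%:R * (L * (l / M%:R)).
Proof.
move=> M0; have E0 : 0 <= E by exact: le_trans total.
have e1 : `|\sum_(v <- S) phi (t v) - \sum_(v <- S) step phi l M (t v)|
    <= (size S)%:R * (L * (l / M%:R)).
  rewrite -sumrB; apply: le_trans (ler_norm_sum _ _ _) _.
  elim: S t_range => [|v s IH] /=; first by rewrite big_nil mul0r.
  move=> /andP[tv ts]; rewrite big_cons -natr1 mulrDl mul1r addrC; apply: lerD; first exact: IH.
  by rewrite distrC; exact: step_near.
have e2 : \sum_(v <- S) step phi l M (t v)
   = phi l * (size S)%:R - \sum_(1 <= j < M.+1) jump phi l M j * \sum_(v <- S) (t v < node l M j)%R%:R.
  rewrite /step sumrB; congr (_ - _).
    by rewrite big_const_seq count_predT iter_addr_0 mulr_natr.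
  by rewrite exchange_big /=; apply: eq_bigr => j _; rewrite mulr_sumr.
have e3 : `|\sum_(v <- S) step phi l M (t v)
    - k * (phi l * l - \sum_(1 <= j < M.+1) jump phi l M j * node l M j)|
    <= (`|phi l| + L * l) * E.
  have -> : \sum_(v <- S) step phi l M (t v)
    - k * (phi l * l - \sum_(1 <= j < M.+1) jump phi l M j * node l M j)
   = phi l * ((size S)%:R - k * l)
    - \sum_(1 <= j < M.+1) jump phi l M j * (\sum_(v <- S) (t v < node l M j)%R%:R - k * node l M j).
    rewrite e2.
    have -> : \sum_(1 <= j < M.+1) jump phi l M j * (\sum_(v <- S) (t v < node l M j)%R%:R - k * node l M j)
      = \sum_(1 <= j < M.+1) jump phi l M j * (\sum_(v <- S) (t v < node l M j)%R%:R)
        - k * \sum_(1 <= j < M.+1) jump phi l M j * node l M j.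
      by rewrite mulr_sumr -sumrB; apply: eq_bigr => j _; ring.
    by ring.
  apply: le_trans (ler_normB _ _) _; rewrite mulrDl; apply: lerD.
    by rewrite normrM ler_wpM2l.
  apply: le_trans (ler_norm_sum _ _ _) _.
  apply: (@le_trans _ _ (\sum_(1 <= j < M.+1) `|jump phi l M j| * E)).
    apply: ler_sum_nat => j /andP[j0 jM]; rewrite normrM ler_wpM2l //.
    apply: counts; rewrite /node mulr_ge0 ?(ltW (node_width l_gt0 M0)) //=.
    rewrite -[leRHS](nodeM l M0) ler_pM2r ?node_width // ler_nat //.
  by rewrite -mulr_suml ler_wpM2r // sum_norm_jump_le.
apply: le_trans (ler_distD (\sum_(v <- S) step phi l M (t v)) _ _) _.
by rewrite addrC; exact: lerD.
Qed.

End SumSide.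

Lemma lipschitz_continuous (R : realType) (phi : R -> R) (L : R) :
  (forall x y, `|phi x - phi y| <= L * `|x - y|) -> continuous phi.
Proof.
move=> phi_lip; have L0 := lip_ge0 phi_lip.
move=> x; apply/cvgrPdist_le => e e0; near=> y.
apply: le_trans (phi_lip _ _) _.
have : `|x - y| <= e / (L + 1).
  near: y; apply: cvgr_dist_le; first exact: cvg_id.
  by rewrite divr_gt0 // ltr_wpDl.
rewrite ler_pdivlMr ?ltr_wpDl //; apply: le_trans.
by rewrite mulrC ler_wpM2l // lerDl.
Unshelve. all: end_near.
Qed.

Section IntegralSide.
Context (d : measure_display) (T : measurableType d) (R : realType).
Variables (mu : {measure set T -> \bar R}) (X : set T) (t : T -> R).
Variables (phi : R -> R) (L l : R).
Hypothesis phi_lip : forall x y, `|phi x - phi y| <= L * `|x - y|.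
Hypothesis l_gt0 : 0 < l.
Hypothesis mX : measurable X.
Hypothesis mt : measurable_fun setT t.
Hypothesis t_range : forall u, X u -> 0 <= t u <= l.
Hypothesis muX : mu X = l%:E.
Hypothesis mu_level : forall x, 0 <= x <= l ->
  mu (X `&` [set u | t u < x]) = x%:E.

Lemma bounded_integrable (f : T -> R) (B : R) : measurable_fun X f ->
  (forall u, X u -> `|f u| <= B) -> mu.-integrable X (EFin \o f).
Proof.
move=> mf fB; apply: measurable_bounded_integrable => //.
  by rewrite muX ltry.
by exists B; split; [exact: num_real | move=> y By u /fB /le_trans; apply; exact: ltW].
Qed.

Lemma measurable_level x : measurable [set u | t u < x].
Proof.
have -> : [set u | t u < x] = setT `&` t @^-1` `]-oo, x[%classic.
  by apply/seteqP; split => u /=; rewrite in_itv /=; [|case].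
exact: mt.
Qed.

Lemma measurable_lt_level x : measurable_fun X (fun u => (t u < x)%R%:R : R).
Proof.
have -> : (fun u => (t u < x)%R%:R : R) = \1_[set u | t u < x].
  apply/funext => u; rewrite indicE; congr (nat_of_bool _)%:R.
  by apply/idP/idP => [?|/set_mem//]; rewrite inE.
apply: measurable_funTS; apply: measurable_indic; exact: measurable_level.
Qed.

Lemma integral_level x : 0 <= x <= l ->
  \int[mu]_(u in X) ((t u < x)%R%:R : R) = x.
Proof.
move=> xl; rewrite /Rintegral.
rewrite (eq_integral (fun u => (\1_[set u | t u < x] u)%:E)); last first.
  move=> u _; rewrite indicE; congr (nat_of_bool _)%:R%:E.
  by apply/idP/idP => [?|/set_mem//]; rewrite inE.
rewrite integral_indic //; last exact: measurable_level.
by rewrite setIC mu_level.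
Qed.

Lemma integral_levels (s : seq nat) (a y : nat -> R) :
  all (fun j => 0 <= y j <= l) s ->
  mu.-integrable X (EFin \o (fun u => \sum_(j <- s) a j * (t u < y j)%R%:R)) /\
  \int[mu]_(u in X) (\sum_(j <- s) a j * (t u < y j)%R%:R) = \sum_(j <- s) a j * y j.
Proof.
elim: s => [_|j s IH /andP[yj /IH[int_s eq_s]]].
  split.
    under eq_fun do rewrite big_nil.
    apply: (bounded_integrable (B := 0)); first exact: measurable_cst.
    by move=> u _; rewrite normr0.
  by under eq_Rintegral do rewrite big_nil; rewrite big_nil Rintegral_cst // mul0r.
have int_l : mu.-integrable X (EFin \o (fun u => (t u < y j)%R%:R : R)).
  apply: (bounded_integrable (B := 1)); first exact: measurable_lt_level.
  by move=> u _; rewrite normr_nat lern1 leq_b1.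
have int_j : mu.-integrable X (EFin \o (fun u => a j * (t u < y j)%R%:R)).
  apply: (bounded_integrable (B := `|a j|)).
    by apply: measurable_funM => //; exact: measurable_lt_level.
  by move=> u _; rewrite normrM ler_piMr // normr_nat lern1 leq_b1.
split.
  under eq_fun do rewrite big_cons.
  by apply: eq_integrable (integrableD mX int_j int_s) => // u _; rewrite /= EFinD.
under eq_Rintegral do rewrite big_cons.
by rewrite RintegralD // eq_s RintegralZl // integral_level // big_cons.
Qed.

(** The same expression in the nodes as on the side of the sums. Comparing both with it avoids
    transporting the integral from [X] to the line. *)
Lemma integral_step_near (M : nat) : (0 < M)%N ->
  `|\int[mu]_(u in X) phi (t u) - (phi l * l - \sum_(1 <= j < M.+1) jump phi l M j * node l M j)|
  <= l * (L * (l / M%:R)).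
Proof.
move=> M0; have L0 := lip_ge0 phi_lip.
have nodes : all (fun j => 0 <= node l M j <= l) (index_iota 1 M.+1).
  apply/allP => j; rewrite mem_index_iota => /andP[_ jM].
  rewrite /node mulr_ge0 ?(ltW (node_width l_gt0 M0)) //=.
  by rewrite -[leRHS](nodeM l M0) ler_pM2r ?node_width // ler_nat.
have [int_s eq_s] := integral_levels (jump phi l M) nodes.
have phi_cont := lipschitz_continuous phi_lip.
have mphi : measurable_fun X (fun u => phi (t u)).
  apply: measurable_funTS; apply: measurableT_comp => //.
  exact: continuous_measurable_fun.
have int_phi : mu.-integrable X (EFin \o (fun u => phi (t u))).
  apply: (bounded_integrable (B := `|phi 0| + L * l)) => //.
  move=> u /t_range/andP[t0 tl].
  have -> : phi (t u) = phi 0 + (phi (t u) - phi 0) by rewrite addrC subrK.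
  apply: le_trans (ler_normD _ _) _; rewrite lerD2l.
  apply: le_trans (phi_lip _ _) _; rewrite ler_wpM2l // subr0 ger0_norm //.
have int_c : mu.-integrable X (EFin \o (fun=> phi l)).
  by apply: (bounded_integrable (B := `|phi l|)); first exact: measurable_cst.
have int_step : mu.-integrable X (EFin \o (fun u => step phi l M (t u))).
  by apply: eq_integrable (integrableB mX int_c int_s) => // u _; rewrite /= EFinB.
have <- : \int[mu]_(u in X) (step phi l M (t u))
   = phi l * l - \sum_(1 <= j < M.+1) jump phi l M j * node l M j.
  by rewrite RintegralB // eq_s Rintegral_cst // muX.
have int_d : mu.-integrable X (EFin \o (fun u => phi (t u) - step phi l M (t u))).
  by apply: eq_integrable (integrableB mX int_phi int_step) => // u _; rewrite /= EFinB.
rewrite -RintegralB //; apply: le_trans (le_normr_Rintegral mX int_d) _.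
apply: (@le_trans _ _ (\int[mu]_(u in X) (L * (l / M%:R)))).
  apply: le_Rintegral => //.
  - by apply: eq_integrable (integrable_abse int_d).
  - by apply: (bounded_integrable (B := `|L * (l / M%:R)|)); first exact: measurable_cst.
  - by move=> u /t_range tu; rewrite distrC; exact: step_near.
by rewrite Rintegral_cst // muX /= mulrC.
Unshelve. all: by end_near. Qed.

End IntegralSide.

Lemma ler_add_div (R : realType) (a b c : R) : 0 <= c ->
  (forall M : nat, (0 < M)%N -> a <= b + c / M%:R) -> a <= b.
Proof.
move=> c0 h; apply/ler_addgt0Pr => e e0.
have := h (Num.truncn (c / e)).+1 isT => /le_trans; apply.
rewrite lerD2l ler_pdivrMr ?ltr0n // mulrC -ler_pdivrMr //.
by rewrite ltW // truncnS_gt.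
Qed.

(** A Koksma inequality: discrepancy times variation, plus a boundary term. Sum and integral are
    compared through [M] nodes and then [M] grows. The space is abstract, so that arcs and the
    segment [[0, 1/2]] are both covered. *)
Lemma equidistribution_by_counts (R : realType) (V : Type) (S : seq V) (tS : V -> R)
    (d : measure_display) (T : measurableType d) (mu : {measure set T -> \bar R})
    (X : set T) (t : T -> R) (phi : R -> R) (L l k E : R) :
  (forall x y, `|phi x - phi y| <= L * `|x - y|) -> 0 < l ->
  measurable X -> measurable_fun setT t -> (forall u, X u -> 0 <= t u <= l) ->
  mu X = l%:E ->
  (forall x, 0 <= x <= l -> mu (X `&` [set u | t u < x]) = x%:E) ->
  all (fun v => 0 <= tS v <= l) S ->
  `|(size S)%:R - k * l| <= E ->
  (forall x, 0 <= x <= l -> `|\sum_(v <- S) (tS v < x)%R%:R - k * x| <= E) ->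
  `|\sum_(v <- S) phi (tS v) - k * \int[mu]_(u in X) phi (t u)| <= (`|phi l| + L * l) * E.
Proof.
move=> lip l0 mX mt tX muX mulev tl tot cnt.
have L0 := lip_ge0 lip.
apply: (@ler_add_div _ _ _ ((size S)%:R * (L * l) + `|k| * (l * (L * l)))).
  by rewrite addr_ge0 ?mulr_ge0 // ltW.
move=> M M0.
have h1 := sum_step_near lip l0 tl tot cnt M0.
have h2 := integral_step_near lip l0 mX mt tX muX mulev M0.
set J := phi l * l - _ in h1 h2.
have h3 : `|k * J - k * \int[mu]_(u in X) phi (t u)| <= `|k| * (l * (L * (l / M%:R))).
  by rewrite -mulrBr normrM ler_wpM2l // distrC.
apply: le_trans (ler_distD (k * J) _ _) _.
apply: le_trans (lerD h1 h3) _.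
rewrite le_eqVlt; apply/orP; left; apply/eqP.
by field; rewrite pnatr_eq0 -lt0n.
Qed.

(** * The direction of the companion vector *)

Section Companion.
Variable R : realType.
Implicit Types (u : R * R) (t : R) (v w : int * int).

Lemma pi_le4 : pi <= 4 :> R.
Proof.
have := pihalf_lt2 R; move: (pi : R) => p *; lra.
Qed.

Lemma enormZ (k : R) u : 0 <= k -> enorm (k *: u) = k * enorm u.
Proof.
move=> k0; rewrite /enorm /= !exprMn -mulrDr sqrtrM ?sqr_ge0 // sqrtr_sqr ger0_norm //.
Qed.

Lemma enorm_dir u : 0 < enorm u -> enorm (dir u) = 1.
Proof. by move=> u0; rewrite /dir enormZ ?invr_ge0 ?(ltW u0) // mulVf // gt_eqF. Qed.

Lemma rotation_cis t x : rotation t (cis x) = cis (x + t).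
Proof. by rewrite /rotation /cis /= cosD sinD; congr pair; ring. Qed.

Lemma cisDpi t : cis (t + pi) = - cis t.
Proof. by rewrite /cis cosDpi sinDpi. Qed.

Lemma enorm_vec_ge1 v : primitive v -> 1 <= enorm (vec R v).
Proof.
move=> pv; rewrite -sqrtr1 ler_wsqrtr //=.
have := primitive_neq0 R pv; rewrite -!rmorphXn -rmorphD /= ltr0z => h.
by rewrite -[1]/(1%:~R) ler_int; lia.
Qed.

Lemma gcd_solution_neq0 v w : gcd_solution v w -> primitive w.
Proof.
rewrite /gcd_solution /primitive => g; apply/coprimezP; exists (v.2, - v.1) => /=.
by rewrite -g mulNr.
Qed.

Lemma angle_fromP u u' t : enorm (dir u) = 1 -> 0 <= t < 2 * pi ->
  dir u' = rotation t (dir u) -> angle_from u u' = t.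
Proof.
move=> u1 tp e; apply: xget_subset1; first by split.
move=> x y [xp ex] [yp ey].
have [th dE] : exists th, dir u = cis th by exists (angle (dir u)); rewrite cis_angle.
have ce : cis (th + x) = cis (th + y) by rewrite -!rotation_cis -dE -ex -ey.
have [x0 x2] := andP xp; have [y0 y2] := andP yp.
case: (leP x y) => [xy|/ltW yx]; apply: (@addrI _ th).
  apply: cis_inj => //; rewrite lerD2l xy /= -addrA ltrD2l.
  by apply: lt_le_trans y2 _; rewrite lerDr.
apply/esym; apply: cis_inj => //; rewrite lerD2l yx /= -addrA ltrD2l.
by apply: lt_le_trans x2 _; rewrite lerDr.
Qed.

(** Cosine and sine of the angle from [w] to [v] are the scalar product and the determinant over
    [|v| |w|]. The determinant is 1 by the gcd equation, so the sine is positive and small. *)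
Lemma companion_angle v w : primitive v -> gcd_solution v w ->
  exists al : R, [/\ 0 < al < pi,
    cos al = lam R v w * (enorm (vec R v) / enorm (vec R w)),
    sin al = (enorm (vec R v) * enorm (vec R w))^-1 &
    dir (vec R v) = rotation al (dir (vec R w))].
Proof.
move=> pv g; have pw := gcd_solution_neq0 g.
have n1 := enorm_vec_ge1 pv; have m1 := enorm_vec_ge1 pw.
have n2 := enorm_sqr (vec R v); have m2 := enorm_sqr (vec R w).
rewrite /lam; move: g; rewrite /gcd_solution => /(congr1 (fun z : int => z%:~R : R)).
rewrite rmorphB !rmorphM rmorph1 => g.
move: n1 m1 n2 m2 g; rewrite /dir /rotation /=.
set n := enorm _; set m := enorm _.
set v1 : R := v.1%:~R; set v2 : R := v.2%:~R; set w1 : R := w.1%:~R; set w2 : R := w.2%:~R.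
move=> n1 m1 n2 m2 g.
have n0 : 0 < n by apply: lt_le_trans n1. 
have m0 : 0 < m by apply: lt_le_trans m1.
rewrite -n2; set P := w1 * v1 + w2 * v2.
have PE : (P / (n * m)) ^+ 2 + (n * m)^-1 ^+ 2 = 1.
  have e : P ^+ 2 + 1 = n ^+ 2 * m ^+ 2.
    transitivity (P ^+ 2 + (v2 * w1 - v1 * w2) ^+ 2); first by rewrite g expr1n.
    by rewrite n2 m2 /P; ring.
  have -> : (P / (n * m)) ^+ 2 + (n * m)^-1 ^+ 2 = (P ^+ 2 + 1) / (n ^+ 2 * m ^+ 2).
    by field; rewrite !gt_eqF.
  by rewrite e divff // mulf_neq0 // expf_neq0 // gt_eqF.
have q0 : 0 < (n * m)^-1 by rewrite invr_gt0 mulr_gt0.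
have x1 : -1 <= P / (n * m) <= 1.
  by move: PE q0; set x := P / _; set y := (n * m)^-1 => *; apply/andP; split; nra.
exists (acos (P / (n * m))).
have cE : cos (acos (P / (n * m))) = P / (n * m) by rewrite acosK // in_itv.
have sE : sin (acos (P / (n * m))) = (n * m)^-1.
  by rewrite sin_acos // -PE addrC addKr sqrtr_sqr ger0_norm // ltW.
rewrite cE sE; split.
- have a0 := acos_ge0 x1; have ap := acos_lepi x1.
  rewrite !lt_neqAle a0 ap !andbT; apply/andP; split.
    by apply/eqP => e; move: sE q0; rewrite -e sin0 => <-; rewrite ltxx.
  by apply/eqP => e; move: sE q0; rewrite e sinpi => <-; rewrite ltxx.
- by field; rewrite !gt_eqF.
- by [].
have h1 : P * w1 - w2 = v1 * m ^+ 2 by rewrite -[X in _ - X]mul1r -g m2 /P; ring.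
have h2 : P * w2 + w1 = v2 * m ^+ 2 by rewrite -[X in _ + X]mul1r -g m2 /P; ring.
congr pair; rewrite /GRing.scale /=.
  transitivity ((P * w1 - w2) / (n * m ^+ 2)); last by field; rewrite !gt_eqF.
  by rewrite h1; field; rewrite !gt_eqF.
transitivity ((P * w2 + w1) / (n * m ^+ 2)); last by field; rewrite !gt_eqF.
by rewrite h2; field; rewrite !gt_eqF.
Qed.

(** The chord bound gives [x <= (pi / 2) / n], and [pi <= 4]. *)
Lemma small_angle (x n m : R) : 0 <= x <= pi / 2 -> 1 <= n -> 1 <= m ->
  sin x = (n * m)^-1 -> x <= 2 / n.
Proof.
move=> xp n1 m1 sx; have := sin_ge_chord xp; rewrite sx.
have pi4 := pi_le4; have pi0 := @pi_gt0 R.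
have n0 : 0 < n by apply: lt_le_trans n1.
have m0 : 0 < m by apply: lt_le_trans m1.
have : (n * m)^-1 <= n^-1 by rewrite invfM ler_piMr ?invr_ge0 ?(ltW n0) // invf_le1.
move: (pi : R) pi0 pi4 => p p0 p4 h1 h2.
have : 2 / p * x <= n^-1 by apply: le_trans h1.
rewrite mulrAC ler_pdivrMr // => h3.
have ni0 : 0 < n^-1 by rewrite invr_gt0.
move: h3 ni0; move: n^-1 => N h3 ni0; nra.
Qed.

Lemma companion_turn v w : primitive v -> gcd_solution v w ->
  exists al : R, [/\ 0 < al < pi, angle_from (vec R w) (vec R v) = al,
    forall tau, dir (vec R v) = cis tau -> dir (vec R w) = cis (tau - al),
    (0 <= lam R v w -> al <= pi / 2 /\ al <= 2 / enorm (vec R v)) &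
    (lam R v w < 0 -> pi / 2 < al /\ pi - al <= 2 / enorm (vec R v))]
    /\ (al < pi / 2) = (0 < lam R v w).
Proof.
move=> pv g; have [al [al0 c s rot]] := companion_angle pv g.
have pw := gcd_solution_neq0 g.
have n1 := enorm_vec_ge1 pv; have m1 := enorm_vec_ge1 pw.
have w1 := enorm_dir (lt_le_trans ltr01 m1).
have [a0 ap] := andP al0; have pi0 := @pi_gt0 R.
have q0 : 0 < enorm (vec R v) / enorm (vec R w).
  by rewrite divr_gt0 //; apply: lt_le_trans ltr01 _.
have cz : forall x : R, 0 <= x <= pi -> (x < pi / 2) = (0 < cos x).
  move=> x xp; rewrite -(cos_pihalf R) ltr_cos // in_itv //= ?divr_ge0 ?ltW //.
  by rewrite ltr_pdivrMr // ltr_pMr // ltr1n.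
have alI : 0 <= al <= pi by rewrite !ltW.
have cn : (pi / 2 < al) = (cos al < 0).
  by rewrite -(cos_pihalf R) ltr_cos // in_itv //= ?divr_ge0 ?ltW // ltr_pdivrMr // ltr_pMr // ltr1n.
exists al; split.
  split=> //.
  - apply: angle_fromP => //; rewrite ltW //= (lt_trans ap) //.
    by rewrite ltr_pMl // ltr1n.
  - move=> tau e.
    have [ph wE] : exists ph, dir (vec R w) = cis ph.
      by exists (angle (dir (vec R w))); rewrite cis_angle.
    move: rot; rewrite e wE rotation_cis /cis => -[e1 e2].
    rewrite cosB sinB e1 e2 cosD sinD.
    have := cos2Dsin2 al; set C := cos al; set S := sin al => h.
    by congr pair; rewrite -[LHS]mulr1 -h; ring.
  - move=> l0.
    have a2 : al <= pi / 2 by rewrite leNgt cn -leNgt c mulr_ge0 // ltW.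
    by split=> //; apply: (@small_angle _ (enorm (vec R v)) (enorm (vec R w))) => //; rewrite (ltW a0) a2.
  move=> l0.
  have a2 : pi / 2 < al by rewrite cn c pmulr_llt0.
  split=> //; apply: (@small_angle _ (enorm (vec R v)) (enorm (vec R w))) => //.
    by rewrite subr_ge0 ltW //=; move: a2; move: (pi : R) => p *; lra.
  by rewrite sinB cospi sinpi mul0r sub0r mulN1r opprK.
by rewrite cz // c pmulr_lgt0.
Qed.

Lemma positive_vectorE v w : primitive v -> gcd_solution v w ->
  positive_vector R v w <-> 0 < lam R v w.
Proof.
move=> pv g; have [al [[/andP[a0 ap] aE _ l1 l2] l3]] := companion_turn pv g.
by rewrite /positive_vector aE a0 /= l3.
Qed.

Lemma negative_vectorE v w : primitive v -> gcd_solution v w ->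
  negative_vector R v w <-> lam R v w < 0.
Proof.
move=> pv g; have [al [[/andP[a0 ap] aE _ l1 l2] l3]] := companion_turn pv g.
rewrite /negative_vector aE ap andbT; split=> [a2|/l2[] //].
by rewrite ltNge; apply/negP => /l1[a3 _]; move: (lt_le_trans a2 a3); rewrite ltxx.
Qed.

(** Since [|lam| = |cos al| |w| / |v|] and [1 - |cos al| <= sin^2 al], the difference is even at
    most [1 / (|v|^3 |w|)]. *)
Lemma companion_ratio v w : primitive v -> gcd_solution v w ->
  `| enorm (vec R w) / enorm (vec R v) - `|lam R v w| | <= (enorm (vec R v))^-1.
Proof.
move=> pv g; have [al [_ c s _]] := companion_angle pv g.
have pw := gcd_solution_neq0 g.
have n1 := enorm_vec_ge1 pv; have m1 := enorm_vec_ge1 pw.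
have := cos2Dsin2 al; rewrite s; move: n1 m1 c.
move: (enorm (vec R v)) (enorm (vec R w)) (cos al) (lam R v w) => n m C l n1 m1 cE cs.
have n0 : 0 < n by apply: lt_le_trans n1. 
have m0 : 0 < m by apply: lt_le_trans m1.
have -> : l = C * (m / n) by rewrite cE; field; rewrite !gt_eqF.
have q0 : 0 < m / n by rewrite divr_gt0.
rewrite normrM (gtr0_norm q0) -[X in X - _]mul1r -mulrBl normrM (gtr0_norm q0).
have C1 : `|C| <= 1.
  rewrite -(@ler_pXn2r _ 2) ?nnegrE // real_normK ?num_real // expr1n -cs lerDl.
  exact: sqr_ge0.
rewrite ger0_norm ?subr_ge0 //.
have h : 1 - `|C| <= (n * m)^-1 ^+ 2.
  have := normr_ge0 C; have : `|C| ^+ 2 = C ^+ 2 by rewrite real_normK ?num_real.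
  move: (`|C|) cs C1 => D; move: ((n * m)^-1 ^+ 2) => q *; nra.
apply: (le_trans (ler_wpM2r (ltW q0) h)).
have -> : (n * m)^-1 ^+ 2 * (m / n) = n^-1 * (m^-1 * (n^-1 ^+ 2)) by field; rewrite !gt_eqF.
rewrite ler_piMr ?invr_ge0 ?(ltW n0) // mulr_ile1 ?invr_ge0 ?exprn_ge0 ?invr_ge0 ?(ltW n0) ?(ltW m0) // ?invf_le1 //.
by rewrite exprn_ile1 ?invr_ge0 ?(ltW n0) // invf_le1.
Qed.

Lemma sub_le_of_derive (f df : R -> R) (s t : R) :
  (forall x : R, is_derive x (1 : R) f (df x)) -> (forall x, `|df x| <= 1) ->
  `|f s - f t| <= `|s - t|.
Proof.
move=> fd df1; wlog ts : s t / t < s => [h|].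
  case: (ltgtP t s) => [/h //|/h|->]; last by rewrite !subrr.
  by rewrite distrC [leRHS]distrC.
have [|c _ ->] := @MVT R f df t s ts (fun x _ => fd x).
  apply: derivable_within_continuous => x _.
  by have [] := fd x.
by rewrite normrM ler_piMl.
Qed.

Lemma enorm_le_sum u : enorm u <= `|u.1| + `|u.2|.
Proof.
rewrite -(@ler_pXn2r _ 2) ?nnegrE ?enorm_ge0 ?addr_ge0 // enorm_sqr.
rewrite sqrrD !real_normK ?num_real // lerD2r lerDl mulrn_wge0 // mulr_ge0 //.
Qed.

Lemma cis_dist (s t : R) : enorm (cis s - cis t) <= 2 * `|s - t|.
Proof.
apply: (le_trans (enorm_le_sum _)).
have c : `|cos s - cos t| <= `|s - t|.
  by apply: (@sub_le_of_derive _ (fun x => - sin x)) => x; rewrite normrN sin_max.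
have d : `|sin s - sin t| <= `|s - t|.
  by apply: (@sub_le_of_derive _ (@cos R)) => x; rewrite cos_max.
by rewrite mulr_natl mulr2n lerD.
Qed.

Lemma companion_dir_pos v w : primitive v -> gcd_solution v w -> 0 < lam R v w ->
  enorm (dir (vec R w) - dir (vec R v)) <= 4 / enorm (vec R v).
Proof.
move=> pv g /ltW l0; have [al [[/andP[a0 _] _ rot l1 _] _]] := companion_turn pv g.
have v1 := enorm_dir (lt_le_trans ltr01 (enorm_vec_ge1 pv)).
have [_ al2] := l1 l0; rewrite -{1}(cis_angle v1) (rot (angle (dir (vec R v)))) ?cis_angle //.
rewrite -{2}(cis_angle v1); apply: (le_trans (cis_dist _ _)).
rewrite addrAC subrr sub0r normrN gtr0_norm //.
rewrite [4%:R](natrM _ 2 2) -mulrA; exact: ler_wpM2l.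
Qed.

Lemma companion_dir_neg v w : primitive v -> gcd_solution v w -> lam R v w < 0 ->
  enorm (dir (vec R w) + dir (vec R v)) <= 4 / enorm (vec R v).
Proof.
move=> pv g l0; have [al [[/andP[_ ap] _ rot _ l2] _]] := companion_turn pv g.
have v1 := enorm_dir (lt_le_trans ltr01 (enorm_vec_ge1 pv)).
have [_ al2] := l2 l0; rewrite (rot (angle (dir (vec R v)))) ?cis_angle //.
rewrite -{2}(cis_angle v1) -[X in cis _ + cis X](subrK pi) cisDpi.
apply: (le_trans (cis_dist _ _)).
rewrite opprB addrC addrA subrK gtr0_norm ?subr_gt0 //.
rewrite [4%:R](natrM _ 2 2) -mulrA; exact: ler_wpM2l.
Qed.

End Companion.

(** * Equidistribution in sectors *)

Section PowerBounds.
Variable R : realType.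
Implicit Types r y : R.

Lemma rt4_ge1 r : 1 <= r -> 1 <= rt4 r.
Proof. by move=> r1; rewrite -(rt4_1 R) ler_rt4. Qed.

Lemma rt4_le_errf r j : 2 <= r -> (j <= 7)%N -> rt4 r ^+ j <= 2 * errf r.
Proof.
move=> r2 j7; have r0 : 0 <= r by lra.
have q1 : 1 <= rt4 r by apply: rt4_ge1; lra.
have l2 := ln_ge_half r2.
apply: (@le_trans _ _ (rt4 r ^+ 7)); first exact: ler_weXn2l.
have -> : errf r = rt4 r ^+ 7 * ln r by rewrite /errf -[7%N]/(4 + 3)%N exprD rt4X4.
have : 0 <= rt4 r ^+ 7 by rewrite exprn_ge0 ?rt4_ge0.
move: (rt4 r ^+ 7) (ln r) l2 => x y *; nra.
Qed.

Lemma size_disc_le y : 1 <= y -> (size (disc y))%:R <= 9 * y ^+ 2.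
Proof.
move=> y1; have y0 : 0 <= y by lra.
apply: (@le_trans _ _ ((2 * Num.truncn y).+1%:R ^+ 2)).
  rewrite -natrX ler_nat; apply: (leq_trans (size_subseq (filter_subseq _ _))).
  by rewrite size_allpairs !size_map size_iota mulnn.
have t : (2 * Num.truncn y).+1%:R <= 3 * y.
  rewrite -natr1 natrM; have := truncn_le y; rewrite y0; lra.
apply: (@le_trans _ _ ((3 * y) ^+ 2)).
  by rewrite ler_pXn2r ?nnegrE // mulr_ge0.
by rewrite exprMn -natrX.
Qed.

Lemma disc_small_count r y : 0 <= r -> 1 <= y ->
  \sum_(v <- disc r) (enorm (vec R v) <= y)%R%:R <= 9 * y ^+ 2 :> R.
Proof.
move=> r0 y1; have y0 : 0 <= y by lra.
apply: le_trans (size_disc_le y1).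
rewrite -natr_sum ler_nat big_seq.
rewrite [leqLHS](eq_bigr (fun v => if (enorm (vec R v) <= y)%R then 1%N else 0%N)); last by move=> v _; case: leP.
rewrite -big_mkcondr -big_filter sum1_size.
apply: uniq_leq_size; first by rewrite filter_uniq ?disc_uniq.
move=> v; rewrite mem_filter [v \in disc y]mem_disc // => /andP[/andP[vd ->] _].
by move: vd; rewrite mem_disc // => /andP[->].
Qed.

Lemma inv_enorm_split r y (v : int * int) : 0 < y -> primitive v ->
  (enorm (vec R v))^-1 <= (enorm (vec R v) <= y)%R%:R + y^-1.
Proof.
move=> y0 pv; have n1 := enorm_vec_ge1 R pv; have n0 := lt_le_trans ltr01 n1.
case: (leP (enorm (vec R v)) y) => [_|ny].
  by rewrite mulr1n (@le_trans _ _ 1) ?invf_le1 // lerDl invr_ge0 ltW.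
by rewrite add0r lef_pV2 ?posrE // ltW.
Qed.

(** Perturbing every value by [O(1 / |v|)] is thus harmless. The sum is split at norm [r^(3/4)]: the
    few short vectors contribute [O(r^(3/2))], the others [O(r^2 / r^(3/4))]. *)
Lemma sum_inv_enorm_le r : 2 <= r ->
  \sum_(v <- disc r) (enorm (vec R v))^-1 <= 36%:R * errf r.
Proof.
move=> r2; have r0 : 0 <= r by lra.
have r1 : 1 <= r by lra.
have q1 := rt4_ge1 r1; have q0 := lt_le_trans ltr01 q1.
set y := rt4 r ^+ 3; have y1 : 1 <= y by rewrite exprn_ege1.
have y0 := lt_le_trans ltr01 y1.
apply: (@le_trans _ _ (\sum_(v <- disc r) ((enorm (vec R v) <= y)%R%:R + y^-1))).
  rewrite big_seq [leRHS]big_seq; apply: ler_sum => v.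
  by rewrite mem_disc // => /andP[pv _]; exact: inv_enorm_split.
rewrite big_split /= big_const_seq count_predT iter_addr_0 -[_ *+ _]mulr_natr.
have h1 := disc_small_count r0 y1.
have h2 : y^-1 * (size (disc r))%:R <= 9 * rt4 r ^+ 5.
  rewrite ler_pdivrMl //; apply: (le_trans (size_disc_le r1)).
  by rewrite [leRHS]mulrCA /y -exprD -[(3 + 5)%N]/(4 * 2)%N exprM rt4X4.
have h3 : y ^+ 2 <= 2 * errf r by rewrite /y -exprM rt4_le_errf.
have h4 := @rt4_le_errf r 5 r2 isT.
by move: h1 h2 h3 h4; rewrite -/y; move: (errf r) => e *; lra.
Qed.

End PowerBounds.

Section RayCount.
Variables (R : realType) (w : int * int -> int * int).
Hypothesis shortest_w : forall v, primitive v -> shortest_solution R v (w v).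

Lemma in_arc_count (b d r : R) : 2 <= r -> 0 <= b <= 2 * pi -> 0 <= d <= 2 * pi ->
  \sum_(v <- disc r) (in_arc b (b + d) v)%:R <= 20000%:R * errf r + d * r ^+ 2.
Proof.
move=> r2 /andP[b0 b2] /andP[d0 d2]; have r0 : 0 <= r by lra.
have bd : b <= b + d by rewrite lerDl.
have bd2 : b + d <= b + 2 * pi by rewrite lerD2l.
pose I (x : R) := (- (1 / 2) <= x <= 1 / 2).
have hm : - (1 / 2) <= 1 / 2 :> R by lra.
have I1 x : - (1 / 2) < x < 1 / 2 -> I x by move=> /andP[? ?]; apply/andP; split; apply: ltW.
have := @arc_estimate_all R b (b + d) b0 b2 bd bd2 w shortest_w r _ _ I r2 (lexx _) hm (lexx _) I1 (fun x Ix => Ix).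
set S := \sum_(v <- _ | _) _.
have -> : S = \sum_(v <- disc r) (in_arc b (b + d) v)%:R.
  rewrite /S big_mkcond big_seq [RHS]big_seq; apply: eq_bigr => v.
  rewrite mem_disc // => /andP[pv _]; case: in_arc => //.
  by rewrite /I -ler_norml lam_le_half //; exact: shortest_w.
have n0 : (0 < Num.truncn r)%N by rewrite truncn_ge_nat //; lra.
have /andP[k0 k2] := kappa_bounds R n0.
rewrite addrAC subrr add0r ler_norml => /andP[_].
rewrite lerBlDr => h; apply: (le_trans h); rewrite lerD2l.
have : 0 <= d * r ^+ 2 by rewrite mulr_ge0 // sqr_ge0.
have -> : (1 / 2 - - (1 / 2)) = 1 :> R by lra.
rewrite mulr1 -!mulrA [_^-1 * _]mulrC mulrA; move: (d * r ^+ 2) (kappa _ _) k0 k2 => z k *; nra.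
Qed.

Lemma in_arc_dir (b c tau : R) v : primitive v -> dir (vec R v) = cis tau ->
  b <= tau < c -> in_arc b c v.
Proof.
move=> pv e tI; apply/asboolP; exists tau; split=> //; rewrite -e /dir scalerA.
by rewrite divff ?scale1r // gt_eqF // enorm_vec_gt0.
Qed.

(* Vectors of norm at most [r^(3/4)] are few; the others lie in a fixed sector
   of width [4 r^(-3/4)]. *)
Lemma near_ray_count (b r : R) (P : pred (int * int)) : 2 <= r -> 0 <= b <= 4 * pi ->
  (forall v, v \in disc r -> P v ->
     exists tau, dir (vec R v) = cis tau /\ `|tau - b| <= 2 / enorm (vec R v)) ->
  \sum_(v <- disc r) (P v)%:R <= 20026%:R * errf r.
Proof.
move=> r2 /andP[b0 b4] HP; have r0 : 0 <= r by lra.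
have r1 : 1 <= r by lra.
have q1 := rt4_ge1 r1; have q0 := lt_le_trans ltr01 q1.
set y := rt4 r ^+ 3; have y1 : 1 <= y by rewrite exprn_ege1.
have y0 := lt_le_trans ltr01 y1.
have yi : 0 < y^-1 <= 1 by rewrite invr_gt0 y0 invf_le1.
have pi2 := @pi_ge2 R.
(* The sector should start at [b - 2 / y], which may leave [[0, 2 pi]] on either side; a full turn
   is added or subtracted. *)
have [c [c0 c2 cE]] : exists c : R, [/\ 0 <= c, c <= 2 * pi &
    forall tau, exists tau', cis tau' = cis tau /\ tau' - c = tau - (b - 2 / y)].
  case: (ltP (b - 2 / y) 0) => h1; [|case: (leP (b - 2 / y) (2 * pi)) => h2].
  - exists (b - 2 / y + 2 * pi); split; last by move=> tau; exists (tau + 2 * pi); rewrite cisD2pi; split=> //; ring.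
      by move: yi b0 pi2; move: (y^-1) (pi : R) => z p /andP[*]; lra.
    by rewrite gerDr ltW.
  - exists (b - 2 / y); split=> // tau; by exists tau.
  - exists (b - 2 / y - 2 * pi); split; last by move=> tau; exists (tau - 2 * pi); split; [rewrite -cisD2pi subrK|ring].
      by rewrite subr_ge0 ltW.
    by move: yi b4 pi2; move: (y^-1) (pi : R) => z p /andP[*]; lra.
have d0 : 0 <= 4 / y <= 2 * pi.
  by move: yi pi2; move: (y^-1) (pi : R) => z p /andP[*]; apply/andP; split; lra.
apply: (@le_trans _ _ (\sum_(v <- disc r) ((enorm (vec R v) <= y)%R%:R + (in_arc c (c + 4 / y) v)%:R))).
  rewrite big_seq [leRHS]big_seq; apply: ler_sum => v vd.
  case: (boolP (P v)) => [Pv|_]; last by rewrite addr_ge0.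
  case: (leP (enorm (vec R v)) y) => [_|ny]; first by rewrite lerDl.
  have [tau [e tb]] := HP v vd Pv.
  have pv : primitive v by move: vd; rewrite mem_disc // => /andP[].
  have [tau' [e' te]] := cE tau.
  rewrite add0r (@in_arc_dir _ _ tau') ?e' //.
  have h : 2 / enorm (vec R v) < 2 / y by rewrite ltr_pM2l // ltf_pV2 ?posrE // (lt_trans y0).
  have : `|tau - b| < 2 / y by apply: le_lt_trans h.
  rewrite ltr_norml; move: te; have -> : 4 / y = 2 / y + 2 / y by lra.
  by move: (2 / y) => z te /andP[? ?]; apply/andP; split; lra.
have r2' : (4 / y) * r ^+ 2 = 4 * rt4 r ^+ 5.
  by rewrite -[X in _ * X ^+ 2](rt4X4 r0) /y; field; rewrite gt_eqF.
rewrite big_split /=.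
have h1 := disc_small_count r0 y1.
have h2 := in_arc_count r2 (_ : 0 <= c <= 2 * pi) d0; rewrite c0 c2 r2' in h2.
have h3 : y ^+ 2 <= 2 * errf r by rewrite /y -exprM rt4_le_errf.
have h4 := @rt4_le_errf R r 5 r2 isT.
(* Short vectors give [9 y^2 <= 18 errf r], and the area of the thin sector gives
   [4 r^(5/4) <= 8 errf r], together 26. *)
have -> : 20026%:R = 20000%:R + 26%:R :> R by rewrite -natrD.
by move: h1 h3 h4 (h2 isT); move: (20000%:R) (errf r) => K e *; lra.
Qed.

End RayCount.

(** The expected number of primitive vectors of norm at most [r] per unit of angle and per unit of
    [lam]. *)
Definition main_term (R : realType) (r : R) : R :=
  kappa R (Num.truncn r) / 2 * r ^+ 2.

(** One count for an arc, and two for its boundary rays. *)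
Definition sector_const (R : realType) : R := 2 * 20026%:R + 20000%:R.

Section SectorCount.
Variables (R : realType) (w : int * int -> int * int).
Hypothesis shortest_w : forall v, primitive v -> shortest_solution R v (w v).
Variables (b1 b2 : bool) (a l : R).
Hypotheses (a_itv : 0 <= a < 2 * pi) (l_itv : 0 < l <= 2 * pi).
Local Notation X := (arc b1 b2 a l).

Definition offset (v : int * int) : R := arc_param a (dir (vec R v)).

Definition in_sector (v : int * int) : bool := `[< X (dir (vec R v)) >].

Lemma enorm_dir_vec v : primitive v -> enorm (dir (vec R v)) = 1.
Proof. by move=> pv; rewrite enorm_dir // enorm_vec_gt0. Qed.

Lemma cis_offset v : primitive v -> cis (a + offset v) = dir (vec R v).
Proof. by move=> pv; rewrite cis_arc_param // enorm_dir_vec. Qed.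

Lemma offset_ge0 v : 0 <= offset v.
Proof. by have /andP[] := arc_param_range (dir (vec R v)) a_itv. Qed.

Lemma offset_le v : in_sector v -> offset v <= l.
Proof.
by move=> /asboolP; apply: arc_param_le => //; case/andP: l_itv => /ltW -> ->.
Qed.

Lemma in_sector_of_offset v : primitive v -> 0 < offset v < l -> in_sector v.
Proof. by move=> pv tv; apply/asboolP; apply: arc_of_param => //; exact: enorm_dir_vec. Qed.

Lemma offset_lt_in_arc v x : primitive v -> x <= 2 * pi ->
  in_arc a (a + x) v = (offset v < x).
Proof.
move=> pv x2; apply/idP/idP => [/asboolP[tau [/andP[t1 t2] e]]|tx].
  rewrite /offset (_ : dir _ = cis (a + (tau - a))).
    rewrite arc_param_cis //; first by rewrite ltrBlDl.
    by rewrite subr_ge0 t1 ltrBlDl (lt_le_trans t2) // lerD2l.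
  by rewrite subrKC /dir [X in _ *: X]e scalerA mulVf ?scale1r // gt_eqF // enorm_vec_gt0.
apply: (@in_arc_dir R a (a + x) (a + offset v) v pv (esym (cis_offset pv))).
by rewrite lerDl offset_ge0 ltrD2l.
Qed.

Lemma ray_start_count (r : R) : 2 <= r ->
  \sum_(v <- disc r) (offset v == 0)%R%:R <= 20026%:R * errf r.
Proof.
move=> r2; have r0 : 0 <= r by lra.
have /andP[a0 a2] := a_itv; have pi0 := @pi_gt0 R.
apply: (near_ray_count shortest_w (b := a)) => //.
  by rewrite a0 (le_trans (ltW a2)) // ler_pM2r // ler_nat.
move=> v vd /eqP t0; exists a; rewrite subrr normr0 divr_ge0 ?enorm_ge0 //; split=> //.
by rewrite -cis_offset ?t0 ?addr0 //; move: vd; rewrite mem_disc // => /andP[].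
Qed.

Lemma ray_end_count (r : R) : 2 <= r ->
  \sum_(v <- disc r) (offset v == l)%R%:R <= 20026%:R * errf r.
Proof.
move=> r2; have r0 : 0 <= r by lra.
have /andP[a0 a2] := a_itv; have /andP[l0 l2] := l_itv.
apply: (near_ray_count shortest_w (b := a + l)) => //.
  apply/andP; split; first by rewrite addr_ge0 // ltW.
  rewrite (_ : 4 * pi = 2 * pi + 2 * pi); last by rewrite -mulrDl -natrD.
  by rewrite lerD // ltW.
move=> v vd /eqP t0; exists (a + l); rewrite subrr normr0 divr_ge0 ?enorm_ge0 //; split=> //.
by rewrite -{1}t0 -cis_offset //; move: vd; rewrite mem_disc // => /andP[].
Qed.

Section OneRange.
Variables (r s t : R) (I : R -> bool).
Hypotheses (r2 : 2 <= r) (s0 : - (1 / 2) <= s) (st : s <= t) (t1 : t <= 1 / 2).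
Hypotheses (I1 : forall x, s < x < t -> I x) (I2 : forall x, I x -> s <= x <= t).

Let S := [seq v <- disc r | in_sector v && I (lam R v (w v))].

Lemma offset_level_count x : 0 <= x <= 2 * pi ->
  `|\sum_(v <- disc r) ((offset v < x)%R && I (lam R v (w v)))%:R
    - main_term r * (t - s) * x| <= 20000%:R * errf r.
Proof.
move=> /andP[x0 x2]; have /andP[a0 a2] := a_itv; have r0 : 0 <= r by apply: le_trans r2.
have := @arc_estimate_all R a (a + x) a0 (ltW a2) (_ : a <= a + x) (_ : a + x <= a + 2 * pi).
rewrite lerDl lerD2l => /(_ x0 x2) h.
have := h w shortest_w r s t I r2 s0 st t1 I1 I2.
set A := \sum_(v <- _ | _) _; set B := \sum_(v <- _) _; have -> : A = B.
  rewrite /A /B big_mkcond big_seq [RHS]big_seq; apply: eq_bigr => v.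
  by rewrite mem_disc // => /andP[pv _]; rewrite offset_lt_in_arc //; case: ltP.
by congr (`|_ - _| <= _); rewrite /main_term [a + x]addrC addrK; ring.
Qed.

Lemma sum_close_le (F G H : int * int -> R) (s' : seq (int * int)) :
  (forall v, v \in s' -> `|F v - G v| <= H v) ->
  `|\sum_(v <- s') F v - \sum_(v <- s') G v| <= \sum_(v <- s') H v.
Proof.
move=> h; rewrite -sumrB; apply: (le_trans (ler_norm_sum _ _ _)).
by rewrite big_seq [leRHS]big_seq; apply: ler_sum.
Qed.

(** For [x <= l] the half-open arc of [in_arc] and the given arc can differ only on the starting
    ray, where [offset] is 0; for the total count the end ray matters too. *)
Lemma sector_level_count x : 0 <= x <= l ->
  `|\sum_(v <- S) (offset v < x)%R%:R - main_term r * (t - s) * x| <= sector_const R * errf r.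
Proof.
move=> /andP[x0 xl]; have /andP[l0 l2] := l_itv; have r0 : 0 <= r by apply: le_trans r2.
have xp : 0 <= x <= 2 * pi by rewrite x0 (le_trans xl).
have h := offset_level_count xp; have h0 := ray_start_count r2.
have c0 : 0 <= 20026%:R :> R by rewrite ler0n.
rewrite /sector_const; move: (20026%:R : R) (20000%:R : R) c0 h h0 => c d c0 h h0.
rewrite big_filter big_mkcond /=.
set A := \sum_(v <- _) _; set B := \sum_(v <- _) _ in h.
have AB : `|A - B| <= \sum_(v <- disc r) (offset v == 0)%R%:R.
  apply: sum_close_le => v; rewrite mem_disc // => /andP[pv _].
  have := offset_ge0 v; rewrite le_eqVlt eq_sym => /orP[e|t0].
    by rewrite e; case: in_sector; case: (I _) => /=; case: ltP => _ /=; rewrite ?subrr ?subr0 ?normr0 ?sub0r ?normrN ?normr1.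
  rewrite gt_eqF //; case: (ltP (offset v) x) => [tx|_]; last by rewrite if_same subrr normr0.
  by rewrite in_sector_of_offset ?t0 ?(lt_le_trans tx) //=; case: (I _); rewrite /= subrr normr0.
have e0 : 0 <= errf r by apply: errf_ge0; apply: le_trans r2; rewrite ler1n.
apply: (@le_trans _ _ (`|A - B| + `|B - main_term r * (t - s) * x|)).
  by apply: le_trans (ler_normD _ _); rewrite addrA subrK.
apply: (le_trans (lerD (le_trans AB h0) h)); rewrite -mulrDl.
by apply: ler_wpM2r => //; lra.
Qed.

Lemma sector_size_count :
  `|(size S)%:R - main_term r * (t - s) * l| <= sector_const R * errf r.
Proof.
have /andP[l0 l2] := l_itv; have r0 : 0 <= r by apply: le_trans r2.
have lp : 0 <= l <= 2 * pi by rewrite l2 ltW.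
have h := offset_level_count lp; have h0 := ray_start_count r2; have h1 := ray_end_count r2.
rewrite /sector_const; move: (20026%:R : R) (20000%:R : R) h h0 h1 => c d h h0 h1.
rewrite -sum1_size natr_sum big_filter big_mkcond /=.
set A := \sum_(v <- _) _; set B := \sum_(v <- _) _ in h.
have AB : `|A - B| <= \sum_(v <- disc r) ((offset v == 0)%R%:R + (offset v == l)%R%:R).
  apply: sum_close_le => v; rewrite mem_disc // => /andP[pv _].
  have := offset_ge0 v; rewrite le_eqVlt eq_sym => /orP[e|t0].
    apply: (@le_trans _ _ 1); last by rewrite e lerDl.
    by case: in_sector; case: (I _) => /=; case: ltP => _ /=; rewrite ?subrr ?subr0 ?normr0 ?sub0r ?normrN ?normr1.
  rewrite (gt_eqF t0) add0r.
  case: (ltgtP (offset v) l) => [tx|tx|_].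
  - by rewrite in_sector_of_offset ?t0 ?tx //=; case: (I _); rewrite /= subrr normr0.
  - case: (boolP (in_sector v)) => [/offset_le|_]; first by rewrite leNgt tx.
    by rewrite /= subrr normr0.
  - by case: in_sector; case: (I _) => /=; rewrite ?subrr ?subr0 ?normr0 ?normr1.
have e0 : 0 <= errf r by apply: errf_ge0; apply: le_trans r2; rewrite ler1n.
apply: (@le_trans _ _ (`|A - B| + `|B - main_term r * (t - s) * l|)).
  by apply: le_trans (ler_normD _ _); rewrite addrA subrK.
rewrite big_split /= in AB.
apply: (le_trans (lerD (le_trans AB (lerD h0 h1)) h)); rewrite -!mulrDl.
by rewrite mulr_natl mulr2n.
Qed.

End OneRange.

End SectorCount.

(** * From asymptotic sums to averages with a rate *)

Section Rate.
Variable R : realType.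
Implicit Types r : R.

Definition rate r : R := r `^ (- (1 / 4)) * ln r.

Lemma powR_quarter r : 0 <= r -> r `^ (- (1 / 4)) = (rt4 r)^-1.
Proof.
move=> r0; rewrite powRN; congr (_^-1).
rewrite (_ : 1 / 4 = 2^-1 * 2^-1); last by rewrite -invfM -natrM mul1r.
by rewrite powRrM !powR12_sqrt ?sqrtr_ge0.
Qed.

Lemma errf_rate r : 0 < r -> errf r = r ^+ 2 * rate r.
Proof.
move=> r0; have q0 := rt4_gt0 r0.
rewrite /errf /rate powR_quarter ?(ltW r0) //.
have e := rt4X4 (ltW r0).
have -> : r * rt4 r ^+ 3 * ln r = rt4 r ^+ 4 * rt4 r ^+ 3 * ln r by rewrite e.
have -> : r ^+ 2 = (rt4 r ^+ 4) ^+ 2 by rewrite e.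
by move: (ln r) => y; field; rewrite gt_eqF.
Qed.

(** Writing [p = r^(1/8)], one has [ln r <= 8 p] against [r^(1/4) = p^2]. This serves to keep the
    number of vectors, the denominator of the averages, of order [r^2]. *)
Lemma rate_small (e : R) : 0 < e -> exists2 R0 : R, 2 <= R0 &
  forall r, R0 <= r -> errf r <= e * r ^+ 2.
Proof.
move=> e0; pose M := (8 / e) ^+ 8; have M0 : 0 <= M by rewrite exprn_ge0 // divr_ge0 // ltW.
exists (M + 2); first by rewrite lerDr.
move=> r rM; have r0 : 0 < r by apply: lt_le_trans rM; lra.
have q0 := rt4_gt0 r0; set p := Num.sqrt (rt4 r).
have p0 : 0 < p by rewrite sqrtr_gt0.
have p2 : p ^+ 2 = rt4 r by rewrite sqr_sqrtr // ltW.
have p8 : p ^+ 8 = r by rewrite -(rt4X4 (ltW r0)) -p2 -exprM.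
have lp : ln r <= 8 * p.
  rewrite -{1}p8 lnXn // -[ln p *+ 8]mulr_natl; apply: ler_wpM2l => //.
  by apply: ltW; exact: ln_sublinear.
have pe : 8 / e <= p.
  rewrite -(@ler_pXn2r _ 8) ?nnegrE ?divr_ge0 ?(ltW e0) ?(ltW p0) //.
  by rewrite p8; apply: le_trans rM; rewrite lerDl.
rewrite errf_rate // mulrC; apply: ler_wpM2r; first exact: sqr_ge0.
rewrite /rate powR_quarter ?(ltW r0) // ler_pdivrMl // -p2.
apply: (le_trans lp); move: pe; rewrite ler_pdivrMr // => pe.
by rewrite expr2 -mulrA [leRHS]mulrC; apply: ler_wpM2r => //; exact: ltW.
Qed.

Lemma perm_truncation (V : set (int * int)) r : 0 <= r ->
  (forall v, V v -> primitive v) ->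
  perm_eq (fset_set (truncation V r)) [seq v <- disc r | `[< V v >]].
Proof.
move=> r0 Vp.
have fin : finite_set (truncation V r).
  apply: (@sub_finite_set _ _ [set` disc r]); last exact: finite_seq.
  by move=> v [/Vp pv nv]; rewrite /= mem_disc // pv.
apply: uniq_perm; [exact: fset_uniq|by apply: filter_uniq; exact: disc_uniq|move=> v].
rewrite in_fset_set // mem_filter mem_disc //; apply/idP/idP.
  by rewrite inE => -[Vv nv]; rewrite nv andbT (Vp _ Vv) andbT; apply/asboolP.
by move=> /andP[/asboolP Vv /andP[_ nv]]; rewrite inE.
Qed.

Lemma main_term_bounds r : 2 <= r -> r ^+ 2 / 8 <= main_term r.
Proof.
move=> r2; have n0 : (0 < Num.truncn r)%N by rewrite truncn_ge_nat //; lra.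
have /andP[k0 _] := kappa_bounds R n0; have := sqr_ge0 r.
by rewrite /main_term; move: (r ^+ 2) (kappa _ _) k0 => z k *; nra.
Qed.

(** The coefficient [c] is relative to [main_term], so the limit of an average is a quotient of two
    coefficients. *)
Definition sum_asymptotic (T : Type) (V : set (int * int)) (x : int * int -> T) (f : T -> R)
    (c : R) : Prop :=
  exists C : R, forall r, 2 <= r ->
    `|\sum_(v <- disc r | `[< V v >]) f (x v) - main_term r * c| <= C * errf r.

(** With sum [A], count [N] and main term [M], the deviation is
    [((A - M J) l - J (N - M l)) / (N l)]: the main terms cancel exactly, although [M / r^2] varies
    with [r]. *)
Lemma equidistributed_of_sums (T : topologicalType) (dist : T -> T -> R) (Y : set T)
    (lambda : (T -> R) -> R) (V : set (int * int)) (x : int * int -> T) (l : R)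
    (J : (T -> R) -> R) :
  (forall v, V v -> primitive v) -> 0 < l ->
  sum_asymptotic V x (fun=> 1) l ->
  (forall f, lipschitz_wrt dist Y f -> lambda f = J f / l /\ sum_asymptotic V x f (J f)) ->
  effectively_equidistributed dist Y lambda V x rate.
Proof.
move=> Vp l0 [C1 size1] sums f lipf _; have [-> [C2 sumf]] := sums f lipf.
pose D := `|C1| + 1; have D0 : 0 < D by rewrite ltr_wpDl.
(* With this threshold the error in the count is at most half of the lower bound [l r^2 / 8] of its
   main term. *)
have e0 : 0 < l / (16 * D) by rewrite divr_gt0 // mulr_gt0.
have [R0 R02 small] := rate_small e0.
pose C := 16 * (`|C2| * l + `|J f| * D) / l ^+ 2.
have C0 : 0 <= C by rewrite divr_ge0 ?sqr_ge0 // mulr_ge0 // addr_ge0 ?mulr_ge0 ?(ltW l0) ?(ltW D0).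
exists (C + 1), R0; split; first by rewrite ltr_wpDl.
split; first by apply: lt_le_trans R02.
move=> r rR; have r2 := le_trans R02 rR; have r0 : 0 < r by lra.
have pe := perm_truncation (ltW r0) Vp.
rewrite (perm_big _ pe) /= big_filter.
have -> : (#|` fset_set (truncation V r)|%fset%:R : R) = \sum_(v <- disc r | `[< V v >]) 1.
  by rewrite (perm_size pe) -sum1_size natr_sum big_filter.
have := size1 r r2; have := sumf r r2; have := small r rR.
have m8 := main_term_bounds r2.
have E0 : 0 <= errf r by apply: errf_ge0; lra.
have rE := errf_rate r0.
move: (\sum_(v <- _ | _) 1) (\sum_(v <- _ | _) _) (main_term r) m8 => N A M m8 eE hA hN.
have r20 : 0 < r ^+ 2 by rewrite exprn_gt0.
set E := errf r in E0 rE eE hA hN.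
have hN' : `|N - M * l| <= D * E.
  by apply: (le_trans hN); apply: ler_wpM2r => //; rewrite (le_trans (ler_norm _)) // lerDl.
have hA' : `|A - M * J f| <= `|C2| * E.
  by apply: (le_trans hA); apply: ler_wpM2r => //; exact: ler_norm.
have DE : D * E <= l * r ^+ 2 / 16.
  have -> : l * r ^+ 2 / 16 = D * (l / (16 * D) * r ^+ 2) by field; rewrite gt_eqF.
  exact: ler_wpM2l (ltW D0) _ _ eE.
have Nlow : l * r ^+ 2 / 16 <= N.
  move: hN'; rewrite ler_norml => /andP[h _].
  have : l * (r ^+ 2 / 8) <= l * M by exact: ler_wpM2l (ltW l0) _ _ m8.
  by move: h DE; rewrite [M * l]mulrC; move: (r ^+ 2) (D * E) (l * M) => z d m *; lra.
have N0 : 0 < N by apply: lt_le_trans Nlow; rewrite divr_gt0 // mulr_gt0.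
have -> : N^-1 * A - J f / l = ((A - M * J f) * l - J f * (N - M * l)) / (N * l).
  by field; rewrite !gt_eqF.
rewrite normrM [X in _ * X]gtr0_norm ?invr_gt0 ?mulr_gt0 // ler_pdivrMr ?mulr_gt0 //.
have num : `|(A - M * J f) * l - J f * (N - M * l)| <= (`|C2| * l + `|J f| * D) * E.
  apply: (le_trans (ler_normB _ _)); rewrite !normrM (gtr0_norm l0) mulrDl.
  apply: lerD; first by rewrite mulrAC; apply: ler_wpM2r => //; exact: ltW.
  by rewrite -mulrA; exact: ler_wpM2l.
apply: (le_trans num).
have -> : rate r = E / r ^+ 2 by rewrite rE mulrC mulKf // gt_eqF.
apply: (@le_trans _ _ (C * (E / r ^+ 2) * (l * r ^+ 2 / 16 * l))).
  rewrite le_eqVlt; apply/orP; left; apply/eqP; rewrite /C; field.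
  by rewrite !gt_eqF.
have q0 : 0 <= E / r ^+ 2 by rewrite divr_ge0 // ltW.
apply: ler_pM.
- exact: mulr_ge0.
- by rewrite mulr_ge0 ?(ltW l0) // divr_ge0 // mulr_ge0 ?ltW.
- by apply: ler_wpM2r => //; rewrite lerDl.
by apply: ler_wpM2r => //; exact: ltW.
Qed.

End Rate.

Section SectorSums.
Variables (R : realType) (w : int * int -> int * int).
Hypothesis shortest_w : forall v, primitive v -> shortest_solution R v (w v).
Variables (b1 b2 : bool) (a l : R).
Hypotheses (a_itv : 0 <= a < 2 * pi) (l_itv : 0 < l <= 2 * pi).
Variables (s t : R) (I : R -> bool).
Hypotheses (sE : s = 0 \/ s = - (1 / 2)) (tE : t = 0 \/ t = 1 / 2) (st : s <= t).
Hypotheses (I1 : forall x, s < x < t -> I x) (I2 : forall x, I x -> s <= x <= t).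
Local Notation sel := (fun v => in_sector b1 b2 a l v && I (lam R v (w v))).

Let s0 : - (1 / 2) <= s. Proof. by case: sE => ->; lra. Qed.
Let t1 : t <= 1 / 2. Proof. by case: tE => ->; lra. Qed.

Lemma lip_cis (f : R * R -> R) (L c : R) :
  (forall y z, circle y -> circle z -> `|f y - f z| <= L * enorm (y - z)) ->
  forall x y, `|f (cis (c + x)) - f (cis (c + y))| <= (2 * `|L|) * `|x - y|.
Proof.
move=> lip x y; apply: le_trans (lip _ _ (enorm_cis _) (enorm_cis _)) _.
apply: (@le_trans _ _ (`|L| * enorm (cis (c + x) - cis (c + y)))).
  by apply: ler_wpM2r; [exact: enorm_ge0|exact: ler_norm].
rewrite mulrAC mulrC; apply: ler_wpM2r => //.
apply: le_trans (cis_dist _ _) _.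
by rewrite opprD addrACA subrr add0r.
Qed.

(** Offsets are measured from [a] but the test function is read from [c]: with [c = a] this concerns
    the directions of [v], with [c] opposite to [a] their opposites, and one count serves both. *)
Lemma circle_sum (f : R * R -> R) (c : R) : 0 <= c < 2 * pi ->
  lipschitz_wrt (fun y z : R * R => enorm (y - z)) (@circle R) f ->
  exists C : R, forall r, 2 <= r ->
    `|\sum_(v <- disc r | sel v) f (cis (c + offset a v))
      - main_term r * ((t - s) * \int[@arc_length R]_(u in arc b1 b2 c l) f u)|
    <= C * errf r.
Proof.
move=> cp [L lip]; have /andP[l0 l2] := l_itv.
have lp : 0 <= l <= 2 * pi by rewrite ltW.
exists ((`|f (cis (c + l))| + 2 * `|L| * l) * sector_const R) => r r2.
have r0 : 0 <= r by lra.
rewrite -[leRHS]mulrA [main_term r * _]mulrA -big_filter.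
rewrite (@eq_Rintegral _ _ _ _ _ (fun u => f (cis (c + arc_param c u)))); last first.
  by move=> u /[!inE] /arc_circle u1; rewrite cis_arc_param.
apply: (@equidistribution_by_counts R _ _ (offset a) _ _ _ _ (arc_param c) (fun x => f (cis (c + x)))) => //.
- exact: lip_cis.
- exact: measurable_arc.
- exact: measurable_arc_param.
- by move=> u Xu; rewrite (arc_param_le cp lp Xu) andbT; have /andP[] := arc_param_range u cp.
- exact: arc_lengthP.
- by move=> x xl; exact: arc_length_level.
- apply/allP => v; rewrite mem_filter => /andP[/andP[sv _] _].
  by rewrite offset_ge0 // (offset_le _ _ sv).
- exact: sector_size_count.
- by move=> x xl; exact: sector_level_count.
Qed.

Lemma abs_range (x y : R) : 0 <= y <= 1 / 2 ->
  (2 * s * y < x < 2 * t * y -> I x && (`|x| < y)%R) /\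
  (I x && (`|x| < y)%R -> 2 * s * y <= x <= 2 * t * y).
Proof.
move=> /andP[y0 y1]; split=> [/andP[h1 h2]|/andP[/I2/andP[i1 i2]]]; last first.
  rewrite ltr_norml => /andP[n1 n2].
  by apply/andP; split; [case: sE i1 => -> i1|case: tE i2 => -> i2]; lra.
rewrite I1 /=; last first.
  by apply/andP; split; [case: sE h1 => -> h1|case: tE h2 => -> h2]; lra.
by rewrite ltr_norml; apply/andP; split; [case: sE h1 => -> h1|case: tE h2 => -> h2]; lra.
Qed.

Lemma line_sum (f : R -> R) : lipschitz_wrt (fun y z : R => `|y - z|) [set: R] f ->
  exists C : R, forall r, 2 <= r ->
    `|\sum_(v <- disc r | sel v) f `|lam R v (w v)|
      - main_term r * (2 * (t - s) * l * \int[@lebesgue_measure R]_(x in `[0, 1 / 2]) f x)|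
    <= C * errf r.
Proof.
move=> [L lip]; have /andP[l0 l2] := l_itv.
exists ((`|f (1 / 2)| + L * (1 / 2)) * sector_const R) => r r2.
have r0 : 0 <= r by lra.
have h2 : 0 < 1 / 2 :> R by lra.
have abs_lam v : v \in [seq v <- disc r | sel v] -> `|lam R v (w v)| <= 1 / 2.
  rewrite mem_filter mem_disc // => /andP[_ /andP[pv _]].
  by apply: lam_le_half => //; exact: shortest_w.
rewrite -[leRHS]mulrA [main_term r * _]mulrA -big_filter.
have h := @equidistribution_by_counts R _ [seq v <- disc r | sel v]
  (fun v => `|lam R v (w v)|) _ _ (@lebesgue_measure R) (`[0, 1 / 2]%classic)
  (fun x => x) f L (1 / 2) (main_term r * (2 * (t - s) * l)) (sector_const R * errf r).
apply: h => //.
- by move=> x y; exact: lip.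
- by rewrite [LHS]lebesgue_measure_itv /= lte_fin h2 -EFinB subr0.
- move=> x /andP[x0 x2].
  have -> : `[0, 1 / 2] `&` [set u | u < x] = `[0, x[%classic.
    apply/seteqP; split => u /=; rewrite !in_itv /=.
      by move=> [/andP[-> _] ->].
    by move=> /andP[-> ux]; rewrite ux (le_trans (ltW ux)).
  rewrite [LHS]lebesgue_measure_itv /= lte_fin; case: ltP => [_|]; first by rewrite -EFinB subr0.
  by move=> x0'; congr _%:E; apply/eqP; rewrite eq_le x0 x0'.
- by apply/allP => v /abs_lam ->; rewrite normr_ge0.
- have := sector_size_count shortest_w b1 b2 a_itv l_itv r2 s0 st t1 I1 I2.
  by congr (`|_ - _| <= _); rewrite /=; field.
move=> y y2; have /andP[y0 y1] := y2.
have s0' : - (1 / 2) <= 2 * s * y by case: sE => ->; lra.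
have t1' : 2 * t * y <= 1 / 2 by case: tE => ->; lra.
have st' : 2 * s * y <= 2 * t * y by apply: ler_wpM2r => //; apply: ler_wpM2l.
have := sector_size_count shortest_w b1 b2 a_itv l_itv r2 s0' st' t1'
  (fun x => (abs_range x y2).1) (fun x => (abs_range x y2).2).
rewrite -sum1_size natr_sum [X in `|X - _|]big_filter [X in _ -> `|X - _| <= _]big_filter.
rewrite big_mkcond [X in _ -> `|X - _| <= _]big_mkcond /=.
congr (`|_ - _| <= _); last by ring.
by apply: eq_bigr => v _; case: in_sector; case: (I _); case: ltP.
Qed.

End SectorSums.

Section ArcFacts.
Variable R : realType.
Implicit Types (u : R * R) (a l x : R).

Lemma arcE b1 b2 a l : arc b1 b2 a l =
  (fun x => cis (a + x)) @` [set` Interval (BSide b1 0) (BSide b2 l)].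
Proof.
apply/seteqP; split => u [x] /=; rewrite in_itv /= => h <-.
  exists (x - a); last by rewrite subrKC.
  rewrite /= in_itv /=; move: h; case: b1; case: b2; rewrite /= => /andP[h1 h2];
    by apply/andP; split; lra.
exists (a + x) => //.
rewrite /= in_itv /=; move: h; case: b1; case: b2; rewrite /= => /andP[h1 h2];
  by apply/andP; split; lra.
Qed.

Lemma base_exists u : enorm u = 1 -> exists2 c : R, 0 <= c < 2 * pi & cis c = u.
Proof. by move=> u1; exists (angle_pos u); [exact: angle_pos_range|exact: cis_angle_pos]. Qed.

Lemma cis_add_congr (a c x : R) : cis a = cis c -> cis (a + x) = cis (c + x).
Proof. by rewrite /cis => -[e1 e2]; rewrite !cosD !sinD e1 e2. Qed.

Lemma is_arc_normal (Theta : set (R * R)) : is_arc Theta -> (0 < arc_length Theta)%E ->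
  exists a l b1 b2, [/\ 0 <= a < 2 * pi, 0 < l <= 2 * pi & Theta = arc b1 b2 a l].
Proof.
move=> [a' [l [b1 [b2 [lp TE]]]]] T0.
have [a ap ae] := base_exists (enorm_cis a').
have TE' : Theta = arc b1 b2 a l.
  rewrite TE -/(arc b1 b2 a' l) !arcE; congr image; apply/funext => x.
  exact: cis_add_congr.
exists a, l, b1, b2; split=> //; have /andP[l0 ->] := lp.
rewrite andbT lt_neqAle l0 andbT; apply/eqP => le0.
by move: T0; rewrite TE' arc_lengthP // -le0 ltxx.
Qed.

Lemma opposite_base a : exists2 c : R, 0 <= c < 2 * pi & forall x, cis (c + x) = - cis (a + x).
Proof.
have [c cp ce] := base_exists (enorm_cis (a + pi)); exists c => // x.
by rewrite (cis_add_congr x ce) addrAC cisDpi.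
Qed.

Lemma opp_setE (A : set (R * R)) u : opp_set A u <-> A (- u).
Proof.
by split=> [[z Az <-]|Au]; [rewrite opprK|exists (- u); rewrite ?opprK].
Qed.

Lemma opp_arc b1 b2 a c l : (forall x, cis (c + x) = - cis (a + x)) ->
  opp_set (arc b1 b2 a l) = arc b1 b2 c l.
Proof.
move=> e; rewrite !arcE; apply/seteqP; split => u /=.
  by move=> [z [x xI <-] <-]; exists x.
by move=> [x xI <-]; rewrite e; apply/opp_setE; rewrite opprK; exists x.
Qed.

(** The opposite point has offset [x + pi], which exceeds [l] as soon as [l <= pi]. *)
Lemma arc_interior b1 b2 a l x : 0 <= a < 2 * pi -> l <= pi -> 0 < x < l ->
  arc b1 b2 a l (cis (a + x)) /\ ~ arc b1 b2 a l (- cis (a + x)).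
Proof.
move=> ap lpi /andP[x0 xl]; have pi0 := @pi_gt0 R.
have xpi : x < pi by apply: lt_le_trans lpi.
have pi2 : pi < 2 * pi :> R by rewrite ltr_pMl // ltr1n.
have x2 : 0 <= x < 2 * pi by rewrite ltW //= (lt_trans xpi).
split.
  by apply: arc_of_param => //; [exact: enorm_cis|rewrite arc_param_cis // x0].
rewrite -cisDpi -addrA => /(arc_param_le ap) h; have {}h : arc_param a (cis (a + (x + pi))) <= l.
  by apply: h; rewrite (le_trans (ltW x0) (ltW xl)) (le_trans lpi) // ltW.
move: h; rewrite arc_param_cis //.
  by rewrite leNgt (le_lt_trans lpi) // ltrDr.
by rewrite addr_ge0 ?ltW //= mulr_natl mulr2n ltrD2r.
Qed.

Lemma arc_length_point u : enorm u = 1 -> arc_length [set u] = 0%E.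
Proof.
move=> /base_exists[c cp <-].
have p0 : (0 : R) <= 0 <= 2 * (pi : R) by rewrite lexx mulr_ge0 ?pi_ge0.
rewrite -[RHS](arc_lengthP true false cp p0); congr arc_length.
apply/seteqP; split => z /=.
  by move=> ->; exists c => //; rewrite /= addr0 in_itv /= lexx.
by move=> [x]; rewrite /= addr0 in_itv /= => /le_anti -> .
Qed.

(** Only the two ends of the arc can belong to its opposite as well. *)
Lemma arc_opp_overlap b1 b2 a l : 0 <= a < 2 * pi -> 0 < l -> l <= pi ->
  arc_length (arc b1 b2 a l `&` opp_set (arc b1 b2 a l)) = 0%E.
Proof.
move=> ap l0 lpi; have [c cp ce] := opposite_base a.
have l2 : 0 <= l <= 2 * pi.
  by rewrite ltW //= (le_trans lpi) // ler_peMl ?pi_ge0 // ler1n.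
rewrite (opp_arc _ _ _ ce).
have mN : measurable (arc b1 b2 a l `&` arc b1 b2 c l) by apply: measurableI; exact: measurable_arc.
apply/eqP; rewrite eq_le measure_ge0 andbT.
set p1 := cis a; set p2 := cis (a + l).
apply: (@le_trans _ _ (arc_length ([set p1] `|` [set p2]))).
  apply: le_measure; rewrite ?inE //.
    by apply: measurableU; exact: measurable_plane_set1.
  move=> u [Au]; rewrite -(opp_arc _ _ _ ce) => /opp_setE Bu.
  have u1 := arc_circle Au; have := arc_param_le ap l2 Au.
  move=> tl; have /andP[t0 _] := arc_param_range u ap; have uE := cis_arc_param a u1.
  move: t0; rewrite le_eqVlt => /orP[/eqP t0|t0].
    by left; rewrite /= -uE -t0 addr0.
  move: tl; rewrite le_eqVlt => /orP[/eqP tl|tl]; first by right; rewrite /= -uE tl.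
  have [_] := @arc_interior b1 b2 a l (arc_param a u) ap lpi (introT andP (conj t0 tl)).
  by rewrite cis_arc_param.
rewrite (@le_trans _ _ (arc_length [set p1] + arc_length [set p2])%E) //.
  by apply: measureU2; exact: measurable_plane_set1.
by rewrite !arc_length_point ?enorm_cis // adde0.
Qed.

End ArcFacts.

Lemma Rintegral_setU_null (d : measure_display) (T : measurableType d) (R : realType)
    (mu : {measure set T -> \bar R}) (A B : set T) (f : T -> R) :
  measurable A -> measurable B -> mu.-integrable (A `|` B) (EFin \o f) ->
  mu (A `&` B) = 0%E ->
  \int[mu]_(x in A `|` B) f x = \int[mu]_(x in A) f x + \int[mu]_(x in B) f x.
Proof.
move=> mA mB intf AB0.
have mBA := measurableD mB mA; have mI := measurableI _ _ mA mB.
have iB : mu.-integrable B (EFin \o f) by apply: (integrableS (measurableU _ _ mA mB) mB _ intf) => x; right.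
have -> : A `|` B = A `|` (B `\` A) by apply/seteqP; split => x; [move=> [Ax|Bx]; [left|have [Ax|nA] := pselect (A x); [left|right]]|move=> [Ax|[Bx _]]; [left|right]].
have BE : B = (B `\` A) `|` (A `&` B) by apply/seteqP; split => x; [move=> Bx; have [Ax|nA] := pselect (A x); [right|left]|move=> [[]|[]]].
rewrite Rintegral_setU //; first last.
- by apply/disj_setPS => x [Ax [_]].
- apply: (integrableS (measurableU _ _ mA mB) (measurableU _ _ mA mBA) _ intf).
  by move=> x [Ax|[Bx _]]; [left|right].
congr (_ + _); rewrite [in RHS]BE Rintegral_setU -?BE //; last first.
  by apply/disj_setPS => x [[_ nA] []].
rewrite [X in _ + X](_ : _ = 0) ?addr0 // /Rintegral null_set_integral //.
by apply: measurable_funS (measurable_int _ iB) => // x [].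
Qed.

(** * Stability of asymptotic sums *)

Section Perturbation.
Variable R : realType.
Implicit Types (V W : set (int * int)) (c : R).

Lemma sum_asymptotic_perturb (T T' : Type) V (x : int * int -> T) (f : T -> R)
    (x' : int * int -> T') (f' : T' -> R) (K c : R) : 0 <= K ->
  (forall v, primitive v -> V v -> `|f' (x' v) - f (x v)| <= K / enorm (vec R v)) ->
  sum_asymptotic V x f c -> sum_asymptotic V x' f' c.
Proof.
move=> K0 close [C h]; exists (K * 36%:R + C) => r r2; have r0 : 0 <= r by lra.
have := h r r2; rewrite !(big_mkcond (fun v => `[< V v >])) /=.
set A := \sum_(v <- _) _; set B := \sum_(v <- _) _ => hA.
have BA : `|B - A| <= K * (36%:R * errf r).
  apply: (@le_trans _ _ (\sum_(v <- disc r) K * (enorm (vec R v))^-1)); last first.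
    by rewrite -mulr_sumr; apply: ler_wpM2l => //; exact: sum_inv_enorm_le.
  apply: sum_close_le => v; rewrite mem_disc // => /andP[pv _].
  case: asboolP => [Vv|_]; first exact: close.
  by rewrite subrr normr0 mulr_ge0 ?invr_ge0 ?enorm_ge0.
rewrite mulrDl -mulrA; apply: (le_trans _ (lerD BA hA)).
by apply: le_trans (ler_normD _ _); rewrite addrA subrK.
Qed.

(** For a bounded test function, [O(errf r)] exceptional vectors may enter or leave the class
    without changing the coefficient. *)
Lemma sum_asymptotic_change (T : Type) V W (x : int * int -> T) (f : T -> R)
    (Bd : R -> pred (int * int)) (B K c : R) : 0 <= B ->
  (forall v, primitive v -> `|f (x v)| <= B) ->
  (forall r, 2 <= r -> \sum_(v <- disc r) (Bd r v)%:R <= K * errf r) ->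
  (forall r v, v \in disc r -> ~~ Bd r v -> V v <-> W v) ->
  sum_asymptotic V x f c -> sum_asymptotic W x f c.
Proof.
move=> B0 fB bad VW [C h]; exists (B * K + C) => r r2; have r0 : 0 <= r by lra.
have := h r r2; rewrite !(big_mkcond (fun v => `[< _ v >])) /=.
set A := \sum_(v <- _) _; set D := \sum_(v <- _) _ => hA.
have DA : `|D - A| <= B * (K * errf r).
  apply: (@le_trans _ _ (\sum_(v <- disc r) B * (Bd r v)%:R)); last first.
    by rewrite -mulr_sumr; apply: ler_wpM2l => //; exact: bad.
  apply: sum_close_le => v vd.
  have pv : primitive v by move: vd; rewrite mem_disc // => /andP[].
  case: (boolP (Bd r v)) => [_|/(VW _ _ vd) e]; last first.
    have -> : `[< V v >] = `[< W v >] by apply: asbool_equiv_eq.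
    by rewrite mulr0 subrr normr0.
  rewrite mulr1; case: asboolP => _; case: asboolP => _;
    by rewrite ?subrr ?subr0 ?sub0r ?normrN ?normr0 // fB.
rewrite mulrDl -mulrA; apply: (le_trans _ (lerD DA hA)).
by apply: le_trans (ler_normD _ _); rewrite addrA subrK.
Qed.

Lemma sum_asymptotic_union (T : Type) V W (x : int * int -> T) (f : T -> R) (c c' : R) :
  (forall v, V v -> ~ W v) ->
  sum_asymptotic V x f c -> sum_asymptotic W x f c' ->
  sum_asymptotic (V `|` W) x f (c + c').
Proof.
move=> dis [C h] [C' h']; exists (C + C') => r r2.
have := h r r2; have := h' r r2; rewrite !(big_mkcond (fun v => `[< _ v >])) /=.
set D := \sum_(v <- _) _; set E := \sum_(v <- _) _; set A := \sum_(v <- _) _ => hD hE.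
have -> : A = E + D.
  rewrite -big_split; apply: eq_bigr => v _ /=.
  case: (asboolP (V v)) => [Vv|nV].
    rewrite (asboolF (dis _ Vv)) addr0.
    by rewrite asboolT //; left.
  case: (asboolP (W v)) => [Wv|nW]; first by rewrite add0r asboolT //; right.
  by rewrite addr0 asboolF // => -[].
rewrite mulrDl mulrDr opprD addrACA; apply: le_trans (ler_normD _ _) _.
exact: lerD.
Qed.

Lemma lipschitz_circle_bound (f : R * R -> R) :
  lipschitz_wrt (fun y z : R * R => enorm (y - z)) (@circle R) f ->
  exists2 B : R, 0 <= B & forall u, enorm u = 1 -> `|f u| <= B.
Proof.
move=> [L lip]; exists (`|f (cis 0)| + `|L| * 4); first by rewrite addr_ge0 ?mulr_ge0.
move=> u u1; have h := lip _ _ u1 (enorm_cis 0).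
rewrite -[f u](subrK (f (cis 0))) addrC.
apply: le_trans (ler_normD _ _) _; rewrite lerD2l; apply: (le_trans h).
have : enorm (u - cis 0) <= 4.
  have [th _ <-] := base_exists u1; apply: le_trans (enorm_le_sum _) _ => /=.
  have := cos_max th; have := sin_max th; have := cos_max (0 : R); have := sin_max (0 : R).
  have := ler_normB (cos th) (cos 0); have := ler_normB (sin th) (sin 0).
  by lra.
move=> h4; apply: (@le_trans _ _ (`|L| * enorm (u - cis 0))).
  by apply: ler_wpM2r; [exact: enorm_ge0|exact: ler_norm].
exact: ler_wpM2l.
Qed.

End Perturbation.

(** * Vectors of a sector with lam in a given range *)

Section ClassSums.
Variables (R : realType) (w : int * int -> int * int).
Hypothesis shortest_w : forall v, primitive v -> shortest_solution R v (w v).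
Variables (b1 b2 : bool) (a l : R).
Hypotheses (a_itv : 0 <= a < 2 * pi) (l_itv : 0 < l <= 2 * pi).
Variables (s t : R) (I : R -> bool).
Hypotheses (sE : s = 0 \/ s = - (1 / 2)) (tE : t = 0 \/ t = 1 / 2) (st : s <= t).
Hypotheses (I1 : forall x, s < x < t -> I x) (I2 : forall x, I x -> s <= x <= t).
Variable V : set (int * int).
Hypothesis VE : forall v, primitive v ->
  V v <-> in_sector b1 b2 a l v && I (lam R v (w v)).
Local Notation dir_v := (fun v => dir (vec R v)).
Local Notation dir_w := (fun v => dir (vec R (w v))).
Local Notation circle_lipschitz :=
  (lipschitz_wrt (fun y z : R * R => enorm (y - z)) (@circle R)).

Let s0 : - (1 / 2) <= s. Proof. by case: sE => ->; lra. Qed.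
Let t1 : t <= 1 / 2. Proof. by case: tE => ->; lra. Qed.

Lemma class_big (F : int * int -> R) (r : R) : 2 <= r ->
  \sum_(v <- disc r | `[< V v >]) F v =
  \sum_(v <- disc r | in_sector b1 b2 a l v && I (lam R v (w v))) F v.
Proof.
move=> r2; have r0 : 0 <= r by lra.
rewrite big_seq_cond [RHS]big_seq_cond; apply: eq_bigl => v.
case: (boolP (v \in disc r)) => //=; rewrite mem_disc // => /andP[pv _].
by rewrite (asbool_equiv_eq (VE pv)) asboolb.
Qed.

Lemma class_size (T : Type) (x : int * int -> T) :
  sum_asymptotic V x (fun=> 1) ((t - s) * l).
Proof.
exists (sector_const R) => r r2; rewrite class_big //.
rewrite -big_filter big_const_seq count_predT iter_addr_0 mulrA.
exact: sector_size_count.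
Qed.

Lemma class_dir (f : R * R -> R) : circle_lipschitz f ->
  sum_asymptotic V dir_v f ((t - s) * \int[@arc_length R]_(u in arc b1 b2 a l) f u).
Proof.
move=> lip; have [C h] := circle_sum shortest_w b1 b2 a_itv l_itv sE tE st I1 I2 a_itv lip.
exists C => r r2; rewrite class_big //; have := h r r2; congr (`|_ - _| <= _).
rewrite big_seq_cond [RHS]big_seq_cond; apply: eq_bigr => v.
by rewrite mem_disc; [move=> /andP[/andP[pv _] _]; rewrite cis_offset|lra].
Qed.

Lemma class_opp_dir (f : R * R -> R) : circle_lipschitz f ->
  sum_asymptotic V (fun v => - dir (vec R v)) f
    ((t - s) * \int[@arc_length R]_(u in opp_set (arc b1 b2 a l)) f u).
Proof.
move=> lip; have [c cp ce] := opposite_base a; rewrite (opp_arc _ _ _ ce).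
have [C h] := circle_sum shortest_w b1 b2 a_itv l_itv sE tE st I1 I2 cp lip.
exists C => r r2; rewrite class_big //; have := h r r2; congr (`|_ - _| <= _).
rewrite big_seq_cond [RHS]big_seq_cond; apply: eq_bigr => v.
by rewrite mem_disc; [move=> /andP[/andP[pv _] _]; rewrite ce cis_offset|lra].
Qed.

Lemma class_ratio (f : R -> R) : lipschitz_wrt (fun y z : R => `|y - z|) [set: R] f ->
  sum_asymptotic V (fun v => enorm (vec R (w v)) / enorm (vec R v)) f
    (2 * (t - s) * l * \int[@lebesgue_measure R]_(x in `[0, 1 / 2]) f x).
Proof.
move=> lip; have [C h] := line_sum shortest_w b1 b2 a_itv l_itv sE tE st I1 I2 lip.
have [L lipL] := lip.
apply: (@sum_asymptotic_perturb _ _ _ _ (fun v => `|lam R v (w v)|) f _ _ `|L|) => //.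
  move=> v pv _; apply: le_trans (lipL _ _ _ _) _ => //.
  apply: (@le_trans _ _ (`|L| * `|enorm (vec R (w v)) / enorm (vec R v) - `|lam R v (w v)| |)).
    by apply: ler_wpM2r => //; exact: ler_norm.
  by apply: ler_wpM2l => //; apply: companion_ratio => //; case: (shortest_w pv).
by exists C => r r2; rewrite class_big //; exact: h.
Qed.

Lemma class_dir_w_pos (f : R * R -> R) : (forall x, I x -> 0 < x) -> circle_lipschitz f ->
  sum_asymptotic V dir_w f ((t - s) * \int[@arc_length R]_(u in arc b1 b2 a l) f u).
Proof.
move=> Ipos lip; have [L lipL] := lip.
apply: (@sum_asymptotic_perturb _ _ _ _ dir_v f _ _ (`|L| * 4)); last exact: class_dir.
  by rewrite mulr_ge0.
move=> v pv /(VE pv)/andP[_ /Ipos lp]; have [g _] := shortest_w pv.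
have := companion_dir_pos pv g lp; set e := enorm _ => h.
have dw1 : enorm (dir (vec R (w v))) = 1.
  by rewrite enorm_dir_vec //; exact: gcd_solution_neq0 g.
apply: le_trans (lipL _ _ dw1 (enorm_dir_vec R pv)) _.
apply: (@le_trans _ _ (`|L| * e)).
  by apply: ler_wpM2r; [exact: enorm_ge0|exact: ler_norm].
by rewrite -mulrA; exact: ler_wpM2l.
Qed.

Lemma class_dir_w_neg (f : R * R -> R) : (forall x, I x -> x < 0) -> circle_lipschitz f ->
  sum_asymptotic V dir_w f
    ((t - s) * \int[@arc_length R]_(u in opp_set (arc b1 b2 a l)) f u).
Proof.
move=> Ineg lip; have [L lipL] := lip.
apply: (@sum_asymptotic_perturb _ _ _ _ (fun v => - dir (vec R v)) f _ _ (`|L| * 4)); last exact: class_opp_dir.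
  by rewrite mulr_ge0.
move=> v pv /(VE pv)/andP[_ /Ineg lp]; have [g _] := shortest_w pv.
have := companion_dir_neg pv g lp; rewrite -[X in _ + X]opprK; set e := enorm _ => h.
have dw1 : enorm (dir (vec R (w v))) = 1.
  by rewrite enorm_dir_vec //; exact: gcd_solution_neq0 g.
have dv1 : enorm (- dir (vec R v)) = 1.
  by have [th _ <-] := base_exists (enorm_dir_vec R pv); rewrite -cisDpi enorm_cis.
apply: le_trans (lipL _ _ dw1 dv1) _.
apply: (@le_trans _ _ (`|L| * e)).
  by apply: ler_wpM2r; [exact: enorm_ge0|exact: ler_norm].
by rewrite -mulrA; exact: ler_wpM2l.
Qed.

End ClassSums.

Section EquidistributionCriteria.
Variable R : realType.
Implicit Types (V : set (int * int)) (k c : R).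

(** In the applications [k] is the length of the range of [lam] in one sign class or in all; it
    multiplies counts and sums alike and cancels. *)
Lemma equidistributed_circleI V (x : int * int -> R * R) (X : set (R * R)) k c :
  (forall v, V v -> primitive v) -> 0 < k -> 0 < c -> arc_length X = c%:E ->
  sum_asymptotic V x (fun=> 1) (k * c) ->
  (forall f, lipschitz_wrt (fun y z : R * R => enorm (y - z)) (@circle R) f ->
     sum_asymptotic V x f (k * \int[@arc_length R]_(u in X) f u)) ->
  equidistributed_circle V x X (@rate R).
Proof.
move=> Vp k0 c0 Xc size1 sums.
apply: (@equidistributed_of_sums R _ _ _ _ V x (k * c) (fun f => k * \int[@arc_length R]_(u in X) f u)) => //.
  exact: mulr_gt0.
move=> f lip; split; last exact: sums.
rewrite /mean; have -> : fine (arc_length X) = c by rewrite Xc.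
by rewrite invfM mulrACA divff ?mul1r // gt_eqF.
Qed.

Lemma equidistributed_lineI V (x : int * int -> R) k :
  (forall v, V v -> primitive v) -> 0 < k ->
  sum_asymptotic V x (fun=> 1) k ->
  (forall f, lipschitz_wrt (fun y z : R => `|y - z|) [set: R] f ->
     sum_asymptotic V x f (2 * k * \int[@lebesgue_measure R]_(u in `[0, 1 / 2]) f u)) ->
  equidistributed_line V x `[0, 1 / 2] (@rate R).
Proof.
move=> Vp k0 size1 sums.
apply: (@equidistributed_of_sums R _ _ _ _ V x k (fun f => 2 * k * \int[@lebesgue_measure R]_(u in `[0, 1 / 2]) f u)) => //.
move=> f lip; split; last exact: sums.
have h2 : 0 < 1 / 2 :> R by lra.
rewrite /mean; have -> : fine (lebesgue_measure `[0, 1 / 2]) = 1 / 2 :> R.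
  by rewrite lebesgue_measure_itv /= lte_fin h2 -EFinB subr0.
by move: (\int[_]_(u in _) _) => J; field; rewrite gt_eqF.
Qed.

End EquidistributionCriteria.

Section ClassEquidistribution.
Variables (R : realType) (w : int * int -> int * int).
Hypothesis shortest_w : forall v, primitive v -> shortest_solution R v (w v).
Variables (b1 b2 : bool) (a l : R).
Hypotheses (a_itv : 0 <= a < 2 * pi) (l_itv : 0 < l <= 2 * pi).
Variables (s t : R) (I : R -> bool).
Hypotheses (sE : s = 0 \/ s = - (1 / 2)) (tE : t = 0 \/ t = 1 / 2) (st : s < t).
Hypotheses (I1 : forall x, s < x < t -> I x) (I2 : forall x, I x -> s <= x <= t).
Variable V : set (int * int).
Hypothesis Vprim : forall v, V v -> primitive v.
Hypothesis VE : forall v, primitive v ->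
  V v <-> in_sector b1 b2 a l v && I (lam R v (w v)).

Let l0 : 0 < l. Proof. by case/andP: l_itv. Qed.
Let mTheta : arc_length (arc b1 b2 a l) = l%:E.
Proof. by apply: arc_lengthP => //; case/andP: l_itv => /ltW -> ->. Qed.
Let mOpp : arc_length (opp_set (arc b1 b2 a l)) = l%:E.
Proof.
have [c cp ce] := opposite_base a; rewrite (opp_arc _ _ _ ce).
by apply: arc_lengthP => //; case/andP: l_itv => /ltW -> ->.
Qed.
Let ts0 : 0 < t - s. Proof. by rewrite subr_gt0. Qed.

Lemma class_equidistributed_ratio :
  equidistributed_line V (fun v => enorm (vec R (w v)) / enorm (vec R v)) `[0, 1 / 2] (@rate R).
Proof.
apply: (@equidistributed_lineI R V _ ((t - s) * l)) => //; first exact: mulr_gt0.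
  exact: (class_size shortest_w a_itv l_itv sE tE (ltW st) I1 I2 VE).
move=> f lip; rewrite [2 * (_ * _)]mulrA.
exact: (class_ratio shortest_w a_itv l_itv sE tE (ltW st) I1 I2 VE).
Qed.

Lemma class_equidistributed_dir :
  equidistributed_circle V (fun v => dir (vec R v)) (arc b1 b2 a l) (@rate R).
Proof.
apply: (@equidistributed_circleI R V _ _ (t - s) l) => //.
  exact: (class_size shortest_w a_itv l_itv sE tE (ltW st) I1 I2 VE).
move=> f lip.
exact: (class_dir shortest_w a_itv l_itv sE tE (ltW st) I1 I2 VE).
Qed.

Lemma class_equidistributed_companion_pos : (forall x, I x -> 0 < x) ->
  equidistributed_circle V (fun v => dir (vec R (w v))) (arc b1 b2 a l) (@rate R).
Proof.
move=> Ipos; apply: (@equidistributed_circleI R V _ _ (t - s) l) => //.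
  exact: (class_size shortest_w a_itv l_itv sE tE (ltW st) I1 I2 VE).
move=> f lip.
exact: (class_dir_w_pos shortest_w a_itv l_itv sE tE (ltW st) I1 I2 VE).
Qed.

Lemma class_equidistributed_companion_neg : (forall x, I x -> x < 0) ->
  equidistributed_circle V (fun v => dir (vec R (w v))) (opp_set (arc b1 b2 a l)) (@rate R).
Proof.
move=> Ineg; apply: (@equidistributed_circleI R V _ _ (t - s) l) => //.
  exact: (class_size shortest_w a_itv l_itv sE tE (ltW st) I1 I2 VE).
move=> f lip.
exact: (class_dir_w_neg shortest_w a_itv l_itv sE tE (ltW st) I1 I2 VE).
Qed.

End ClassEquidistribution.

Lemma circle_integrable (R : realType) (f : R * R -> R) (X : set (R * R)) :
  lipschitz_wrt (fun y z : R * R => enorm (y - z)) (@circle R) f ->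
  measurable X -> (arc_length X < +oo)%E -> (forall u, X u -> enorm u = 1) ->
  (@arc_length R).-integrable X (EFin \o f).
Proof.
move=> lip mX finX X1; have [B B0 fB] := lipschitz_circle_bound lip; have [L lipL] := lip.
apply: measurable_bounded_integrable => //.
  apply: (eq_measurable_fun (fun u => f (cis (0 + arc_param 0 u)))).
    by move=> u /[!inE] /X1 u1; rewrite cis_arc_param.
  have mphi : measurable_fun [set: R] (fun x => f (cis (0 + x))).
    by apply: continuous_measurable_fun; exact: (lipschitz_continuous (lip_cis 0 lipL)).
  exact: measurable_funTS (measurableT_comp mphi (measurable_arc_param 0)).
by exists B; split; [exact: num_real|move=> y By u /X1 /fB /le_trans; apply; exact: ltW].
Qed.

Section SectorEquidistribution.
Variables (R : realType) (w : int * int -> int * int).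
Hypothesis shortest_w : forall v, primitive v -> shortest_solution R v (w v).
Variables (b1 b2 : bool) (a l : R).
Hypotheses (a_itv : 0 <= a < 2 * pi) (l_itv : 0 < l <= 2 * pi).
Local Notation Theta := (arc b1 b2 a l).
Local Notation V := [set v | primitive v /\ sector Theta (vec R v)].
Local Notation Vpos := [set v | V v /\ positive_vector R v (w v)].
Local Notation Vneg := [set v | V v /\ negative_vector R v (w v)].
Local Notation ratio := (fun v => enorm (vec R (w v)) / enorm (vec R v)).
Local Notation dir_v := (fun v => dir (vec R v)).
Local Notation dir_w := (fun v => dir (vec R (w v))).
Local Notation lamw v := (lam R v (w v)).

Let l0 : 0 < l. Proof. by case/andP: l_itv. Qed.
Let mTheta : arc_length Theta = l%:E.
Proof. by apply: arc_lengthP => //; case/andP: l_itv => /ltW -> ->. Qed.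

(** The value [lam = 0], a right angle, is in the full range but in neither of the signed ones. *)
Definition full_range (x : R) := - (1 / 2) <= x <= 1 / 2.
Definition pos_range (x : R) := 0 < x <= 1 / 2.
Definition neg_range (x : R) := - (1 / 2) <= x < 0.

Lemma full_rangeP : [/\ (- (1 / 2) <= 1 / 2 :> R),
  forall x, - (1 / 2) < x < 1 / 2 -> full_range x & forall x, full_range x -> - (1 / 2) <= x <= 1 / 2].
Proof. by split=> [|x /andP[*]|x //]; [lra|apply/andP; split; lra]. Qed.

Lemma pos_rangeP : [/\ (0 <= 1 / 2 :> R),
  forall x, 0 < x < 1 / 2 -> pos_range x & forall x, pos_range x -> 0 <= x <= 1 / 2].
Proof. by split=> [|x /andP[*]|x /andP[*]]; [lra|apply/andP; split; lra|apply/andP; split; lra]. Qed.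

Lemma neg_rangeP : [/\ (- (1 / 2) <= 0 :> R),
  forall x, - (1 / 2) < x < 0 -> neg_range x & forall x, neg_range x -> - (1 / 2) <= x <= 0].
Proof. by split=> [|x /andP[*]|x /andP[*]]; [lra|apply/andP; split; lra|apply/andP; split; lra]. Qed.

Lemma sector_primitive v : primitive v -> sector Theta (vec R v) <-> in_sector b1 b2 a l v.
Proof.
move=> pv; split=> [[_ h]|/asboolP h]; first exact/asboolP.
split=> //; apply/eqP => v0; have := enorm_vec_gt0 R pv.
by rewrite v0 /enorm /= expr0n /= addr0 sqrtr0 ltxx.
Qed.

Lemma lamw_range v : primitive v -> - (1 / 2) <= lamw v <= 1 / 2.
Proof. by move=> pv; rewrite -ler_norml; apply: lam_le_half => //; exact: shortest_w. Qed.

Lemma V_class v : primitive v -> V v <-> in_sector b1 b2 a l v && full_range (lamw v).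
Proof.
move=> pv; rewrite /full_range lamw_range // andbT.
by split=> [[_ /(sector_primitive pv)]|/(sector_primitive pv) sv].
Qed.

Lemma Vpos_class v : primitive v -> Vpos v <-> in_sector b1 b2 a l v && pos_range (lamw v).
Proof.
move=> pv; have /andP[_ h] := lamw_range pv; have [g _] := shortest_w pv.
rewrite /pos_range h andbT; split=> [[[_ /(sector_primitive pv) ->]] /(positive_vectorE R pv g) //|].
by move=> /andP[/(sector_primitive pv) sv /(positive_vectorE R pv g) ps].
Qed.

Lemma Vneg_class v : primitive v -> Vneg v <-> in_sector b1 b2 a l v && neg_range (lamw v).
Proof.
move=> pv; have /andP[h _] := lamw_range pv; have [g _] := shortest_w pv.
rewrite /neg_range h /=; split=> [[[_ /(sector_primitive pv) ->]] /(negative_vectorE R pv g) //|].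
by move=> /andP[/(sector_primitive pv) sv /(negative_vectorE R pv g) ps].
Qed.

(* The exceptional vectors, for which the sign of [lam] may fail to tell whether
   the direction of [w v] is in the arc or in its opposite. *)
Definition near_end (v : int * int) : bool :=
  in_sector b1 b2 a l v &&
  [|| offset a v <= 2 / enorm (vec R v), l - 2 / enorm (vec R v) <= offset a v | lamw v == 0].

Lemma near_end_count (r : R) : 2 <= r ->
  \sum_(v <- disc r) (near_end v)%:R <= (2 * 20026%:R + sector_const R) * errf r.
Proof.
move=> r2; have r0 : 0 <= r by lra.
have [a0 a2] := andP a_itv; have [_ l2] := andP l_itv; have pi0 := @pi_gt0 R.
have tau v : v \in disc r -> dir (vec R v) = cis (a + offset a v).
  by rewrite mem_disc // => /andP[pv _]; rewrite cis_offset.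
have h1 : \sum_(v <- disc r) (offset a v <= 2 / enorm (vec R v))%R%:R <= 20026%:R * errf r.
  apply: (near_ray_count shortest_w (b := a)) => //.
    by rewrite a0 (le_trans (ltW a2)) // ler_pM2r // ler_nat.
  move=> v vd tv; exists (a + offset a v); split; first exact: tau.
  by rewrite addrAC subrr add0r ger0_norm // offset_ge0.
have h2 : \sum_(v <- disc r) (in_sector b1 b2 a l v && (l - 2 / enorm (vec R v) <= offset a v)%R)%:R
    <= 20026%:R * errf r.
  apply: (near_ray_count shortest_w (b := a + l)) => //.
    apply/andP; split; first by rewrite addr_ge0 // ltW.
    rewrite (_ : 4 * pi = 2 * pi + 2 * pi); last by rewrite -mulrDl -natrD.
    by rewrite lerD // ltW.
  move=> v vd /andP[sv tv]; exists (a + offset a v); split; first exact: tau.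
  rewrite opprD addrACA subrr add0r distrC ger0_norm ?subr_ge0 ?(offset_le a_itv l_itv sv) //.
  by rewrite lerBlDr -lerBlDl.
(* The vectors with [lam = 0] are counted with the degenerate range [s = t = 0], whose main term
   vanishes. *)
have I1 (x : R) : 0 < x < 0 -> x == 0 by move=> /andP[p /(lt_trans p)]; rewrite ltxx.
have I2 (x : R) : x == 0 -> 0 <= x <= 0 by move=> /eqP ->; rewrite lexx.
have m0 : - (1 / 2) <= 0 :> R by lra.
have p0 : 0 <= 1 / 2 :> R by lra.
have h3 := sector_size_count shortest_w b1 b2 a_itv l_itv r2 m0 (lexx 0) p0 I1 I2.
rewrite subrr mulr0 mul0r subr0 in h3.
have {}h3 := le_trans (ler_norm _) h3.
rewrite -sum1_size natr_sum big_filter big_mkcond /= in h3.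
move: (20026%:R : R) (sector_const R) h1 h2 h3 => c d h1 h2 h3.
rewrite mulrDl mulr_natl mulr2n mulrDl.
apply: le_trans (lerD (lerD h1 h2) h3); rewrite -!big_split /=; apply: ler_sum => v _.
rewrite /near_end; case: in_sector => /=; last by rewrite !addr0.
case: (_ <= 2 / _); case: (_ <= offset a v); case: (_ == 0) => /=; lra.
Qed.

(** The direction of [w], or its opposite if [lam < 0], arises from that of [v] by a turn of at most
    [2 / |v|], so it is still interior to the arc; as [l <= pi], its opposite is then outside. *)
Lemma away_from_ends v : primitive v -> in_sector b1 b2 a l v -> ~~ near_end v -> l <= pi ->
  (0 < lamw v /\ Theta (dir_w v) /\ ~ Theta (- dir_w v)) \/
  (lamw v < 0 /\ Theta (- dir_w v) /\ ~ Theta (dir_w v)).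
Proof.
move=> pv sv; rewrite /near_end sv /= !negb_or -!ltNge => /and3P[t1 t2 l00] lpi.
have [g _] := shortest_w pv; have [al [[/andP[al0 alp] _ rot pos neg] _]] := companion_turn R pv g.
have {}rot := rot _ (esym (cis_offset a pv)).
case: (ltgtP (lamw v) 0) l00 => // [ln|lp] _; [right|left]; split=> //.
  have [_ b2'] := neg ln.
  have x1 : 0 < offset a v + (pi - al) < l.
    rewrite addr_gt0 ?subr_gt0 ?(le_lt_trans _ t1) ?divr_ge0 ?enorm_ge0 //=.
    by rewrite -ltrBrDr (lt_le_trans t2) // lerB.
  have [h1 h2] := @arc_interior R b1 b2 a l _ a_itv lpi x1.
  have e : - dir (vec R (w v)) = cis (a + (offset a v + (pi - al))).
    by rewrite rot -cisDpi; congr cis; ring.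
  by rewrite e; split=> //; rewrite -[dir _]opprK e.
have [_ b2'] := pos (ltW lp).
have x1 : 0 < offset a v - al < l.
  rewrite subr_gt0 (le_lt_trans b2' t1) /= ltrBlDr (le_lt_trans (offset_le a_itv l_itv sv)) //.
  by rewrite ltrDl.
have [h1 h2] := @arc_interior R b1 b2 a l _ a_itv lpi x1.
by rewrite rot -addrA.
Qed.

Let half0 : 0 < 1 / 2 :> R. Proof. by lra. Qed.

Local Notation circle_lipschitz :=
  (lipschitz_wrt (fun y z : R * R => enorm (y - z)) (@circle R)).

Let posI1 := let: And3 _ h _ := pos_rangeP in h.
Let posI2 := let: And3 _ _ h := pos_rangeP in h.
Let negI1 := let: And3 _ h _ := neg_rangeP in h.
Let negI2 := let: And3 _ _ h := neg_rangeP in h.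
Let pos_st : 0 <= 1 / 2 :> R. Proof. by lra. Qed.
Let neg_st : - (1 / 2) <= 0 :> R. Proof. by lra. Qed.

Lemma pos_size (T : Type) (x : int * int -> T) : sum_asymptotic Vpos x (fun=> 1) (1 / 2 * l).
Proof.
have := class_size shortest_w a_itv l_itv (or_introl erefl) (or_intror erefl)
  pos_st posI1 posI2 Vpos_class x.
by rewrite subr0.
Qed.

Lemma neg_size (T : Type) (x : int * int -> T) : sum_asymptotic Vneg x (fun=> 1) (1 / 2 * l).
Proof.
have := class_size shortest_w a_itv l_itv (or_intror erefl) (or_introl erefl)
  neg_st negI1 negI2 Vneg_class x.
by rewrite sub0r opprK.
Qed.

Lemma pos_dir_w (f : R * R -> R) : circle_lipschitz f ->
  sum_asymptotic Vpos dir_w f (1 / 2 * \int[@arc_length R]_(u in Theta) f u).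
Proof.
move=> lip.
have := class_dir_w_pos shortest_w a_itv l_itv (or_introl erefl) (or_intror erefl)
  pos_st posI1 posI2 Vpos_class _ lip.
by rewrite subr0; apply => x /andP[].
Qed.

Lemma neg_dir_w (f : R * R -> R) : circle_lipschitz f ->
  sum_asymptotic Vneg dir_w f (1 / 2 * \int[@arc_length R]_(u in opp_set Theta) f u).
Proof.
move=> lip.
have := class_dir_w_neg shortest_w a_itv l_itv (or_intror erefl) (or_introl erefl)
  neg_st negI1 negI2 Vneg_class _ lip.
by rewrite sub0r opprK; apply => x /andP[].
Qed.

Let mOpp : arc_length (opp_set Theta) = l%:E.
Proof.
have [c cp ce] := opposite_base a; rewrite (opp_arc _ _ _ ce).
by apply: arc_lengthP => //; case/andP: l_itv => /ltW -> ->.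
Qed.

Let measTheta : measurable Theta.
Proof. by apply: measurable_arc => //; case/andP: l_itv => /ltW -> ->. Qed.

Let measOpp : measurable (opp_set Theta).
Proof.
have [c cp ce] := opposite_base a; rewrite (opp_arc _ _ _ ce).
by apply: measurable_arc => //; case/andP: l_itv => /ltW -> ->.
Qed.

Section Among.
Hypothesis l_pi : l <= pi.
Local Notation among X := [set v | V v /\ X (dir_w v)].

(** [among X] tests the direction of [w], while [Z] is described by the sign of [lam]. Inside the
    sector the two disagree at most on [near_end], which is negligible. *)
Lemma among_transfer (X : set (R * R)) (Z : set (int * int)) (f : R * R -> R) (B c : R) :
  0 <= B -> (forall u, enorm u = 1 -> `|f u| <= B) ->
  (forall v, Z v -> V v) ->
  (forall v, primitive v -> in_sector b1 b2 a l v -> ~~ near_end v -> Z v <-> X (dir_w v)) ->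
  sum_asymptotic Z dir_w f c -> sum_asymptotic (among X) dir_w f c.
Proof.
move=> B0 fB ZV ZX.
apply: (@sum_asymptotic_change _ _ _ _ _ _ (fun=> near_end) B _ _ B0); last 1 first.
- move=> r v; rewrite mem_filter => /andP[/andP[pv _] _] nb; split=> [Zv|[Vv Xv]].
    have Vv := ZV _ Zv; split=> //; apply/(ZX v pv) => //.
    by case: Vv => _ /(sector_primitive pv).
  by apply/(ZX v pv) => //; case: Vv => _ /(sector_primitive pv).
- move=> v pv; apply: fB; apply: enorm_dir_vec.
  by have [g _] := shortest_w pv; exact: gcd_solution_neq0 g.
exact: near_end_count.
Qed.

Lemma pos_companion v : primitive v -> in_sector b1 b2 a l v -> ~~ near_end v ->
  Vpos v <-> Theta (dir_w v).
Proof.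
move=> pv sv nb; have [g _] := shortest_w pv; have Vv : V v by split=> //; apply/sector_primitive.
case: (away_from_ends pv sv nb l_pi) => -[lv [h1 h2]].
  by split=> // _; split=> //; apply/(positive_vectorE R pv g).
by split=> // -[_ /(positive_vectorE R pv g)] /(lt_trans lv); rewrite ltxx.
Qed.

Lemma neg_companion v : primitive v -> in_sector b1 b2 a l v -> ~~ near_end v ->
  Vneg v <-> opp_set Theta (dir_w v).
Proof.
move=> pv sv nb; have [g _] := shortest_w pv; have Vv : V v by split=> //; apply/sector_primitive.
rewrite (opp_setE Theta).
case: (away_from_ends pv sv nb l_pi) => -[lv [h1 h2]].
  by split=> // -[_ /(negative_vectorE R pv g)] /(lt_trans lv); rewrite ltxx.
by split=> // _; split=> //; apply/(negative_vectorE R pv g).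
Qed.

Lemma among_arc : equidistributed_circle (among Theta) dir_w Theta (@rate R).
Proof.
have sub v : Vpos v -> V v by case.
apply: (@equidistributed_circleI R _ _ _ (1 / 2) l) => //; first by move=> v [[]].
  by apply: (among_transfer (B := 1) _ _ sub pos_companion (pos_size _)) => // u _; rewrite normr1.
move=> f lip; have [B B0 fB] := lipschitz_circle_bound lip.
exact: (among_transfer B0 fB sub pos_companion (pos_dir_w lip)).
Qed.

Lemma among_opp : equidistributed_circle (among (opp_set Theta)) dir_w (opp_set Theta) (@rate R).
Proof.
have sub v : Vneg v -> V v by case.
apply: (@equidistributed_circleI R _ _ _ (1 / 2) l) => //; first by move=> v [[]].
  by apply: (among_transfer (B := 1) _ _ sub neg_companion (neg_size _)) => // u _; rewrite normr1.
move=> f lip; have [B B0 fB] := lipschitz_circle_bound lip.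
exact: (among_transfer B0 fB sub neg_companion (neg_dir_w lip)).
Qed.

Lemma overlap0 : arc_length (Theta `&` opp_set Theta) = 0%E.
Proof. exact: arc_opp_overlap. Qed.

Lemma arc_length_union : arc_length (Theta `|` opp_set Theta) = (2 * l)%:E.
Proof.
have mD := measurableD measOpp measTheta.
have -> : Theta `|` opp_set Theta = Theta `|` (opp_set Theta `\` Theta).
  by apply/seteqP; split => x; [move=> [Ax|Bx]; [left|have [Ax|nA] := pselect (Theta x); [left|right]]|move=> [Ax|[Bx _]]; [left|right]].
have D : arc_length (opp_set Theta `\` Theta) = l%:E.
  have : arc_length (opp_set Theta) =
      (arc_length (opp_set Theta `\` Theta) + arc_length (opp_set Theta `&` Theta))%E.
    exact: measureDI.
  rewrite mOpp [X in (_ + X)%E](_ : _ = 0%E) ?adde0 // setIC; exact: overlap0.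
rewrite measureU //; last by apply/seteqP; split => x // [Ax []].
rewrite [X in (X + _)%E = _]mTheta [X in (_ + X)%E = _]D -EFinD; congr _%:E.
by rewrite mulr_natl mulr2n.
Qed.

Lemma among_union :
  equidistributed_circle (among (Theta `|` opp_set Theta)) dir_w (Theta `|` opp_set Theta) (@rate R).
Proof.
have sub v : (Vpos `|` Vneg) v -> V v by move=> [[]|[]].
have dis v : Vpos v -> ~ Vneg v.
  move=> [[pv _]]; have [g _] := shortest_w pv.
  by move=> /(positive_vectorE R pv g) p [_] /(negative_vectorE R pv g) /(lt_trans p); rewrite ltxx.
have comp v : primitive v -> in_sector b1 b2 a l v -> ~~ near_end v ->
    (Vpos `|` Vneg) v <-> (Theta `|` opp_set Theta) (dir_w v).
  move=> pv sv nb; have p := pos_companion pv sv nb; have n := neg_companion pv sv nb.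
  by split=> -[h|h]; [left; apply/p|right; apply/n|left; apply/p|right; apply/n].
(* Each sign class contributes [1/2 * l], the range of [lam] having length [1/2]; their union thus
   has [1/2] times the length [2 l] of the two arcs. *)
apply: (@equidistributed_circleI R _ _ _ (1 / 2) (2 * l)) => //; first by move=> v [[]].
- exact: mulr_gt0.
- exact: arc_length_union.
- rewrite mulr_natl mulr2n mulrDr.
  have size2 := sum_asymptotic_union dis (pos_size dir_w) (neg_size dir_w).
  by apply: (among_transfer (B := 1) _ _ sub comp size2) => // u _; rewrite normr1.
move=> f lip; have [B B0 fB] := lipschitz_circle_bound lip.
rewrite Rintegral_setU_null //; last exact: overlap0.
  rewrite mulrDr; apply: (among_transfer B0 fB sub comp).
  exact: sum_asymptotic_union dis (pos_dir_w lip) (neg_dir_w lip).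
apply: circle_integrable => //.
- exact: measurableU.
- by rewrite arc_length_union ltry.
have [c cp ce] := opposite_base a; rewrite (opp_arc _ _ _ ce).
by move=> u [|]; exact: arc_circle.
Qed.

End Among.

Lemma sector_equidistribution :
  let among X := equidistributed_circle [set v | V v /\ X (dir_w v)] dir_w X (@rate R) in
  equidistributed_line V ratio `[0, 1 / 2] (@rate R) /\
  equidistributed_circle V dir_v Theta (@rate R) /\
  (equidistributed_circle Vpos dir_w Theta (@rate R) /\
   equidistributed_circle Vneg dir_w (opp_set Theta) (@rate R) /\
   ((arc_length Theta <= pi%:E)%E ->
      among Theta /\ among (opp_set Theta) /\ among (Theta `|` opp_set Theta))) /\
  (equidistributed_line Vpos ratio `[0, 1 / 2] (@rate R) /\
   equidistributed_line Vneg ratio `[0, 1 / 2] (@rate R) /\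
   equidistributed_circle Vpos dir_v Theta (@rate R) /\
   equidistributed_circle Vneg dir_v Theta (@rate R)).
Proof.
have [_ f1 f2] := full_rangeP.
have fst : - (1 / 2) < 1 / 2 :> R by lra.
have pst : 0 < 1 / 2 :> R by lra.
have nst : - (1 / 2) < 0 :> R by lra.
have Vp v : V v -> primitive v by case.
have Vpp v : Vpos v -> primitive v by move=> [[]].
have Vnp v : Vneg v -> primitive v by move=> [[]].
split.
  exact: (class_equidistributed_ratio shortest_w a_itv l_itv (or_intror erefl) (or_intror erefl) fst f1 f2 Vp V_class).
split.
  exact: (class_equidistributed_dir shortest_w a_itv l_itv (or_intror erefl) (or_intror erefl) fst f1 f2 Vp V_class).
split; last first.
  split; first exact: (class_equidistributed_ratio shortest_w a_itv l_itv (or_introl erefl) (or_intror erefl) pst posI1 posI2 Vpp Vpos_class).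
  split; first exact: (class_equidistributed_ratio shortest_w a_itv l_itv (or_intror erefl) (or_introl erefl) nst negI1 negI2 Vnp Vneg_class).
  split; first exact: (class_equidistributed_dir shortest_w a_itv l_itv (or_introl erefl) (or_intror erefl) pst posI1 posI2 Vpp Vpos_class).
  exact: (class_equidistributed_dir shortest_w a_itv l_itv (or_intror erefl) (or_introl erefl) nst negI1 negI2 Vnp Vneg_class).
split.
  apply: (class_equidistributed_companion_pos shortest_w a_itv l_itv (or_introl erefl) (or_intror erefl) pst posI1 posI2 Vpp Vpos_class).
  by move=> x /andP[].
split.
  apply: (class_equidistributed_companion_neg shortest_w a_itv l_itv (or_intror erefl) (or_introl erefl) nst negI1 negI2 Vnp Vneg_class).
  by move=> x /andP[].
rewrite mTheta lee_fin => lpi.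
by split; [exact: among_arc|split; [exact: among_opp|exact: among_union]].
Qed.

End SectorEquidistribution.

Theorem theorem2p1 (R : realType) (Theta : set (R * R))
    (arcTheta : is_arc Theta) (Theta_gt0 : (0 < arc_length Theta)%E)
    (w : int * int -> int * int)
    (shortest_w : forall v, primitive v -> shortest_solution R v (w v)) :
  let V := [set v | primitive v /\ sector Theta (vec R v)] in
  let Vpos := [set v | V v /\ positive_vector R v (w v)] in
  let Vneg := [set v | V v /\ negative_vector R v (w v)] in
  let ratio := fun v => enorm (vec R (w v)) / enorm (vec R v) in
  let dir_v := fun v => dir (vec R v) in
  let dir_w := fun v => dir (vec R (w v)) in
  let rate := fun r : R => r `^ (- (1 / 4)) * ln r in
  let equidistributed_among X :=
    equidistributed_circle [set v | V v /\ X (dir_w v)] dir_w X rate in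
  equidistributed_line V ratio `[0, 1 / 2] rate /\
  equidistributed_circle V dir_v Theta rate /\
  (equidistributed_circle Vpos dir_w Theta rate /\
   equidistributed_circle Vneg dir_w (opp_set Theta) rate /\
   ((arc_length Theta <= pi%:E)%E ->
      equidistributed_among Theta /\
      equidistributed_among (opp_set Theta) /\
      equidistributed_among (Theta `|` opp_set Theta))) /\
  (equidistributed_line Vpos ratio `[0, 1 / 2] rate /\
   equidistributed_line Vneg ratio `[0, 1 / 2] rate /\
   equidistributed_circle Vpos dir_v Theta rate /\
   equidistributed_circle Vneg dir_v Theta rate).

Proof.
have [a [l [b1 [b2 [ap lp ->]]]]] := is_arc_normal arcTheta Theta_gt0.
exact: sector_equidistribution.
Qed.
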